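(* Let $\sigma$ be a SODE on $M$. There is a unique linear connection $\nabla^\sigma$ on $M^1$ such that: (1) $\nabla^\sigma X^\sigma=0$; (2) $\nabla^\sigma(L_{X^\sigma}J)=0$; (3) if $E^\sigma\colon T(M^1)\to T(M^1)$ is the endomorphism $E^\sigma=J+H^\sigma\circ\varepsilon^{-1}\circ(L_{X^\sigma}J)^v$, then $\nabla^\sigma E^\sigma=0$; (4) the torsion of $\nabla^\sigma$ is the tensor field $$T^\sigma=K^\sigma+dt\wedge\bigl(H^\sigma\circ\varepsilon^{-1}\circ(L_{X^\sigma}J)^v\bigr),$$ where $K^\sigma$ is the curvature form of the splitting $H^\sigma$. This connection coincides with the Chern connection of $\sigma$, i.e. the linear connection on $M^1$ given in every induced coordinate system by $\nabla^\sigma_YX^\sigma=0$ for all $Y$; $\nabla^\sigma_{X^\sigma}X^\sigma_i=-\frac12\frac{\partial F^j}{\partial\dot x^i}X^\sigma_j$, $\nabla^\sigma_{X^\sigma}\frac{\partial}{\partial\dot x^i}=-\frac12\frac{\partial F^j}{\partial\dot x^i}\frac{\partial}{\partial\dot x^j}$; $\nabla^\sigma_{X^\sigma_j}X^\sigma_i=-\frac12\frac{\partial^2F^k}{\partial\dot x^i\partial\dot x^j}X^\sigma_k$, $\nabla^\sigma_{X^\sigma_j}\frac{\partial}{\partial\dot x^i}=-\frac12\frac{\partial^2F^k}{\partial\dot x^i\partial\dot x^j}\frac{\partial}{\partial\dot x^k}$; $\nabla^\sigma_{\partial/\partial\dot x^j}X^\sigma_i=0$, $\nabla^\sigma_{\partial/\partial\dot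 x^j}\frac{\partial}{\partial\dot x^i}=0$.
   Context: $M$ is a connected smooth manifold of dimension $n$; $M^0=\mathbb{R}\times M$ with projections $p\colon M^0\to\mathbb{R}$, $p'\colon M^0\to M$; $M^r=J^r(\mathbb{R},M)$ is the manifold of $r$-jets of smooth maps $\mathbb{R}\to M$, with projections $p^{rs}\colon M^r\to M^s$. Coordinates $(x^i)$ on $M$ induce coordinates $(t,x^i,\dot x^i)$ on $M^1$ and $(t,x^i,\dot x^i,\ddot x^i)$ on $M^2$. The summation convention is used. A SODE on $M$ is a smooth section $\sigma\colon M^1\to M^2$ of $p^{21}$; in coordinates $F^i=\ddot x^i\circ\sigma$. Put $X^\sigma=\frac{\partial}{\partial t}+\dot x^i\frac{\partial}{\partial x^i}+F^i\frac{\partial}{\partial\dot x^i}$ (globally defined), $X^\sigma_i=\frac{\partial}{\partial x^i}+\frac12\frac{\partial F^j}{\partial\dot x^i}\frac{\partial}{\partial\dot x^j}$, $\omega^i=dx^i-\dot x^idt$. $J=\omega^i\otimes\frac{\partial}{\partial\dot x^i}$ is the (globally defined) fundamental tensor of $M^1$, and $L_{X^\sigma}J$ is its Lie derivative along $X^\sigma$, again a field of endomorphisms of $TM^1$. $V(p^{10})$ is the bundle of $p^{10}$-vertical vectors; $\varepsilon\colon(p'\circ p^{10})^*TM\to V(p^{10})$ is the canonical isomorphism $\varepsilon(\partial/\partial x^i)=\partial/\partial\dot x^i$; $H^\sigma\colon(p^{10})^*TM^0\to TM^1$ is the section of $(p^{10})_*$ given by $H^\sigma=dt\otimes X^\sigma+\omega^i\otimes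 X^\sigma_i$. Since $(p'\circ p^{10})^*TM\subset(p^{10})^*TM^0$, the composition $H^\sigma\circ\varepsilon^{-1}$ is defined on $V(p^{10})$ and maps $\partial/\partial\dot x^i$ to $X^\sigma_i$. Every $X\in TM^1$ decomposes as $X=X^h+X^v$ with $X^h=H^\sigma((p^{10})_*X)$ and $X^v=X-X^h\in V(p^{10})$. $(L_{X^\sigma}J)^v$ denotes the endomorphism $X\mapsto((L_{X^\sigma}J)(X))^v$. The curvature form $K^\sigma\in\bigwedge^2T^*M^1\otimes V(p^{10})$ of $H^\sigma$ is $K^\sigma(X,Y)=-[X^h,Y^h]^v$ for $X,Y\in\mathfrak{X}(M^1)$. Conventions: the torsion is $\nabla_XY-\nabla_YX-[X,Y]$, and for an endomorphism field $A$, $(dt\wedge A)(X,Y)=dt(X)A(Y)-dt(Y)A(X)$. *)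

(* Defs.v *)
From HB Require Import structures.
From mathcomp Require Import all_boot all_order all_algebra.
From mathcomp Require Import all_classical all_reals all_analysis.

Set Implicit Arguments.
Unset Strict Implicit.
Unset Printing Implicit Defensive.

Import Order.TTheory GRing.Theory Num.Theory.
Import numFieldNormedType.Exports.

Local Open Scope classical_set_scope.
Local Open Scope ring_scope.

Section Smoothness.
Context {R : realType} {V W : normedModType R}.

(* For finite-dimensional V and open U this is the usual class C^k on U. *)
Fixpoint Ck (k : nat) (U : set V) (f : V -> W) : Prop :=
  if k is k'.+1 then
    (forall x, U x -> differentiable f x) /\
    (forall v : V, Ck k' U (fun x => 'd f x v))
  else forall x, U x -> {for x, continuous f}.

Definition smooth_on (U : set V) (f : V -> W) : Prop := forall k, Ck k U f.

End Smoothness.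

Record chart (P E : Type) := Chart {
  chart_dom : set P;
  chart_map :> P -> E  (* relevant on chart_dom only *)
}.

(* f \o c^-1 on the image of the chart c, extended by 0. *)
Definition coord_rep {P E : Type} {F : zmodType} (c : chart P E) (f : P -> F)
    (y : E) : F :=
  if pselect (exists2 p, chart_dom c p & c p = y) is left h
  then f (projT1 (cid2 h)) else 0.

Section SmoothStructure.
Context {R : realType} {n : nat} {M : topologicalType}.

Definition is_chart (c : chart M 'rV[R]_n) : Prop :=
  [/\ open (chart_dom c),
      set_inj (chart_dom c) c,
      (forall p, chart_dom c p -> {for p, continuous c}) &
      (forall V, open V -> V `<=` chart_dom c -> open (c @` V))].

Definition compatible (c d : chart M 'rV[R]_n) : Prop :=
  smooth_on (c @` (chart_dom c `&` chart_dom d)) (coord_rep c d) /\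
  smooth_on (d @` (chart_dom c `&` chart_dom d)) (coord_rep d c).

(* phi enumerates a maximal atlas, so that "every coordinate system" is
   "every index i". *)
Record smooth_manifold (I : Type) (phi : I -> chart M 'rV[R]_n) : Prop := {
  manifold_hausdorff : hausdorff_space M;
  manifold_second_countable : @second_countable M;
  manifold_charts : forall i, is_chart (phi i);
  manifold_cover : forall p, exists i, chart_dom (phi i) p;
  manifold_compatible : forall i k, compatible (phi i) (phi k);
  manifold_maximal : forall c, is_chart c ->
    (forall i, compatible c (phi i)) -> exists i, phi i = c
}.

End SmoothStructure.

(* Tangent vectors, vector fields and linear connections on the manifold whose
   underlying set P is described by an atlas A of charts into E.  The topology
   of P is the one determined by A.  A tangent vector is represented by the
   family of its components in all the charts of A around the base point;
   components in the other charts carry no meaning, whence the equalities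
   eq_at and eq_on. *)
Section AtlasGeometry.
Context {R : realType} {P I : Type} {E : normedModType R}.
Variable A : I -> chart P E.

Implicit Types (U : set P) (f : P -> R) (v : I -> E) (X Y : P -> I -> E).

Definition open_in U : Prop :=
  forall i, open (A i @` (U `&` chart_dom (A i))).

Definition smooth_fun U (F : normedModType R) (f : P -> F) : Prop :=
  forall i, smooth_on (A i @` (U `&` chart_dom (A i))) (coord_rep (A i) f).

Definition smooth_map {Q K : Type} {F : normedModType R}
    (B : K -> chart Q F) (f : P -> Q) : Prop :=
  forall i k,
    let W := A i @` (chart_dom (A i) `&` f @^-1` chart_dom (B k)) in
    open W /\ smooth_on W (coord_rep (A i) (B k \o f)).

Definition transition i k : E -> E := coord_rep (A i) (A k).

Definition tangent (p : P) v : Prop :=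
  forall i k, chart_dom (A i) p -> chart_dom (A k) p ->
    v k = 'd (transition i k) (A i p) (v i).

Definition eq_at (p : P) v w : Prop :=
  forall i, chart_dom (A i) p -> v i = w i.

Definition eq_on U X Y : Prop := forall p, U p -> eq_at p (X p) (Y p).

Definition vector_field U X : Prop :=
  (forall p, U p -> tangent p (X p)) /\
  (forall i, smooth_on (A i @` (U `&` chart_dom (A i)))
               (coord_rep (A i) (X ^~ i))).

(* The vector field on the domain of chart k with component function w in
   that chart. *)
Definition chart_field k (w : P -> E) : P -> I -> E :=
  fun p i => 'd (transition k i) (A k p) (w p).

(* The derivative X f at p, computed in chart i. *)
Definition dir_deriv i X {F : normedModType R} (f : P -> F) (p : P) : F :=
  'd (coord_rep (A i) f) (A i p) (X p i).

Definition bracket X Y : P -> I -> E :=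
  fun p i => dir_deriv i X (Y ^~ i) p - dir_deriv i Y (X ^~ i) p.

(* Endomorphism fields are operators on vector fields. *)
Definition lie_endo X (L : (P -> I -> E) -> P -> I -> E) :
    (P -> I -> E) -> P -> I -> E :=
  fun Y => bracket X (L Y) - L (bracket X Y).

(* A family, compatible with restriction, of covariant derivatives on the open
   sets of P.  Compatibility makes the value on (X, Y) independent of the open
   set (conn_local), which is therefore not an argument of nabla. *)
Record linear_connection
    (nabla : (P -> I -> E) -> (P -> I -> E) -> P -> I -> E) : Prop := {
  conn_field : forall U X Y, open_in U ->
    vector_field U X -> vector_field U Y -> vector_field U (nabla X Y);
  conn_local : forall U X X' Y Y', open_in U ->
    vector_field U X -> vector_field U X' ->
    vector_field U Y -> vector_field U Y' ->
    eq_on U X X' -> eq_on U Y Y' -> eq_on U (nabla X Y) (nabla X' Y');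
  conn_addl : forall U X X' Y, open_in U ->
    vector_field U X -> vector_field U X' -> vector_field U Y ->
    eq_on U (nabla (X + X') Y) (nabla X Y + nabla X' Y);
  conn_scalel : forall U f X Y, open_in U -> smooth_fun U f ->
    vector_field U X -> vector_field U Y ->
    eq_on U (nabla (fun p => f p *: X p) Y) (fun p => f p *: nabla X Y p);
  conn_addr : forall U X Y Y', open_in U ->
    vector_field U X -> vector_field U Y -> vector_field U Y' ->
    eq_on U (nabla X (Y + Y')) (nabla X Y + nabla X Y');
  conn_leibniz : forall U f X Y, open_in U -> smooth_fun U f ->
    vector_field U X -> vector_field U Y ->
    eq_on U (nabla X (fun p => f p *: Y p))
            (fun p i => dir_deriv i X f p *: Y p i + f p *: nabla X Y p i)
}.

Definition eq_connection
    (nabla nabla' : (P -> I -> E) -> (P -> I -> E) -> P -> I -> E) : Prop :=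
  forall U X Y, open_in U -> vector_field U X -> vector_field U Y ->
    eq_on U (nabla X Y) (nabla' X Y).

Definition parallel_field nabla Y : Prop :=
  forall U X, open_in U -> vector_field U X -> eq_on U (nabla X Y) 0.

Definition parallel_endo nabla (L : (P -> I -> E) -> P -> I -> E) : Prop :=
  forall U X Y, open_in U -> vector_field U X -> vector_field U Y ->
    eq_on U (nabla X (L Y) - L (nabla X Y)) 0.

Definition torsion (nabla : (P -> I -> E) -> (P -> I -> E) -> P -> I -> E) X Y :
    P -> I -> E :=
  nabla X Y - nabla Y X - bracket X Y.

Definition has_torsion nabla
    (T : (P -> I -> E) -> (P -> I -> E) -> P -> I -> E) : Prop :=
  forall U X Y, open_in U -> vector_field U X -> vector_field U Y ->
    eq_on U (torsion nabla X Y) (T X Y).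

End AtlasGeometry.

(* The differential of a map f carrying the domain of A i into that of B i. *)
Definition tangent_map {R : realType} {P Q I : Type} {E F : normedModType R}
    (A : I -> chart P E) (B : I -> chart Q F) (f : P -> Q) (p : P)
    (v : I -> E) : I -> F :=
  fun i => 'd (coord_rep (A i) (B i \o f)) (A i p) (v i).

Section Jets.
Context {R : realType} {n : nat} {M : topologicalType} {I : Type}.
Variable phi : I -> chart M 'rV[R]_n.

Definition smooth_curve (g : R -> M) : Prop :=
  smooth_map (fun _ : unit => Chart [set: R] (id : R -> R)) phi g.

Definition same_jet (r : nat) (t : R) (g h : R -> M) : Prop :=
  g t = h t /\
  forall i, chart_dom (phi i) (g t) -> forall k, (k <= r)%N ->
    derive1n k (phi i \o g) t = derive1n k (phi i \o h) t.

Definition jet_class_of (r : nat) (t : R) (g : R -> M) : set (R -> M) :=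
  [set h | smooth_curve h /\ same_jet r t g h].

(* J^r(R, M); an r-jet is the set of all the curves representing it,
   together with its source. *)
Record jet (r : nat) := Jet {
  jet_source : R;
  jet_class : set (R -> M);
  jet_proof : exists2 g, smooth_curve g &
                jet_class = jet_class_of r jet_source g
}.

Definition jet_curve r (j : jet r) : R -> M := projT1 (cid2 (jet_proof j)).

Lemma jet_curve_smooth r (j : jet r) : smooth_curve (jet_curve j).
Proof. by rewrite /jet_curve; case: cid2. Qed.

Definition mk_jet r (t : R) (g : R -> M) (hg : smooth_curve g) : jet r :=
  Jet (ex_intro2 _ _ g hg (erefl (jet_class_of r t g))).

(* p^{rs}, meaningful for s <= r. *)
Definition jet_proj r s (j : jet r) : jet s :=
  mk_jet s (jet_source j) (jet_curve_smooth j).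

Definition jet_target r (j : jet r) : M := jet_curve j (jet_source j).

Definition jet_coord r (j : jet r) (i : I) (k : nat) : 'rV[R]_n :=
  derive1n k (phi i \o jet_curve j) (jet_source j).

(* The induced coordinates (t, x), (t, x, x') and (t, x, x', x''). *)
Definition chart0 (i : I) : chart (R * M) (R * 'rV[R]_n) :=
  Chart [set q | chart_dom (phi i) q.2] (fun q => (q.1, phi i q.2)).

Definition chart1 (i : I) : chart (jet 1) (R * 'rV[R]_n * 'rV[R]_n) :=
  Chart [set j | chart_dom (phi i) (jet_target j)]
    (fun j => (jet_source j, jet_coord j i 0, jet_coord j i 1)).

Definition chart2 (i : I) :
    chart (jet 2) (R * 'rV[R]_n * 'rV[R]_n * 'rV[R]_n) :=
  Chart [set j | chart_dom (phi i) (jet_target j)]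
    (fun j => (jet_source j, jet_coord j i 0, jet_coord j i 1,
               jet_coord j i 2)).

Definition p10 (j : jet 1) : R * M := (jet_source j, jet_target j).

Definition sode (sigma : jet 1 -> jet 2) : Prop :=
  smooth_map chart1 chart2 sigma /\ (forall j, jet_proj 1 (sigma j) = j).

End Jets.

Section SODEGeometry.
Context {R : realType} {n : nat} {M : topologicalType} {I : Type}.
Variables (phi : I -> chart M 'rV[R]_n) (sigma : jet phi 1 -> jet phi 2).

Local Notation M1 := (jet phi 1).
Local Notation E0 := (R * 'rV[R]_n)%type.
Local Notation E1 := (R * 'rV[R]_n * 'rV[R]_n)%type.
Local Notation field := (M1 -> I -> E1).
Local Notation A1 := (chart1 phi).

Definition velocity (i : I) (j : M1) : 'rV[R]_n := jet_coord j i 1.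

(* F^a is the a-th entry of force i. *)
Definition force (i : I) (j : M1) : 'rV[R]_n := jet_coord (sigma j) i 2.

(* The partial derivative with respect to the a-th velocity coordinate of the
   chart i. *)
Definition dvel (i : I) (a : 'I_n) {F : normedModType R} (f : M1 -> F)
    (j : M1) : F :=
  'd (coord_rep (A1 i) f) (A1 i j) ((0, 0, delta_mx 0 a) : E1).

Definition X_sigma : field :=
  fun j i => (1, velocity i j, force i j).

(* The components of X^sigma_a in the chart i. *)
Definition X_hor_coord (i : I) (a : 'I_n) (j : M1) : E1 :=
  (0, delta_mx 0 a, 2^-1 *: dvel i a (force i) j).

Definition X_hor (i : I) (a : 'I_n) : field :=
  chart_field A1 i (X_hor_coord i a).

Definition D_vel (i : I) (a : 'I_n) : field :=
  chart_field A1 i (fun=> (0, 0, delta_mx 0 a)).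

Definition dt (X : field) (j : M1) (i : I) : R := (X j i).1.1.

(* omega^a is the a-th entry; it is defined on TM^0 pulled back to M^1. *)
Definition omega (j : M1) (w : I -> E0) (i : I) : 'rV[R]_n :=
  (w i).2 - (w i).1 *: velocity i j.

Definition dp10 (j : M1) (v : I -> E1) : I -> E0 :=
  tangent_map A1 (chart0 phi) (p10 (phi:=phi)) j v.

(* epsilon, and its inverse on p^{10}-vertical vectors, for which only the
   velocity components are nonzero. *)
Definition vlift (w : I -> 'rV[R]_n) : I -> E1 := fun i => (0, 0, w i).
Definition vlift_inv (v : I -> E1) : I -> 'rV[R]_n := fun i => (v i).2.

(* TM inside TM^0 = TR x TM. *)
Definition incl0 (w : I -> 'rV[R]_n) : I -> E0 := fun i => (0, w i).

(* H^sigma *)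
Definition hlift (j : M1) (w : I -> E0) : I -> E1 :=
  fun i => (w i).1 *: X_sigma j i
           + \sum_(a < n) omega j w i 0 a *: X_hor_coord i a j.

Definition hor (X : field) : field := fun j => hlift j (dp10 j (X j)).
Definition ver (X : field) : field := X - hor X.

Definition J_endo (X : field) : field :=
  fun j => vlift (omega j (dp10 j (X j))).

Definition LJ : field -> field := lie_endo A1 X_sigma J_endo.

(* H^sigma o epsilon^-1 o (L_{X^sigma} J)^v *)
Definition HLJ (X : field) : field :=
  fun j => hlift j (incl0 (vlift_inv (ver (LJ X) j))).

Definition E_endo (X : field) : field := J_endo X + HLJ X.

Definition curvature (X Y : field) : field :=
  - ver (bracket A1 (hor X) (hor Y)).

Definition dt_wedge (L : field -> field) (X Y : field) : field :=
  fun j i => dt X j i *: L Y j i - dt Y j i *: L X j i.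

Definition T_sigma (X Y : field) : field :=
  curvature X Y + dt_wedge HLJ X Y.

Definition characterized (nabla : field -> field -> field) : Prop :=
  [/\ parallel_field A1 nabla X_sigma,
      parallel_endo A1 nabla LJ,
      parallel_endo A1 nabla E_endo &
      has_torsion A1 nabla T_sigma].

(* -1/2 (d F^b / d x'^a) and -1/2 (d^2 F^c / d x'^a d x'^b) in the chart i. *)
Definition chern_coef1 (i : I) (a b : 'I_n) (j : M1) : R :=
  - 2^-1 * dvel i a (force i) j 0 b.
Definition chern_coef2 (i : I) (a b c : 'I_n) (j : M1) : R :=
  - 2^-1 * dvel i a (dvel i b (force i)) j 0 c.

Record chern_connection (nabla : field -> field -> field) : Prop := {
  chern_X : parallel_field A1 nabla X_sigma;
  chern_X_hor : forall i a, eq_on A1 (chart_dom (A1 i))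
    (nabla X_sigma (X_hor i a))
    (fun j => \sum_(b < n) chern_coef1 i a b j *: X_hor i b j);
  chern_X_vel : forall i a, eq_on A1 (chart_dom (A1 i))
    (nabla X_sigma (D_vel i a))
    (fun j => \sum_(b < n) chern_coef1 i a b j *: D_vel i b j);
  chern_hor_hor : forall i a b, eq_on A1 (chart_dom (A1 i))
    (nabla (X_hor i b) (X_hor i a))
    (fun j => \sum_(c < n) chern_coef2 i a b c j *: X_hor i c j);
  chern_hor_vel : forall i a b, eq_on A1 (chart_dom (A1 i))
    (nabla (X_hor i b) (D_vel i a))
    (fun j => \sum_(c < n) chern_coef2 i a b c j *: D_vel i c j);
  chern_vel_hor : forall i a b, eq_on A1 (chart_dom (A1 i))
    (nabla (D_vel i b) (X_hor i a)) 0;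
  chern_vel_vel : forall i a b, eq_on A1 (chart_dom (A1 i))
    (nabla (D_vel i b) (D_vel i a)) 0
}.

End SODEGeometry.

(* Main.v *)
Require Import Defs.
From HB Require Import structures.
From mathcomp Require Import all_boot all_order all_algebra.
From mathcomp Require Import all_classical all_reals all_analysis.
From mathcomp Require Import ring.

(** In an induced chart, decompose vector fields of M^1 along the frame X^sigma,
    X^sigma_a, d/dx'^a: the adapted components of Y are (alpha, eta, nu), with
    alpha = dt(Y), eta = omega(Y) and nu the vertical part. In these components
    the operators of the theorem act by constants ([adapted_block_J],
    [adapted_block_LJ], [adapted_block_E]): J gives (0, 0, eta), L_X J gives
    (0, - eta, nu) and E^sigma gives (0, nu, eta).

    Existence. Put N w = 1/2 dF(0, 0, w) and S(w, om) = 1/2 d^2F((0, 0, w),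
    (0, 0, om)), and let nabla_X Y have the adapted components
    (X alpha, D_X eta, D_X nu), where D_X w = X w - dt(X) N w - S(w, omega(X)).
    Because one derivation D_X acts on both eta and nu, L_X J and E^sigma are
    parallel ([chern_nabla_parallel_block_map]). The torsion follows from the
    structure equations of the frame ([bracket_frame]) and from the symmetry of
    S. The values on the frame are those of the Chern connection.

    The formulas of the various charts define one field. Rather than transform
    the derivatives of F, nabla_X Y is rewritten with Lie brackets and tensors:
    it is X(dt Y) X^sigma + theta (D_X (J Y)) + D_X (ver Y) with
    theta = H^sigma o epsilon^-1 and D_X V = ver [hor X, V] + J [ver X, theta V]
    ([chern_nabla_invariant]). The bracket does not depend on the chart because
    second derivatives are symmetric ([schwarz], [vector_field_bracket]); hor and
    theta are expressed in turn by brackets with X^sigma ([hor_LJ], [HLJ_hor]).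

    Uniqueness. If L_X J and E^sigma are parallel, nabla preserves vertical
    fields, and nabla_X (hor Z) has no vertical part. In the torsion of
    (hor X, V) and of (ver X, E V), V vertical, all terms but one are then
    determined, which fixes nabla_X V ([vert_agree]). The formula
    Y = dt(Y) X^sigma + E (J Y) + ver Y does the rest. For the Chern connection
    it is enough that the frame spans ([frame_agree]).

    That M^1 is a manifold rests on the existence of a smooth curve with any
    given position and velocity ([curve_exists]), which makes the image of a
    chart a full cylinder; and X^sigma is tangent since it is the velocity of
    the 1-jet prolongation of a curve representing sigma ([X_sigma_tangent]). *)

Set Implicit Arguments.
Unset Strict Implicit.
Unset Printing Implicit Defensive.

Import Order.TTheory GRing.Theory Num.Theory.
Import numFieldNormedType.Exports.

Local Open Scope classical_set_scope.
Local Open Scope ring_scope.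

(** * Differentials *)

Section HasDiff.
Context {R : realType}.
Implicit Types V W Z : normedModType R.

(** Pointwise in v, so that a differential can be rewritten without its
    linear-map structure. *)
Definition has_diff V W (f : V -> W) (x : V) (df : V -> W) : Prop :=
  differentiable f x /\ forall v, 'd f x v = df v.

Lemma has_diffP V W (f : V -> W) x : differentiable f x -> has_diff f x ('d f x).
Proof. by []. Qed.

Lemma has_diff_is V W (f df : V -> W) x : is_diff x f df -> has_diff f x df.
Proof. by move=> [h e]; split=> // v; rewrite e. Qed.

Lemma has_diff_to V W (f df : V -> W) x : has_diff f x df -> is_diff x f df.
Proof. by move=> [h e]; apply: DiffDef => //; apply/funext. Qed.

Lemma has_diff_eq V W (f df dg : V -> W) x :
  (forall v, df v = dg v) -> has_diff f x df -> has_diff f x dg.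
Proof. by move=> e [h1 h2]; split=> // v; rewrite h2 e. Qed.

Lemma has_diff_near V W (f g df : V -> W) x :
  (\forall y \near x, f y = g y) -> has_diff f x df -> has_diff g x df.
Proof.
move=> fg [fd fe].
have gx : f x = g x by exact: nbhs_singleton fg.
have key : g \o shift x = cst (g x) + 'd f x +o_ 0 id.
  apply/eqaddoP => e e0.
  have /diff_locally/eqaddoP/(_ e e0) H := fd.
  have fg0 : \forall h \near 0, f (h + x) = g (h + x).
    by have := fg; rewrite (near_shift 0 x); apply: filterS => h; rewrite /= subr0.
  near=> h.
  have E : f (h + x) = g (h + x) by near: h; exact: fg0.
  have : `|(f \o shift x - (cst (f x) + 'd f x)) h| <= e * `|h|.
    by near: h; exact: H.
  by rewrite -![(_ - _ : V -> W) _]/(_ - _) /= E gx.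
have dE : 'd g x = 'd f x :> (V -> W).
  by apply: diff_unique => //; exact: diff_continuous.
split; last by move=> v; rewrite dE fe.
apply/diff_locallyP; split; last by rewrite dE.
by rewrite dE; exact: diff_continuous.
Unshelve. all: by end_near. Qed.

Lemma has_diff_on V W (U : set V) (f g df : V -> W) x : open U -> U x ->
  (forall y, U y -> f y = g y) -> has_diff f x df -> has_diff g x df.
Proof.
move=> oU Ux fg; apply: has_diff_near.
by have : nbhs x U by [exact: open_nbhs_nbhs]; apply: filterS.
Qed.

Lemma has_diff_cst V W (a : W) (x : V) : has_diff (fun=> a) x (fun=> 0).
Proof. by apply: has_diff_is; exact: is_diff_cst. Qed.

Lemma has_diff_id V (x : V) : has_diff (fun y => y) x (fun v => v).
Proof. by apply: has_diff_is; exact: is_diff_id. Qed.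

Lemma has_diffD V W (f g df dg : V -> W) x : has_diff f x df ->
  has_diff g x dg -> has_diff (fun y => f y + g y) x (fun v => df v + dg v).
Proof.
by move=> /has_diff_to ? /has_diff_to ?; apply: has_diff_is; exact: is_diffD.
Qed.

Lemma has_diffN V W (f df : V -> W) x : has_diff f x df ->
  has_diff (fun y => - f y) x (fun v => - df v).
Proof. by move=> /has_diff_to ?; apply: has_diff_is; exact: is_diffN. Qed.

Lemma has_diffB V W (f g df dg : V -> W) x : has_diff f x df ->
  has_diff g x dg -> has_diff (fun y => f y - g y) x (fun v => df v - dg v).
Proof. by move=> hf /has_diffN; exact: has_diffD. Qed.

Lemma has_diff_sum V W (T : finType) (f df : T -> V -> W) x :
  (forall k, has_diff (f k) x (df k)) ->
  has_diff (fun y => \sum_k f k y) x (fun v => \sum_k df k v).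
Proof.
move=> h; suff: forall s : seq T,
    has_diff (fun y => \sum_(k <- s) f k y) x (fun v => \sum_(k <- s) df k v).
  exact.
elim=> [|k s ih].
  under eq_fun do rewrite big_nil.
  by apply: has_diff_eq (has_diff_cst _ _) => v; rewrite big_nil.
under eq_fun do rewrite big_cons.
by apply: has_diff_eq (has_diffD (h k) ih) => v; rewrite big_cons.
Qed.

Lemma has_diff_pair V W Z (f df : V -> W) (g dg : V -> Z) x :
  has_diff f x df -> has_diff g x dg ->
  has_diff (fun y => (f y, g y)) x (fun v => (df v, dg v)).
Proof.
by move=> /has_diff_to ? /has_diff_to ?; apply: has_diff_is; exact: is_diff_pair.
Qed.

Lemma has_diff_comp V W Z (f df : V -> W) (g dg : W -> Z) x :
  has_diff f x df -> has_diff g (f x) dg ->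
  has_diff (fun y => g (f y)) x (fun v => dg (df v)).
Proof.
move=> /has_diff_to hf /has_diff_to hg.
exact: has_diff_is (is_diff_comp hf hg).
Qed.

Lemma has_diff_lin V W (L : {linear V -> W}) x : continuous L ->
  has_diff L x L.
Proof.
by move=> cL; split; [exact: linear_differentiable|move=> v; rewrite diff_lin].
Qed.

Lemma has_diff_lincomp V W Z (L : {linear W -> Z}) (f df : V -> W) x :
  continuous L -> has_diff f x df ->
  has_diff (fun y => L (f y)) x (fun v => L (df v)).
Proof. by move=> cL hf; exact: has_diff_comp hf (has_diff_lin _ cL). Qed.

Lemma scale_is_bilinear W : bilinear_for
  (GRing.Scale.Law.clone _ _ *:%R _) (GRing.Scale.Law.clone _ _ *:%R _)
  (@GRing.scale R W : R -> W -> W).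
Proof.
split=> [u'|u] a x y /=.
- by rewrite scalerDl scalerA.
- by rewrite scalerDr !scalerA mulrC.
Qed.
HB.instance Definition _ W := bilinear_isBilinear.Build R R W W _ _
  (@GRing.scale R W : R -> W -> W) (@scale_is_bilinear W).

Lemma has_diffZ V W (k dk : V -> R) (f df : V -> W) x :
  has_diff k x dk -> has_diff f x df ->
  has_diff (fun y => k y *: f y) x (fun v => dk v *: f x + k x *: df v).
Proof.
move=> hk hf.
pose B : {bilinear R -> W -> W} := (@GRing.scale R W : R -> W -> W).
have cB : continuous (fun q : R * W => B q.1 q.2) by move=> q; exact:
  scale_continuous.
have hB : has_diff (fun q : R * W => B q.1 q.2) (k x, f x)
    (fun q => B (k x) q.2 + B q.1 (f x)).
  by split; [exact: differentiable_bilin | move=> v; rewrite diff_bilin].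
apply: has_diff_eq (has_diff_comp (has_diff_pair hk hf) hB) => v /=.
by rewrite addrC.
Qed.

End HasDiff.

(** * Maps of class C^k *)

Section FiniteFrame.
Context {R : realType}.
Implicit Types V W : normedModType R.

(** Stands for finite dimension: vectors can be expanded with continuous
    coordinates. *)
Definition finite_frame V : Prop :=
  exists (T : finType) (e : T -> V) (l : T -> {linear V -> R}),
    (forall k, continuous (l k)) /\ forall v, v = \sum_k l k v *: e k.

Lemma finite_frame_R : finite_frame R.
Proof.
exists unit, (fun=> 1), (fun=> idfun); split=> [_ v|v]; first exact: cvg_id.
by rewrite (bigD1 tt)//= big1 ?addr0 ?[_ *: _]mulr1// => -[].
Qed.

Lemma finite_frame_rV n : finite_frame 'rV[R]_n.
Proof.
have lin (k : 'I_n) : linear (fun v : 'rV[R]_n => v 0 k) by move=> a u v;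
  rewrite !mxE.
pose l k : {linear 'rV[R]_n -> R} :=
  HB.pack (fun v : 'rV[R]_n => v 0 k) (GRing.isLinear.Build _ _ _ _ _ (lin k)).
exists 'I_n, (fun k => delta_mx 0 k), l; split=> [k v|v].
  exact: coord_continuous.
exact: row_sum_delta.
Qed.

Lemma finite_frame_prod V W : finite_frame V -> finite_frame W ->
  finite_frame (V * W)%type.
Proof.
move=> [T [e [l [cl el]]]] [T' [e' [l' [cl' el']]]].
pose f k : V * W -> R :=
  match k with inl i => l i \o fst | inr j => l' j \o snd end.
have lin k : linear (f k) by case: k => k a u v /=; rewrite linearP.
pose L k : {linear (V * W)%type -> R} :=
  HB.pack (f k) (GRing.isLinear.Build _ _ _ _ _ (lin k)).
exists (T + T')%type,
  (fun k => match k with inl i => (e i, 0) | inr j => (0, e' j) end), L.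
split=> [[k|k] v|[v w]] /=.
- by apply: continuous_comp; [exact: cvg_fst|exact: cl].
- by apply: continuous_comp; [exact: cvg_snd|exact: cl'].
rewrite big_sumType /= [in LHS](el v) [in LHS](el' w).
apply: injective_projections => /=.
- rewrite !(big_morph (@fst V W) (fun _ _ => erefl) erefl)/=.
  by rewrite [X in _ + X]big1 ?addr0//= => i _; rewrite scaler0.
- rewrite !(big_morph (@snd V W) (fun _ _ => erefl) erefl)/=.
  by rewrite [X in X + _]big1 ?add0r//= => i _; rewrite scaler0.
Qed.

End FiniteFrame.

Section CkTheory.
Context {R : realType}.
Implicit Types V W Z : normedModType R.

Lemma Ck_sub V W k (U U' : set V) (f : V -> W) : U' `<=` U ->
  Ck k U f -> Ck k U' f.
Proof.
elim: k f => [|k ih] f sU /=; first by move=> h x /sU; exact: h.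
by move=> [h1 h2]; split=> [x /sU /h1//|v]; exact: ih.
Qed.

Lemma CkS V W k (U : set V) (f : V -> W) : Ck k.+1 U f -> Ck k U f.
Proof.
elim: k f => [|k ih] f /=.
  by move=> [h _] x /h; exact: differentiable_continuous.
by move=> [h1 h2]; split=> // v; apply: ih; exact: h2.
Qed.

Lemma Ck_eq V W k (U : set V) (f g : V -> W) : open U ->
  (forall x, U x -> f x = g x) -> Ck k U f -> Ck k U g.
Proof.
move=> oU; elim: k f g => [|k ih] f g fg /=.
  move=> h x Ux; rewrite /prop_for /continuous_at -(fg x Ux).
  have nU : nbhs x U by exact: open_nbhs_nbhs.
  apply: cvg_trans (h x Ux); apply: near_eq_cvg.
  by near=> y; apply: fg; near: y.
move=> [h1 h2].
have hd x : U x -> has_diff g x ('d f x).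
  by move=> Ux; apply: has_diff_on oU Ux fg (has_diffP (h1 _ Ux)).
split=> [x /hd[]//|v]; apply: ih (h2 v) => x /hd[_ ->//].
Unshelve. all: by end_near. Qed.

Lemma Ck_diff V W k (U : set V) (f : V -> W) x : Ck k.+1 U f -> U x ->
  has_diff f x ('d f x).
Proof. by move=> [h _] /h /has_diffP. Qed.

Lemma Ck_intro V W k (U : set V) (f : V -> W) (df : V -> V -> W) : open U ->
  (forall x, U x -> has_diff f x (df x)) ->
  (forall v, Ck k U (df ^~ v)) -> Ck k.+1 U f.
Proof.
move=> oU h1 h2; split=> [x /h1[]//|v].
by apply: Ck_eq (h2 v) => // x /h1[_ ->].
Qed.

Lemma Ck_cst V W k (U : set V) (a : W) : open U -> Ck k U (fun=> a).
Proof.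
move=> oU; elim: k a => [|k ih] a /=; first by move=> x _; exact: cvg_cst.
by apply: (Ck_intro oU (df := fun=> fun=> 0)) => // x _; exact: has_diff_cst.
Qed.

Lemma Ck_lin V W k (U : set V) (L : {linear V -> W}) : open U ->
  continuous L -> Ck k U L.
Proof.
move=> oU cL; case: k => [|k]; first by move=> x _; exact: cL.
apply: (Ck_intro oU (df := fun=> L)) => [x _|v]; first exact: has_diff_lin.
exact: Ck_cst.
Qed.

Lemma CkD V W k (U : set V) (f g : V -> W) : open U ->
  Ck k U f -> Ck k U g -> Ck k U (fun y => f y + g y).
Proof.
move=> oU; elim: k f g => [|k ih] f g hf hg.
  by move=> x Ux; apply: cvgD; [exact: hf|exact: hg].
apply: (Ck_intro oU (df := fun x v => 'd f x v + 'd g x v)).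
  by move=> x Ux; apply: has_diffD; apply: Ck_diff Ux; eassumption.
by move=> v; apply: ih; [exact: hf.2|exact: hg.2].
Qed.

Lemma Ck_sum V W k (U : set V) (T : finType) (f : T -> V -> W) : open U ->
  (forall a, Ck k U (f a)) -> Ck k U (fun y => \sum_a f a y).
Proof.
move=> oU hf; suff : forall s : seq T, Ck k U (fun y => \sum_(a <- s) f a y) by
  exact.
elim=> [|a s ih].
  by apply: Ck_eq (Ck_cst k (0:W) oU) => // x _; rewrite big_nil.
by apply: Ck_eq (CkD oU (hf a) ih) => // x _; rewrite big_cons.
Qed.

Lemma CkN V W k (U : set V) (f : V -> W) : open U ->
  Ck k U f -> Ck k U (fun y => - f y).
Proof.
move=> oU; elim: k f => [|k ih] f hf.
  by move=> x Ux; apply: cvgN; exact: hf.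
apply: (Ck_intro oU (df := fun x v => - 'd f x v)).
  by move=> x Ux; apply: has_diffN; exact: Ck_diff hf Ux.
by move=> v; apply: ih; exact: hf.2.
Qed.

Lemma CkB V W k (U : set V) (f g : V -> W) : open U ->
  Ck k U f -> Ck k U g -> Ck k U (fun y => f y - g y).
Proof. by move=> oU hf hg; apply: CkD => //; exact: CkN. Qed.

Lemma Ck_pair V W Z k (U : set V) (f : V -> W) (g : V -> Z) : open U ->
  Ck k U f -> Ck k U g -> Ck k U (fun y => (f y, g y)).
Proof.
move=> oU; elim: k f g => [|k ih] f g hf hg.
  by move=> x Ux; apply: cvg_pair; [exact: hf|exact: hg].
apply: (Ck_intro oU (df := fun x v => ('d f x v, 'd g x v))).
  by move=> x Ux; apply: has_diff_pair; apply: Ck_diff Ux; eassumption.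
by move=> v; apply: ih; [exact: hf.2|exact: hg.2].
Qed.

Lemma Ck_lincomp V W Z k (U : set V) (L : {linear W -> Z}) (f : V -> W) :
  open U -> continuous L -> Ck k U f -> Ck k U (fun y => L (f y)).
Proof.
move=> oU cL; elim: k f => [|k ih] f hf.
  by move=> x Ux; apply: continuous_comp; [exact: hf|exact: cL].
apply: (Ck_intro oU (df := fun x v => L ('d f x v))).
  by move=> x Ux; apply: has_diff_lincomp => //; exact: Ck_diff hf Ux.
by move=> v; apply: ih; exact: hf.2.
Qed.

Lemma CkZ V W k (U : set V) (r : V -> R) (f : V -> W) : open U ->
  Ck k U r -> Ck k U f -> Ck k U (fun y => r y *: f y).
Proof.
move=> oU; elim: k r f => [|k ih] r f hr hf.
  by move=> x Ux; apply: cvgZ; [exact: hr|exact: hf].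
apply: (Ck_intro oU (df := fun x v => 'd r x v *: f x + r x *: 'd f x v)).
  by move=> x Ux; apply: has_diffZ; apply: Ck_diff Ux; eassumption.
move=> v; apply: CkD => //; apply: ih.
- exact: hr.2.
- exact: CkS.
- exact: CkS.
- exact: hf.2.
Qed.

(** Expanding the derivative of f in a frame of W makes the derivative of the
    composite a sum of products, to which the induction hypothesis applies. *)
Lemma Ck_comp V W Z k (U : set V) (U' : set W) (f : V -> W) (g : W -> Z) :
  finite_frame W -> open U -> (forall x, U x -> U' (f x)) ->
  Ck k U f -> Ck k U' g -> Ck k U (fun y => g (f y)).
Proof.
move=> [T [e [l [cl el]]]] oU UU'; elim: k g f UU' => [|k ih] g f UU' hf hg.
  by move=> x Ux; apply: continuous_comp; [exact: hf|exact/hg/UU'].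
pose D x v := \sum_a l a ('d f x v) *: 'd g (f x) (e a).
apply: (Ck_intro oU (df := D)) => [x Ux|v].
  have hf1 := Ck_diff hf Ux; have hg1 := Ck_diff hg (UU' x Ux).
  apply: has_diff_eq (has_diff_comp hf1 hg1) => v.
  rewrite [in LHS](el ('d f x v)) raddf_sum; apply: eq_bigr => a _.
  exact: linearZZ.
apply: Ck_sum => // a; apply: CkZ => //.
  by apply: Ck_lincomp => //; exact: hf.2.
apply: (ih (fun y => 'd g y (e a))) => //; first exact: CkS.
exact: hg.2.
Qed.

(** [Ck] controls a differential along fixed directions only; a varying
    direction is reduced to these by expanding it in a frame. *)
Lemma diff_app_sum V W (T : finType) (e : T -> V) (l : T -> {linear V -> R})
  (G : V -> W) x w : (forall v, v = \sum_k l k v *: e k) ->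
  'd G x w = \sum_a l a w *: 'd G x (e a).
Proof.
by move=> el; rewrite {1}(el w) raddf_sum; apply: eq_bigr => a _; exact: linearZZ.
Qed.

Lemma Ck_diff_app V W k (U : set V) (G : V -> W) (w : V -> V) :
  finite_frame V -> open U -> Ck k.+1 U G -> Ck k U w ->
  Ck k U (fun y => 'd G y (w y)).
Proof.
move=> [T [e [l [cl el]]]] oU hG hw.
apply: (Ck_eq (f := fun y => \sum_a l a (w y) *: 'd G y (e a))) => //.
  by move=> x _; rewrite -diff_app_sum.
apply: Ck_sum => // a; apply: CkZ => //; last exact: hG.2.
exact: Ck_lincomp.
Qed.

Lemma has_diff_diff_app V W (U : set V) (G : V -> W) (w dw : V -> V) x :
  finite_frame V -> Ck 2 U G -> U x -> has_diff w x dw ->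
  has_diff (fun y => 'd G y (w y)) x
    (fun z => 'd (fun y => 'd G y (w x)) x z + 'd G x (dw z)).
Proof.
move=> [T [e [l [cl el]]]] hG Ux hw.
have hd (u du : V -> V) : has_diff u x du ->
  has_diff (fun y => 'd G y (u y)) x (fun z => \sum_a
    (l a (du z) *: 'd G x (e a) + l a (u x) *: 'd (fun y => 'd G y (e a)) x z)).
  move=> hu.
  under eq_fun do rewrite (diff_app_sum _ _ _ el).
  apply: has_diff_sum => a.
  apply: (has_diffZ (has_diff_lincomp (@cl a) hu)).
  by apply: has_diffP; exact: (hG.2 (e a)).1.
apply: has_diff_eq (hd _ _ hw) => z.
have [_ ->] := hd _ _ (has_diff_cst (w x) x).
rewrite big_split /= -diff_app_sum// addrC; congr (_ + _).
by apply: eq_bigr => a _; rewrite linear0 scale0r add0r.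
Qed.

End CkTheory.

(** * Symmetry of second derivatives *)

Section Schwarz.
Context {R : realType}.
Implicit Types V W : normedModType R.

Lemma has_diff_is_derive W (f df : R -> W) r :
  has_diff f r df -> is_derive r 1 f (df 1).
Proof.
move=> [fd fe]; apply: DeriveDef; first exact: diff_derivable.
by rewrite deriveE // fe.
Qed.

Lemma mean_value (f : R -> R) (df : R -> R -> R) (s : R) : 0 < s ->
  (forall r, 0 <= r <= s -> has_diff f r (df r)) ->
  exists2 r, 0 < r < s & f s - f 0 = df r 1 * s.
Proof.
move=> s0 hf.
have [||r] := @MVT R f (fun r => df r 1) 0 s s0.
- move=> r; rewrite in_itv/= => /andP[/ltW r0 /ltW rs].
  by apply: has_diff_is_derive; apply: hf; rewrite r0 rs.
- apply: derivable_within_continuous => r; rewrite in_itv/= => /hf.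
  by move=> /has_diff_is_derive [].
- by rewrite in_itv/= subr0 => rs ->; exists r.
Qed.

Lemma has_diff_line V (a u : V) (r : R) :
  has_diff (fun q : R => a + q *: u) r (fun h => h *: u).
Proof.
apply: has_diff_eq (has_diffD (has_diff_cst a r)
  (has_diffZ (has_diff_id r) (has_diff_cst u r))) => h.
by rewrite scaler0 addr0 add0r.
Qed.

(** Two applications of the mean value theorem. The left-hand side is
    symmetric in u and v, which is where Schwarz's theorem comes from. *)
Lemma second_difference V (U : set V) (f : V -> R) (x u v : V) (s : R) :
  0 < s -> Ck 2 U f ->
  (forall p q, 0 <= p <= s -> 0 <= q <= s -> U (x + p *: u + q *: v)) ->
  exists p q, [/\ 0 <= p <= s, 0 <= q <= s &
    f (x + s *: u + s *: v) - f (x + s *: u) - (f (x + s *: v) - f x) =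
    'd (fun y => 'd f y u) (x + p *: u + q *: v) v * s * s].
Proof.
move=> s0 hf hU.
have ss : 0 <= s <= s by rewrite ltW /=.
have s00 : 0 <= (0:R) <= s by rewrite lexx ltW.
pose phi r := f (x + s *: v + r *: u) - f (x + r *: u).
have hphi r : 0 <= r <= s -> has_diff phi r
   (fun h => 'd f (x + s *: v + r *: u) (h *: u) - 'd f (x + r *: u) (h *: u)).
  move=> hr; apply: has_diffB; apply: has_diff_comp (has_diff_line _ _ _) _;
    apply: (Ck_diff hf).
    by rewrite addrAC; exact: hU.
  by rewrite -[_ + _]addr0 -(scale0r v); exact: hU.
have [p /andP[/ltW p0 /ltW ps]] := mean_value s0 hphi.
have hp : 0 <= p <= s by rewrite p0.
pose psi r := 'd f (x + p *: u + r *: v) u.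
have hpsi r : 0 <= r <= s -> has_diff psi r
   (fun h => 'd (fun y => 'd f y u) (x + p *: u + r *: v) (h *: v)).
  move=> hr; apply: (has_diff_comp (has_diff_line _ _ _)
    (g := fun y => 'd f y u)).
  by apply: has_diffP; apply: (hf.2 u).1; exact: hU.
have [q /andP[/ltW q0 /ltW qs]] := mean_value s0 hpsi.
rewrite /phi /psi !scale0r !addr0 !scale1r => E2 E1.
exists p, q; split=> //; first by rewrite q0.
rewrite -E2 [x + s *: u + s *: v]addrAC.
rewrite [x + p *: u + s *: v]addrAC -E1; ring.
Qed.

(** By [second_difference] the two mixed derivatives, which are continuous,
    take a common value in every neighbourhood of x. *)
Lemma schwarz_scalar V (U : set V) (f : V -> R) (x u v : V) : open U -> U x ->
  Ck 2 U f -> 'd (fun y => 'd f y v) x u = 'd (fun y => 'd f y u) x v.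
Proof.
move=> oU Ux hf.
set g1 := fun y => 'd (fun y => 'd f y v) y u.
set g2 := fun y => 'd (fun y => 'd f y u) y v.
rewrite -/(g1 x) -/(g2 x); apply/eqP; apply: contraT => g12.
pose e := `|g1 x - g2 x| / 2.
have e0 : 0 < e by rewrite divr_gt0// normr_gt0 subr_eq0.
have c1 : g1 @ x --> g1 x by exact: ((hf.2 v).2 u).
have c2 : g2 @ x --> g2 x by exact: ((hf.2 u).2 v).
move/cvgrPdist_lt : c1 => /(_ e e0) c1.
move/cvgrPdist_lt : c2 => /(_ e e0) c2.
have : \forall y \near x, [/\ U y, `|g1 x - g1 y| < e & `|g2 x - g2 y| < e].
  near=> y; split; near: y.
  - exact: open_nbhs_nbhs.
  - exact: c1.
  - exact: c2.
move=> /nbhs_ballP[d /= d0 hd].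
(* parallelograms with sides at most s u and s v stay in the ball of radius d *)
pose m := `|u| + `|v| + 1.
have m0 : 0 < m by rewrite ltr_wpDl.
pose s := d / m; have s0 : 0 < s by rewrite divr_gt0.
have small p q : 0 <= p <= s -> 0 <= q <= s ->
    ball x d (x + p *: u + q *: v).
  move=> /andP[p0 ps] /andP[q0 qs].
  rewrite -ball_normE /= -addrA opprD addNKr normrN.
  apply: le_lt_trans (ler_normD _ _) _; rewrite !normrZ !ger0_norm//.
  apply: (@le_lt_trans _ _ (s * (`|u| + `|v|))).
    by rewrite mulrDr lerD// ler_wpM2r.
  by rewrite -[ltRHS](divfK (lt0r_neq0 m0)) ltr_pM2l// ltrDl.
have hU p q hp hq := let: And3 h _ _ := hd _ (small p q hp hq) in h.
have [p [q [hp hq E]]] := second_difference s0 hf hU.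
have hU' p' q' : 0 <= p' <= s -> 0 <= q' <= s -> U (x + p' *: v + q' *: u).
  by move=> h h'; rewrite addrAC; exact: hU.
have [p' [q' [hp' hq' E']]] := second_difference s0 hf hU'.
have [_ _ d2] := hd _ (small p q hp hq).
have [_ d1 _] := hd _ (small q' p' hq' hp').
move: d1; rewrite addrAC => d1.
have ss0 : s * s != 0 by rewrite mulf_neq0// gt_eqF.
have E3 : g1 (x + p' *: v + q' *: u) = g2 (x + p *: u + q *: v).
  apply: (mulIf ss0); rewrite 2!(mulrA _ s s).
  rewrite [LHS](esym E') [RHS](esym E) [x + s *: v + _]addrAC; ring.
move: d1; rewrite E3 => d1.
have : `|g1 x - g2 x| < e + e.
  rewrite -(subrKA (g2 (x + p *: u + q *: v))).
  apply: le_lt_trans (ler_normD _ _) _; apply: ltrD => //.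
  by rewrite distrC.
by rewrite -splitr ltxx.
Unshelve. all: by end_near. Qed.

Lemma schwarz V W (U : set V) (f : V -> W) (x u v : V) : finite_frame W ->
  open U -> U x -> Ck 2 U f ->
  'd (fun y => 'd f y v) x u = 'd (fun y => 'd f y u) x v.
Proof.
move=> [T [e [l [cl el]]]] oU Ux hf.
rewrite [LHS]el [RHS]el; apply: eq_bigr => a _; congr (_ *: _).
have d1 y : U y -> has_diff (fun y => l a (f y)) y (fun v => l a ('d f y v)).
  by move=> Uy; apply: has_diff_lincomp (Ck_diff hf Uy).
have d2 w z : 'd (fun y => 'd (fun y => l a (f y)) y w) x z =
    l a ('d (fun y => 'd f y w) x z).
  have h : has_diff (fun y => l a ('d f y w)) x
      (fun z => l a ('d (fun y => 'd f y w) x z)).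
    apply: has_diff_lincomp => //; apply: has_diffP.
    exact: (hf.2 w).1.
  have E y : U y -> l a ('d f y w) = 'd (fun y => l a (f y)) y w.
    by move=> /d1[_ ->].
  by have [_ ->] := has_diff_on oU Ux E h.
rewrite -!d2; apply: schwarz_scalar Ux _ => //.
exact: Ck_lincomp.
Qed.

End Schwarz.

(** * Vector fields on an atlas *)

Section CoordRep.
Context {P E : Type}.
Implicit Types c : chart P E.

Lemma coord_repE {F : zmodType} c (f : P -> F) p :
  set_inj (chart_dom c) c -> chart_dom c p -> coord_rep c f (c p) = f p.
Proof.
move=> ic dp; rewrite /coord_rep; case: pselect => [h|[]]; last by exists p.
case: cid2 => q /= dq e; congr f; apply: ic => //; exact: mem_set.
Qed.

Lemma coord_rep_on {F : zmodType} c (U : set P) (f : P -> F) (g : E -> F) :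
  set_inj (chart_dom c) c ->
  (forall p, U p -> chart_dom c p -> f p = g (c p)) ->
  forall y, (c @` (U `&` chart_dom c)) y -> g y = coord_rep c f y.
Proof. by move=> ic fg _ [p [Up dp] <-]; rewrite coord_repE// fg. Qed.

End CoordRep.

Section Atlas.
Context {R : realType} {P I : Type} {E : normedModType R}.
Variable A : I -> chart P E.

(** What the differential geometry below needs from an atlas. Openness makes
    it legitimate to restrict everything to the domain of a chart. *)
Record good_atlas : Prop := {
  atlas_frame : finite_frame E;
  atlas_inj : forall i, set_inj (chart_dom (A i)) (A i);
  atlas_open : forall k, open_in A (chart_dom (A k));
  atlas_smooth : forall i k,
    smooth_on (A i @` (chart_dom (A k) `&` chart_dom (A i))) (transition A i k)
}.

Hypothesis gA : good_atlas.
Implicit Types (U : set P) (p : P) (X Y : P -> I -> E).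

Let inj := atlas_inj gA.
Let frame := atlas_frame gA.

Lemma imageI i U V : A i @` (U `&` V `&` chart_dom (A i)) =
  A i @` (U `&` chart_dom (A i)) `&` A i @` (V `&` chart_dom (A i)).
Proof.
apply/seteqP; split=> [_ [p [[Up Vp] dp] <-]|y [[p [Up dp] <-] [q [Vq dq] e]]].
  by split; exists p.
have qp : q = p by apply: (@inj i) => //; exact: mem_set.
by exists p => //; split=> //; split=> //; rewrite -qp.
Qed.

Lemma open_inI U V : open_in A U -> open_in A V -> open_in A (U `&` V).
Proof. by move=> oU oV i; rewrite imageI; apply: openI. Qed.

Lemma transitionE i k p : chart_dom (A i) p -> transition A i k (A i p) = A k p.
Proof. by move=> dp; rewrite /transition coord_repE. Qed.

Lemma transition_diff i k p : chart_dom (A i) p -> chart_dom (A k) p ->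
  has_diff (transition A i k) (A i p) ('d (transition A i k) (A i p)).
Proof.
move=> di dk; apply: (Ck_diff (atlas_smooth gA i k 1)).
by exists p.
Qed.

Lemma coord_rep_change {F : zmodType} (f : P -> F) i k y :
  (A i @` (chart_dom (A k) `&` chart_dom (A i))) y ->
  coord_rep (A k) f (transition A i k y) = coord_rep (A i) f y.
Proof.
by move=> [p [dk di] <-]; rewrite transitionE// !coord_repE.
Qed.

Lemma diff_change (F : normedModType R) (f : P -> F) i k p v :
  chart_dom (A i) p -> chart_dom (A k) p ->
  differentiable (coord_rep (A k) f) (A k p) ->
  'd (coord_rep (A i) f) (A i p) v =
  'd (coord_rep (A k) f) (A k p) ('d (transition A i k) (A i p) v).
Proof.
move=> di dk df.
have h : has_diff (fun y => coord_rep (A k) f (transition A i k y)) (A i p)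
    (fun v => 'd (coord_rep (A k) f) (A k p) ('d (transition A i k) (A i p) v)).
  apply: has_diff_comp (transition_diff di dk) _.
  by rewrite transitionE//; exact: has_diffP.
have Ap : (A i @` (chart_dom (A k) `&` chart_dom (A i))) (A i p) by exists p.
have [_ ->//] := has_diff_on (@atlas_open gA k i) Ap
   (@coord_rep_change _ f i k) h.
Qed.

Lemma transition_cocycle i k l p v :
  chart_dom (A i) p -> chart_dom (A k) p -> chart_dom (A l) p ->
  'd (transition A k l) (A k p) ('d (transition A i k) (A i p) v) =
  'd (transition A i l) (A i p) v.
Proof.
move=> di dk dl; rewrite [RHS](@diff_change _ _ i k)//.
by have [] := transition_diff dk dl.
Qed.

Lemma transition_self i p v : chart_dom (A i) p ->
  'd (transition A i i) (A i p) v = v.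
Proof.
move=> di; have Ap : (A i @` (chart_dom (A i) `&` chart_dom (A i))) (A i p).
  by exists p.
have E1 y : (A i @` (chart_dom (A i) `&` chart_dom (A i))) y ->
  y = transition A i i y by move=> [q [dq _] <-]; rewrite transitionE.
by have [_ ->] := has_diff_on (@atlas_open gA i i) Ap E1 (has_diff_id (A i p)).
Qed.

Lemma tangent_eq_at i p v w : chart_dom (A i) p -> tangent A p v ->
  tangent A p w -> v i = w i -> eq_at A p v w.
Proof. by move=> di tv tw e k dk; rewrite (tv i k)// (tw i k)// e. Qed.

Lemma tangent0 p : tangent A p 0.
Proof. by move=> i k _ _; rewrite linear0. Qed.

Lemma tangentD p v w : tangent A p v -> tangent A p w -> tangent A p (v + w).
Proof.
move=> hv hw i k di dk.
by rewrite -[LHS]/(v k + w k) -[(v + w) i]/(v i + w i) (hv i k)// (hw i k)//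
  linearD.
Qed.

Lemma tangentN p v : tangent A p v -> tangent A p (- v).
Proof.
move=> hv i k di dk.
by rewrite -[LHS]/(- v k) -[(- v) i]/(- v i) (hv i k)// linearN.
Qed.

Lemma tangentZ p v (a : I -> R) : tangent A p v ->
  (forall i k, chart_dom (A i) p -> chart_dom (A k) p -> a i = a k) ->
  tangent A p (fun i => a i *: v i).
Proof.
move=> hv ha i k di dk.
by rewrite (hv i k)// (ha i k)//; apply: esym; exact: linearZZ.
Qed.

Lemma chart_field_tangent k (w : P -> E) p : chart_dom (A k) p ->
  tangent A p (chart_field A k w p).
Proof. by move=> dk i l di dl; rewrite /chart_field transition_cocycle. Qed.

Lemma vector_field_sub U V X : V `<=` U -> vector_field A U X ->
  vector_field A V X.
Proof.
move=> VU [h1 h2]; split=> [p /VU /h1//|i k].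
by apply: Ck_sub (h2 i k); apply: image_subset => p [/VU].
Qed.

Lemma eq_on_sub U V X Y : V `<=` U -> eq_on A U X Y -> eq_on A V X Y.
Proof. by move=> VU h p /VU; exact: h. Qed.

Lemma field_diff U X i p : vector_field A U X -> U p -> chart_dom (A i) p ->
  has_diff (coord_rep (A i) (X ^~ i)) (A i p)
    ('d (coord_rep (A i) (X ^~ i)) (A i p)).
Proof. by move=> [_ h] Up di; apply: (Ck_diff (h i 1)); exists p. Qed.

Lemma vector_fieldI U X (g : I -> E -> E) : open_in A U ->
  (forall p, U p -> tangent A p (X p)) ->
  (forall i p, U p -> chart_dom (A i) p -> X p i = g i (A i p)) ->
  (forall i k, Ck k (A i @` (U `&` chart_dom (A i))) (g i)) ->
  vector_field A U X.
Proof.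
move=> oU h1 h2 h3; split=> // i k.
apply: Ck_eq (oU i) _ (h3 i k) => y.
by apply: coord_rep_on => // p; exact: h2.
Qed.

Lemma vector_field0 U : open_in A U -> vector_field A U 0.
Proof.
move=> oU; apply: (vector_fieldI (g := fun=> fun=> 0)) => // [p _|i k].
  exact: tangent0.
exact: Ck_cst.
Qed.

Lemma vector_fieldD U X Y : open_in A U -> vector_field A U X ->
  vector_field A U Y -> vector_field A U (X + Y).
Proof.
move=> oU hX hY; apply: (vector_fieldI (g := fun i y =>
  coord_rep (A i) (X ^~ i) y + coord_rep (A i) (Y ^~ i) y)) => //.
- by move=> p Up; apply: tangentD; [exact: hX.1|exact: hY.1].
- by move=> i p Up di; rewrite !coord_repE.
- by move=> i k; apply: CkD => //; [exact: hX.2|exact: hY.2].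
Qed.

Lemma vector_fieldN U X : open_in A U -> vector_field A U X ->
  vector_field A U (- X).
Proof.
move=> oU hX; apply: (vector_fieldI (g := fun i y =>
  - coord_rep (A i) (X ^~ i) y)) => //.
- by move=> p Up; apply: tangentN; exact: hX.1.
- by move=> i p Up di; rewrite !coord_repE.
- by move=> i k; apply: CkN => //; exact: hX.2.
Qed.

Lemma vector_fieldB U X Y : open_in A U -> vector_field A U X ->
  vector_field A U Y -> vector_field A U (X - Y).
Proof. by move=> oU hX hY; apply: vector_fieldD => //; exact: vector_fieldN. Qed.

Lemma vector_fieldZ U (f : P -> R) X : open_in A U -> smooth_fun A U f ->
  vector_field A U X -> vector_field A U (fun p => f p *: X p).
Proof.
move=> oU hf hX; apply: (vector_fieldI (g := fun i y =>
  coord_rep (A i) f y *: coord_rep (A i) (X ^~ i) y)) => //.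
- by move=> p Up; apply: tangentZ => //; exact: hX.1.
- by move=> i p Up di; rewrite !coord_repE.
- by move=> i k; apply: CkZ => //; [exact: hf|exact: hX.2].
Qed.

Lemma vector_field_sum U (T : finType) (X : T -> P -> I -> E) : open_in A U ->
  (forall a, vector_field A U (X a)) -> vector_field A U (\sum_a X a).
Proof.
move=> oU hX; apply: (big_ind (vector_field A U)) => //.
  exact: vector_field0.
by move=> ? ?; exact: vector_fieldD.
Qed.

Lemma bracketE U X Y i p : open_in A U -> vector_field A U X ->
  vector_field A U Y -> U p -> chart_dom (A i) p ->
  bracket A X Y p i = 'd (coord_rep (A i) (Y ^~ i)) (A i p) (X p i) -
                      'd (coord_rep (A i) (X ^~ i)) (A i p) (Y p i).
Proof. by []. Qed.

(** The transformation law of the components, differentiated along X. The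
    second derivative of the transition is symmetric in X and Y, so that it
    drops out of the bracket. *)
Lemma field_diff_change U X Y i k p : open_in A U -> vector_field A U X ->
  vector_field A U Y -> U p -> chart_dom (A i) p -> chart_dom (A k) p ->
  'd (coord_rep (A k) (Y ^~ k)) (A k p) (X p k) =
  'd (fun y => 'd (transition A i k) y (Y p i)) (A i p) (X p i) +
  'd (transition A i k) (A i p)
     ('d (coord_rep (A i) (Y ^~ i)) (A i p) (X p i)).
Proof.
move=> oU hX hY Up di dk.
pose W := A i @` ((U `&` chart_dom (A k)) `&` chart_dom (A i)).
have oW : open W by apply: open_inI => //; exact: atlas_open.
have Wp : W (A i p) by exists p.
have hT : Ck 2 W (transition A i k).
  by apply: Ck_sub (atlas_smooth gA i k 2); apply: image_subset => q [[]].
have E1 y : W y -> 'd (transition A i k) y (coord_rep (A i) (Y ^~ i) y) =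
    coord_rep (A k) (Y ^~ k) (transition A i k y).
  move=> [q [[Uq dkq] diq] <-]; rewrite transitionE// !coord_repE//.
  by rewrite (hY.1 q Uq i k).
have h1 := has_diff_diff_app frame hT Wp (field_diff hY Up di).
have [_ e1] := has_diff_on oW Wp E1 h1.
have h2 : has_diff (fun y => coord_rep (A k) (Y ^~ k) (transition A i k y))
  (A i p) (fun v => 'd (coord_rep (A k) (Y ^~ k)) (A k p)
     ('d (transition A i k) (A i p) v)).
  apply: has_diff_comp (transition_diff di dk) _.
  by rewrite transitionE//; exact: field_diff hY Up dk.
have [_ e2] := h2.
by rewrite (hX.1 p Up i k)// -e2 e1 coord_repE.
Qed.

Lemma vector_field_bracket U X Y : open_in A U -> vector_field A U X ->
  vector_field A U Y -> vector_field A U (bracket A X Y).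
Proof.
move=> oU hX hY; apply: (vector_fieldI (g := fun i y =>
  'd (coord_rep (A i) (Y ^~ i)) y (coord_rep (A i) (X ^~ i) y) -
  'd (coord_rep (A i) (X ^~ i)) y (coord_rep (A i) (Y ^~ i) y))) => //.
- move=> p Up i k di dk.
  rewrite (bracketE oU hX hY Up dk) (bracketE oU hX hY Up di).
  rewrite (field_diff_change oU hX hY Up di dk).
  rewrite (field_diff_change oU hY hX Up di dk) linearB opprD addrACA.
  rewrite (schwarz (X p i) (Y p i) frame (@atlas_open gA k i) _
    (atlas_smooth gA i k 2)); first by rewrite subrr add0r.
  by exists p.
- by move=> i p Up di; rewrite (bracketE oU hX hY Up di) !coord_repE.
- move=> i k; apply: CkB => //; apply: Ck_diff_app => //.
  + exact: hY.2.
  + exact: hX.2.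
  + exact: hX.2.
  + exact: hY.2.
Qed.

End Atlas.

(** * Curves and jets *)

Section Coordinates.
Context {R : realType}.
Let oT (V : normedModType R) : open [set: V]. Proof. exact: openT. Qed.
Implicit Types V W Z : normedModType R.

Lemma Ck_fst V W Z k (U : set V) (f : V -> W * Z) : open U -> Ck k U f ->
  Ck k U (fun y => (f y).1).
Proof.
by move=> oU; apply: (Ck_lincomp (L := fst : {linear (W * Z)%type -> W})) => // x;
  exact: cvg_fst.
Qed.

Lemma Ck_snd V W Z k (U : set V) (f : V -> W * Z) : open U -> Ck k U f ->
  Ck k U (fun y => (f y).2).
Proof.
by move=> oU; apply: (Ck_lincomp (L := snd : {linear (W * Z)%type -> Z})) => // x;
  exact: cvg_snd.
Qed.

Lemma has_diff_fst V W Z (f df : V -> W * Z) x : has_diff f x df ->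
  has_diff (fun y => (f y).1) x (fun v => (df v).1).
Proof.
by apply: (has_diff_lincomp (L := fst : {linear (W * Z)%type -> W})) => y;
  exact: cvg_fst.
Qed.

Lemma has_diff_snd V W Z (f df : V -> W * Z) x : has_diff f x df ->
  has_diff (fun y => (f y).2) x (fun v => (df v).2).
Proof.
by apply: (has_diff_lincomp (L := snd : {linear (W * Z)%type -> Z})) => y;
  exact: cvg_snd.
Qed.

Lemma Ck_id V k (U : set V) : open U -> Ck k U (fun y => y).
Proof. by move=> oU; apply: (@Ck_lin _ _ _ _ _ idfun) => // x; exact: cvg_id. Qed.

Lemma has_diff_derive1 W (f : R -> W) (x : R) : differentiable f x ->
  has_diff f x (fun h => h *: derive1n 1 f x).
Proof. by move=> fd; split=> // v; rewrite deriv1E//; exact/derivable1_diffP. Qed.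

Lemma derive1_has_diff W (f df : R -> W) (x : R) : has_diff f x df ->
  derive1n 1 f x = df 1.
Proof. by move=> [fd fe]; rewrite derive1n1 derive1E' ?fe. Qed.

Lemma has_diff_derive (f : R -> R) (x d : R) : is_derive x 1 f d ->
  has_diff f x (fun h => h *: d).
Proof.
move=> [h1 h2]; have fd : differentiable f x by exact/derivable1_diffP.
by split=> // v; rewrite deriv1E// derive1E h2.
Qed.

Lemma Ck_sin_cos k : Ck k setT (@sin R) /\ Ck k setT (@cos R).
Proof.
elim: k => [|k [ih1 ih2]].
  by split=> x _; [exact: continuous_sin|exact: continuous_cos].
have ids v : Ck k setT (fun=> v : R) by exact: Ck_cst (oT _).
split.
- apply: (@Ck_intro R R R k setT (@sin R) (fun x h => h *: cos x) (oT _)).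
    by move=> x _; apply: has_diff_derive; exact: is_derive_sin.
  by move=> v; exact: (CkZ (oT _) (ids _ v) ih2).
- apply: (@Ck_intro R R R k setT (@cos R) (fun x h => h *: - sin x) (oT _)).
    by move=> x _; apply: has_diff_derive; exact: is_derive_cos.
  by move=> v; exact: (CkZ (oT _) (ids _ v) (CkN (oT _) ih1)).
Qed.

End Coordinates.

Section BaseManifold.
Context {R : realType} {n : nat} {M : topologicalType} {I : Type}.
Variable phi : I -> chart M 'rV[R]_n.
Hypothesis hM : smooth_manifold phi.

Lemma base_atlas : good_atlas phi.
Proof.
split.
- exact: finite_frame_rV.
- by move=> i; case: (manifold_charts hM i).
- move=> k i; have [ o1 _ _ h] := manifold_charts hM i.
  have [ o2 _ _ _] := manifold_charts hM k.
  by apply: h; [exact: openI|move=> p []].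
- by move=> i k; rewrite setIC; case: (manifold_compatible hM i k).
Qed.

Let gA := base_atlas.

Lemma coord_rep_id (F : zmodType) (f : R -> F) :
  coord_rep (Chart [set: R] (id : R -> R)) f = f.
Proof.
apply/funext => x; apply: (coord_repE (c := Chart [set: R] (id : R -> R))) => //.
Qed.

Lemma smooth_curveP (g : R -> M) : smooth_curve phi g <->
  forall k, open (g @^-1` chart_dom (phi k)) /\
            smooth_on (g @^-1` chart_dom (phi k)) (phi k \o g).
Proof.
rewrite /smooth_curve /smooth_map; split=> [h k|h _ k] /=.
  by have /= := h tt k; rewrite setTI image_id coord_rep_id.
by rewrite setTI image_id coord_rep_id.
Qed.

Lemma curve_diff g k t : smooth_curve phi g -> chart_dom (phi k) (g t) ->
  has_diff (phi k \o g) t (fun h => h *: derive1n 1 (phi k \o g) t).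
Proof.
move=> /smooth_curveP/(_ k)[_ h] dk; apply: has_diff_derive1.
by case: (h 1) => + _; apply.
Qed.

Lemma curve_velocity g i k t : smooth_curve phi g ->
  chart_dom (phi i) (g t) -> chart_dom (phi k) (g t) ->
  derive1n 1 (phi k \o g) t =
  'd (transition phi i k) (phi i (g t)) (derive1n 1 (phi i \o g) t).
Proof.
move=> hg di dk; have [ oW _] := (smooth_curveP g).1 hg i.
have h : has_diff (fun s => transition phi i k ((phi i \o g) s)) t (fun h =>
    'd (transition phi i k) (phi i (g t)) (h *: derive1n 1 (phi i \o g) t)).
  by apply: has_diff_comp (curve_diff hg di) (transition_diff gA di dk).
have E s : (g @^-1` chart_dom (phi i)) s ->
    transition phi i k ((phi i \o g) s) = (phi k \o g) s.
  by move=> ds; rewrite (transitionE gA).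
by rewrite (derive1_has_diff (has_diff_on oW di E h)) scale1r.
Qed.

Lemma same_jet_refl r t g : same_jet phi r t g g. Proof. by split. Qed.

Lemma same_jet_sym r t g h : same_jet phi r t g h -> same_jet phi r t h g.
Proof.
by move=> [e1 e2]; split=> // i; rewrite -e1 => di k kr; rewrite e2.
Qed.

Lemma same_jet_trans r t f g h :
  same_jet phi r t f g -> same_jet phi r t g h -> same_jet phi r t f h.
Proof.
move=> [e1 e2] [e3 e4]; split; first by rewrite e1.
by move=> i di k kr; rewrite e2// e4// -e1.
Qed.

(** By the chain rule, the velocity in one chart determines it in the others. *)
Lemma same_jet1 i t g h : smooth_curve phi g -> smooth_curve phi h ->
  chart_dom (phi i) (g t) -> g t = h t ->
  derive1n 1 (phi i \o g) t = derive1n 1 (phi i \o h) t ->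
  same_jet phi 1 t g h.
Proof.
move=> hg hh di e e1; split; first by [].
move=> k dk [|[|m]] hm.
- by rewrite /derive1n /= e.
- have dk' : chart_dom (phi k) (h t) by rewrite -e.
  have di' : chart_dom (phi i) (h t) by rewrite -e.
  by rewrite (curve_velocity hg di dk) (curve_velocity hh di' dk') e1 e.
- by exfalso; move: hm; rewrite ltnS ltn0.
Qed.

Lemma jet_ext r (j j' : jet phi r) : jet_source j = jet_source j' ->
  same_jet phi r (jet_source j) (jet_curve j) (jet_curve j') -> j = j'.
Proof.
have cE (l : jet phi r) : jet_class l = jet_class_of phi r (jet_source l)
  (jet_curve l).
  by rewrite /jet_curve; case: cid2.
move=> es sj; have ec : jet_class j = jet_class j'.
  rewrite !cE -es; apply/seteqP; split=> h [hh sh]; split=> //.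
    exact: same_jet_trans (same_jet_sym sj) sh.
  exact: same_jet_trans sj sh.
case: j j' es ec {sj} => [t c pj] [t' c' pj'] /= e1 e2.
by move: pj pj'; rewrite -e1 -e2 => pj pj'; congr Jet; exact: Prop_irrelevance.
Qed.

(** [jet_curve] picks some representative of the jet, in general not g. *)
Lemma mk_jet_same r t g (hg : smooth_curve phi g) :
  same_jet phi r t g (jet_curve (mk_jet r t hg)).
Proof.
rewrite /jet_curve; case: cid2 => h /= hh e.
have : jet_class_of phi r t h h by split=> //; exact: same_jet_refl.
by rewrite -e => -[].
Qed.

Lemma mk_jet_target r t g (hg : smooth_curve phi g) :
  jet_target (mk_jet r t hg) = g t.
Proof. by rewrite /jet_target; have [] := mk_jet_same r t hg. Qed.

Lemma mk_jet_coord r t g (hg : smooth_curve phi g) i k : (k <= r)%N ->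
  chart_dom (phi i) (g t) ->
  jet_coord (mk_jet r t hg) i k = derive1n k (phi i \o g) t.
Proof. by move=> kr di; have [_ ->] := mk_jet_same r t hg. Qed.

Lemma jet_coord0 r (j : jet phi r) i : jet_coord j i 0 = phi i (jet_target j).
Proof. by []. Qed.

(** The curve x + e sin((s - t) / e) v stays in a ball contained in the image
    of the chart, so that it is a curve on M for all times. *)
Lemma curve_exists i p v t : chart_dom (phi i) p ->
  exists g, [/\ smooth_curve phi g, g t = p & derive1n 1 (phi i \o g) t = v].
Proof.
move=> dp; have oi : open (phi i @` chart_dom (phi i)).
  by have := atlas_open gA i i; rewrite setIid.
have : nbhs (phi i p) (phi i @` chart_dom (phi i)).
  by apply: open_nbhs_nbhs; split=> //; exists p.
move=> /nbhs_ballP[d /= d0 hd].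
have m0 : 0 < `|v| + 1 by rewrite ltr_wpDl.
pose e := d / (`|v| + 1); have e0 : 0 < e by rewrite divr_gt0.
pose c (s : R) := phi i p + (e * sin (e^-1 * (s - t))) *: v.
have cin s : (phi i @` chart_dom (phi i)) (c s).
  apply: hd; rewrite -ball_normE /= opprD addNKr normrN normrZ normrM.
  rewrite (gtr0_norm e0); apply: (@le_lt_trans _ _ (e * `|v|)).
    by apply: ler_wpM2r => //; apply: ler_piMr; [exact: ltW|exact: sin_max].
  by rewrite -[ltRHS](divfK (lt0r_neq0 m0)) ltr_pM2l// ltrDl.
pose g s := sval (cid2 (cin s)).
have dg s : chart_dom (phi i) (g s) by rewrite /g; case: cid2.
have gc s : phi i (g s) = c s by rewrite /g; case: cid2.
have hlin (s : R) : has_diff (fun s => e^-1 * (s - t)) s (fun h => e^-1 * h).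
  apply: has_diff_eq (has_diffZ (has_diff_cst (e^-1) s)
     (has_diffB (has_diff_id s) (has_diff_cst t s))) => h.
  by rewrite scale0r add0r subr0.
have ck k : Ck k setT c.
  have oR : open [set: R] by exact: openT.
  have cst (W : normedModType R) (a : W) : Ck k [set: R] (fun _ : R => a).
    exact: Ck_cst.
  have cs : Ck k setT (fun s : R => e^-1 * (s - t)).
    exact: (CkZ oR (cst R e^-1) (CkB oR (Ck_id k oR) (cst R t))).
  have csin : Ck k setT (fun s : R => sin (e^-1 * (s - t))).
    exact: (Ck_comp (@finite_frame_R R) oR _ cs (@Ck_sin_cos R k).1).
  exact: (CkD oR (cst _ _) (CkZ oR (CkZ oR (cst R e) csin) (cst _ v))).
have hg : smooth_curve phi g.
  apply/smooth_curveP => k.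
  have E1 : g @^-1` chart_dom (phi k) =
      c @^-1` (phi i @` (chart_dom (phi k) `&` chart_dom (phi i))).
    apply/seteqP; split=> [s dk|s [q [dk di] e1]] /=; first by exists (g s).
    suff -> : g s = q by [].
    by apply: (atlas_inj gA (i := i)); rewrite ?gc//; exact: mem_set.
  have oc : open (g @^-1` chart_dom (phi k)).
    rewrite E1; apply: open_comp; last exact: atlas_open.
    by move=> s _; exact: (ck 0).
  split=> // m.
  have : Ck m (g @^-1` chart_dom (phi k)) (fun s => transition phi i k (c s)).
    apply: (Ck_comp (finite_frame_rV n) oc _ _ (atlas_smooth gA i k m)).
      by rewrite E1.
    exact: Ck_sub (ck m).
  by apply: Ck_eq => // s ds; rewrite -gc (transitionE gA).
exists g; split=> //.
  apply: (atlas_inj gA (i := i)); rewrite ?gc; try exact: mem_set.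
  by rewrite /c subrr mulr0 sin0 mulr0 scale0r addr0.
have -> : phi i \o g = c by apply/funext => s /=.
have h1 : has_diff (@sin R) (e^-1 * (t - t)) (fun h => h *: cos (e^-1 * (t - t))).
  by apply: has_diff_derive; exact: is_derive_sin.
have h2 := has_diff_comp (hlin t) h1.
have h3 := has_diffZ (has_diff_cst e t) h2.
have h4 := has_diffD (has_diff_cst (phi i p) t) (has_diffZ h3 (has_diff_cst v t)).
have E4 : derive1n 1 c t = _ := derive1_has_diff h4.
apply: etrans E4 _; rewrite scaler0 addr0 add0r scale0r add0r.
rewrite subrr mulr0 cos0 mulr1 [_ *: 1]mulr1 [_ *: _^-1]divff ?scale1r//.
exact: lt0r_neq0.
Qed.

End BaseManifold.

(** * The manifold of 1-jets *)

Section JetAtlas.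
Context {R : realType} {n : nat} {M : topologicalType} {I : Type}.
Variable phi : I -> chart M 'rV[R]_n.
Hypothesis hM : smooth_manifold phi.
Local Notation A1 := (chart1 phi).
Local Notation E1 := (R * 'rV[R]_n * 'rV[R]_n)%type.

Let gA := base_atlas hM.

Lemma frame_E1 : finite_frame E1.
Proof.
apply: finite_frame_prod; last exact: finite_frame_rV.
by apply: finite_frame_prod; [exact: finite_frame_R|exact: finite_frame_rV].
Qed.

Lemma chart1_inj i : set_inj (chart_dom (A1 i)) (A1 i).
Proof.
move=> j j' /set_mem dj /set_mem dj' [e1 e2 e3].
apply: (jet_ext e1).
have et : jet_target j = jet_target j'.
  exact: (atlas_inj gA (mem_set dj) (mem_set dj') e2).
apply: (same_jet1 hM (jet_curve_smooth j) (jet_curve_smooth j') dj).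
  by rewrite -/(jet_target j) et /jet_target e1.
by move: e3; rewrite /jet_coord -e1.
Qed.

Lemma chart1_surj i t p v : chart_dom (phi i) p ->
  exists j : jet phi 1, [/\ jet_source j = t, jet_target j = p &
    A1 i j = (t, phi i p, v)].
Proof.
move=> dp; have [g [hg gp gv]] := curve_exists hM v t dp.
exists (mk_jet 1 t hg); split=> //; first by rewrite mk_jet_target.
by rewrite /= jet_coord0 mk_jet_target gp mk_jet_coord// ?gp// gv.
Qed.

(** Every time and velocity occur over every point of M, by [chart1_surj]:
    this is what makes the images of the charts of the jet space open. *)
Lemma chart1_image i (V : set M) :
  A1 i @` ([set j | V (jet_target j)] `&` chart_dom (A1 i)) =
  [set y | (phi i @` (V `&` chart_dom (phi i))) y.1.2].
Proof.
apply/seteqP; split=> [_ [j [Vj dj] <-] /=|[[t x] v] /= [p [Vp dp] <-]].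
  by exists (jet_target j).
have [j [ej ep ev]] := chart1_surj t v dp.
by exists j; rewrite //= ep.
Qed.

Lemma open_cylinder (O : set 'rV[R]_n) : open O -> open [set y : E1 | O y.1.2].
Proof.
move=> oO; have : open ((fun y : E1 => y.1.2) @^-1` O); last by [].
apply: open_comp oO => y _.
by apply: (@continuous_comp _ _ _ fst snd); [exact: cvg_fst|exact: cvg_snd].
Qed.

Lemma open_chart1 k : open_in A1 (chart_dom (A1 k)).
Proof.
move=> i; have -> : A1 i @` (chart_dom (A1 k) `&` chart_dom (A1 i)) = _ :=
  chart1_image i (chart_dom (phi k)).
exact: open_cylinder (atlas_open gA k i).
Qed.

Lemma jet_velocity i k (j : jet phi 1) : chart_dom (A1 i) j ->
  chart_dom (A1 k) j ->
  jet_coord j k 1 =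
  'd (transition phi i k) (phi i (jet_target j)) (jet_coord j i 1).
Proof. by move=> di dk; exact: (curve_velocity hM (jet_curve_smooth j)). Qed.

(** The first prolongation of the change of coordinates of M. *)
Definition jet_transition i k (y : E1) : E1 :=
  (y.1.1, transition phi i k y.1.2, 'd (transition phi i k) (y.1.2) y.2).

Lemma jet_transitionE i k j : chart_dom (A1 i) j -> chart_dom (A1 k) j ->
  jet_transition i k (A1 i j) = A1 k j.
Proof.
move=> di dk; rewrite /jet_transition /= !jet_coord0 (transitionE gA)//.
by rewrite -jet_velocity.
Qed.

Lemma jet_transition_smooth i k :
  smooth_on (A1 i @` (chart_dom (A1 k) `&` chart_dom (A1 i))) (jet_transition i k).
Proof.
move=> m.
have oW : open (A1 i @` (chart_dom (A1 k) `&` chart_dom (A1 i))) by exact: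
  open_chart1.
have sub y : (A1 i @` (chart_dom (A1 k) `&` chart_dom (A1 i))) y ->
  (phi i @` (chart_dom (phi k) `&` chart_dom (phi i))) y.1.2.
  by move=> [j [dk di] <-]; exists (jet_target j).
set W := A1 i @` _ in oW sub *.
have c12 l : Ck l W (fun y : E1 => y.1.2).
  by apply: Ck_snd => //; apply: Ck_fst => //; exact: Ck_id.
have c2 l : Ck l W (fun y : E1 => y.2) by apply: Ck_snd => //; exact: Ck_id.
have cT l : Ck l W (fun y : E1 => transition phi i k y.1.2).
  exact: (Ck_comp (finite_frame_rV n) oW sub _ (atlas_smooth gA i k l)).
apply: Ck_pair => //; first apply: Ck_pair => //.
  by apply: Ck_fst => //; apply: Ck_fst => //; exact: Ck_id.
have hd (y : E1) : W y -> 'd (fun y : E1 => transition phi i k y.1.2) y (0,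
  y.2, 0) =
    'd (transition phi i k) (y.1.2) y.2.
  move=> /sub [p [dk di] e].
  have h : has_diff (fun y : E1 => y.1.2) y (fun v => v.1.2).
    by apply: has_diff_snd; apply: has_diff_fst; exact: has_diff_id.
  have h2 : has_diff (transition phi i k) (y.1.2) ('d (transition phi i k) (y.1.2)).
    by rewrite -e; exact: (transition_diff gA di dk).
  by have [_ ->] := has_diff_comp h h2.
apply: Ck_eq hd _ => //.
apply: Ck_diff_app => //; first exact: frame_E1.
by apply: Ck_pair => //; [apply: Ck_pair|] => //; exact: Ck_cst.
Qed.

Lemma jet_atlas : good_atlas A1.
Proof.
split.
- exact: frame_E1.
- exact: chart1_inj.
- exact: open_chart1.
- move=> i k m; apply: Ck_eq (jet_transition_smooth i k m); first exact:
  open_chart1.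
  move=> _ [j [dk di] <-]; rewrite jet_transitionE//.
  by rewrite /transition coord_repE//; exact: chart1_inj.
Qed.

End JetAtlas.

Section Sode.
Context {R : realType} {n : nat} {M : topologicalType} {I : Type}.
Variables (phi : I -> chart M 'rV[R]_n) (sigma : jet phi 1 -> jet phi 2).
Hypothesis hM : smooth_manifold phi.
Hypothesis hs : sode sigma.
Local Notation A1 := (chart1 phi).
Local Notation E1 := (R * 'rV[R]_n * 'rV[R]_n)%type.
Let gA := base_atlas hM.
Let gJ := jet_atlas hM.

Lemma sode_source j : jet_source (sigma j) = jet_source j.
Proof. by rewrite -[in RHS](hs.2 j). Qed.

Lemma sode_target j : jet_target (sigma j) = jet_target j.
Proof. by rewrite -[in RHS](hs.2 j) /jet_proj mk_jet_target. Qed.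

Lemma sode_velocity j i : chart_dom (A1 i) j ->
  jet_coord (sigma j) i 1 = jet_coord j i 1.
Proof.
move=> di; rewrite -[in RHS](hs.2 j) /jet_proj mk_jet_coord//.
by rewrite -/(jet_target _) sode_target.
Qed.

Lemma force_smooth i :
  smooth_on (A1 i @` chart_dom (A1 i)) (coord_rep (A1 i) (force sigma i)).
Proof.
move=> m; have /= [ oW h] := hs.1 i i.
have E0 : [set j | chart_dom (phi i) (jet_target j)] `&`
   sigma @^-1` [set j | chart_dom (phi i) (jet_target j)] = chart_dom (A1 i).
  by apply/seteqP; split=> [j []//|j dj]; split=> //=; rewrite sode_target.
rewrite E0 in oW h.
apply: Ck_eq oW _ (Ck_snd oW (h m)) => _ [j dj <-].
by rewrite !(coord_repE _ (@chart1_inj _ _ _ _ _ hM i)).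
Qed.

(** X^sigma at j is the velocity of s |-> j^1_s g, where g is any curve that
    represents sigma j; and the velocity of a curve is a tangent vector. *)
Lemma X_sigma_tangent j : tangent A1 j (X_sigma sigma j).
Proof.
move=> i k di dk.
pose g := jet_curve (sigma j); pose t := jet_source (sigma j).
have hg : smooth_curve phi g by exact: jet_curve_smooth.
pose gam (l : I) (s : R) : E1 := (s, phi l (g s), derive1n 1 (phi l \o g) s).
have gt : g t = jet_target j by rewrite -sode_target.
have gamt l : chart_dom (A1 l) j -> gam l t = A1 l j.
  move=> dl; rewrite -[RHS]/(jet_source j, phi l (jet_target j), jet_coord j l 1).
  by rewrite -sode_velocity// -sode_source -gt.
have hgam l : chart_dom (A1 l) j ->
    has_diff (gam l) t (fun h => h *: X_sigma sigma j l).
  move=> dl; have dl' : chart_dom (phi l) (g t) by rewrite gt.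
  have c1 := curve_diff hg dl'.
  have c2 : has_diff (derive1n 1 (phi l \o g)) t
      (fun h => h *: derive1n 2 (phi l \o g) t).
    suff : differentiable (derive1n 1 (phi l \o g)) t.
      exact: has_diff_derive1.
    have /smooth_curveP/(_ l)[ oW h] := hg.
    have [_ /(_ 1) h2] := h 2.
    have E s : (g @^-1` chart_dom (phi l)) s ->
        'd (phi l \o g) s 1 = derive1n 1 (phi l \o g) s.
      move=> ds; have [_ ->] := curve_diff hg ds.
      by rewrite scale1r.
    have dd : has_diff (fun s => 'd (phi l \o g) s 1) t
       ('d (fun s => 'd (phi l \o g) s 1) t) by apply: has_diffP; exact: h2.1.
    by have [] := has_diff_on oW dl' E dd.
  have c3 := has_diff_pair (has_diff_pair (has_diff_id t) c1) c2.
  have eX : X_sigma sigma j l =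
      (1, derive1n 1 (phi l \o g) t, derive1n 2 (phi l \o g) t).
    rewrite /X_sigma /velocity -(sode_velocity dl); reflexivity.
  rewrite eX; apply: has_diff_eq c3 => h.
  by congr ((_, _), _); rewrite [RHS]mulr1.
have [ oW _] := (smooth_curveP phi g).1 hg i.
have [ oW' _] := (smooth_curveP phi g).1 hg k.
have E s : (g @^-1` chart_dom (phi i) `&` g @^-1` chart_dom (phi k)) s ->
    jet_transition phi i k (gam i s) = gam k s.
  move=> [dis dks]; rewrite /jet_transition /gam /= (transitionE gA)//.
  by rewrite -(curve_velocity hM hg).
have Tk y : (A1 i @` (chart_dom (A1 k) `&` chart_dom (A1 i))) y ->
    transition A1 i k y = jet_transition phi i k y.
  move=> [q [dqk dqi] <-]; rewrite (jet_transitionE hM)//.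
  exact: (transitionE gJ).
have hT : has_diff (jet_transition phi i k) (gam i t)
    ('d (transition A1 i k) (A1 i j)).
  rewrite (gamt i di).
  have Wj : (A1 i @` (chart_dom (A1 k) `&` chart_dom (A1 i))) (A1 i j) by exists j.
  exact: (has_diff_on (atlas_open gJ k i) Wj Tk (transition_diff gJ di dk)).
have hc := has_diff_comp (hgam i di) hT.
have tW : (g @^-1` chart_dom (phi i) `&` g @^-1` chart_dom (phi k)) t.
  by split; rewrite /= gt.
have [_ e1] := has_diff_on (openI oW oW') tW E hc.
have [_ e2] := hgam k dk.
have E1' := etrans (esym (e2 1)) (e1 1).
rewrite -[LHS](scale1r (X_sigma sigma j k)) -(scale1r (X_sigma sigma j i)).
exact: E1'.
Qed.

End Sode.

(** * Adapted components at a point *)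

Section DiffLin.
Context {R : realType} {V W : normedModType R}.
Lemma diff_linP (f : V -> W) x a u v :
  'd f x (a *: u + v) = a *: 'd f x u + 'd f x v.
Proof. exact: linearP. Qed.
Lemma diff_linD (f : V -> W) x u v : 'd f x (u + v) = 'd f x u + 'd f x v.
Proof. exact: linearD. Qed.
End DiffLin.

Section AdaptedPoint.
Context {R : realType} {n : nat}.
Local Notation V := 'rV[R]_n.
Local Notation E1 := (R * V * V)%type.
Variable F : E1 -> V.
Implicit Types (y x c Z : E1) (w om : V).

(** The coefficients 1/2 dF/dx' of the splitting, contracted with w. *)
Definition ncoef y w : V := 2^-1 *: 'd F y ((0, 0, w) : E1).

Definition dvert om y : V := 'd F y ((0, 0, om) : E1).

(** The derivative of y |-> ncoef y om along Z. *)
Definition dncoef y om Z : V := 2^-1 *: 'd (dvert om) y Z.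

(** 1/2 d^2F/dx'dx', contracted with w and om. *)
Definition scoef y w om : V := dncoef y om (0, 0, w).

(** The components of Z in the frame X^sigma, X^sigma_a, d/dx'^a at y. They
    are locked because comparing two vectors must not unfold them. *)
Definition adapt_expr y Z : E1 :=
  let om := Z.1.2 - Z.1.1 *: y.2 in
  (Z.1.1, om, Z.2 - Z.1.1 *: F y - ncoef y om).
Fact adapt_key : unit. Proof. by []. Qed.
Definition adapt := locked_with adapt_key adapt_expr.

Lemma adaptE y Z : adapt y Z = (Z.1.1, Z.1.2 - Z.1.1 *: y.2,
  Z.2 - Z.1.1 *: F y - ncoef y (Z.1.2 - Z.1.1 *: y.2)).
Proof. by rewrite /adapt unlock. Qed.

Definition frame y c : E1 :=
  (c.1.1, c.1.1 *: y.2 + c.1.2, c.1.1 *: F y + ncoef y c.1.2 + c.2).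

Lemma vert_lin : linear (fun w : V => (0, 0, w) : E1).
Proof. by move=> a u v; congr ((_, _), _); rewrite /= ?mulr0 ?scaler0 addr0. Qed.

Lemma ncoef_lin y : linear (ncoef y).
Proof.
by move=> a u v; rewrite /ncoef vert_lin diff_linP scalerDr !scalerA mulrC.
Qed.
HB.instance Definition _ y := GRing.isLinear.Build R V V _ (ncoef y) (ncoef_lin y).

Lemma dncoef_lin y om : linear (dncoef y om).
Proof.
by move=> a u v; rewrite /dncoef diff_linP scalerDr !scalerA mulrC.
Qed.
HB.instance Definition _ y om := GRing.isLinear.Build R E1 V _ (dncoef y om)
  (dncoef_lin y om).

Lemma scoef_lin y om : linear (scoef y ^~ om).
Proof. by move=> a u v; rewrite /scoef vert_lin dncoef_lin. Qed.

Lemma frameK y : cancel (frame y) (adapt y).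
Proof.
move=> [[a w] m]; rewrite adaptE /frame /=.
have -> : a *: y.2 + w - a *: y.2 = w by rewrite addrC addKr.
by congr ((_, _), _); apply/rowP => k; rewrite !mxE; ring.
Qed.

Lemma adaptK y : cancel (adapt y) (frame y).
Proof.
move=> [[a w] m]; rewrite adaptE /frame /=; set N := ncoef _ _.
congr ((_, _), _); first by rewrite addrC subrK.
by apply/rowP => k; rewrite !mxE; ring.
Qed.

Lemma adapt_lin y : linear (adapt y).
Proof.
move=> r [[a u] v] [[a' u'] v'].
have e : (r *: (a, u, v) + (a', u', v') : E1) = (r * a + a', r *: u + u', r *:
  v + v') by [].
rewrite e !adaptE /=.
have e2 : r *: u + u' - (r * a + a') *: y.2 =
   r *: (u - a *: y.2) + (u' - a' *: y.2).
  by apply/rowP => k; rewrite !mxE; ring.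
rewrite e2 ncoef_lin; congr ((_, _), _).
by apply/rowP => k; rewrite !mxE; ring.
Qed.
HB.instance Definition _ y := GRing.isLinear.Build R E1 E1 _ (adapt y)
  (adapt_lin y).

Lemma frame_lin y : linear (frame y).
Proof.
move=> r a b; apply: (can_inj (adaptK y)).
by rewrite adapt_lin !frameK.
Qed.
HB.instance Definition _ y := GRing.isLinear.Build R E1 E1 _ (frame y)
  (frame_lin y).

Lemma adaptD y u v : adapt y (u + v) = adapt y u + adapt y v.
Proof. exact: linearD. Qed.
Lemma adaptN y u : adapt y (- u) = - adapt y u.
Proof. exact: linearN. Qed.
Lemma adaptB y u v : adapt y (u - v) = adapt y u - adapt y v.
Proof. exact: linearB. Qed.
Lemma adaptZ y (a : R) u : adapt y (a *: u) = a *: adapt y u.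
Proof. exact: linearZ. Qed.

Lemma frameB y u v : frame y (u - v) = frame y u - frame y v.
Proof. exact: linearB. Qed.
Lemma ncoefD y u v : ncoef y (u + v) = ncoef y u + ncoef y v.
Proof. exact: linearD. Qed.
Lemma ncoefB y u v : ncoef y (u - v) = ncoef y u - ncoef y v.
Proof. exact: linearB. Qed.
Lemma ncoefZ y (a : R) u : ncoef y (a *: u) = a *: ncoef y u.
Proof. exact: linearZ. Qed.

(** The frame is not holonomic: with [bracket_vel], this is what the
    derivatives of its coefficients contribute to a bracket. *)
Definition bracket_pos y x c : V := c.1.1 *: (frame y x).2 - x.1.1 *: (frame y c).2.

Definition bracket_vel y x c : V :=
  c.1.1 *: 'd F y (frame y x) - x.1.1 *: 'd F y (frame y c) +
  (dncoef y c.1.2 (frame y x) - dncoef y x.1.2 (frame y c)).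

Definition bracket_corr y x c : E1 := (0, bracket_pos y x c, bracket_vel y x c
  - ncoef y (bracket_pos y x c)).

Definition gamma y x w : V := x.1.1 *: ncoef y w + scoef y w x.1.2.

Definition christoffel y x c : E1 := (0, gamma y x c.1.2, gamma y x c.2).

Lemma gamma_lin y x : linear (gamma y x).
Proof.
move=> a u v; rewrite /gamma ncoef_lin scoef_lin.
move: (ncoef y u) (ncoef y v) (scoef y u _) (scoef y v _) => n1 n2 s1 s2.
by apply/rowP => k; rewrite !mxE; ring.
Qed.
HB.instance Definition _ y x := GRing.isLinear.Build R V V _ (gamma y x)
  (gamma_lin y x).

Lemma adapt_add y c (u w : V) :
  adapt y (frame y c + (0, u, w)) = c + (0, u, w - ncoef y u).
Proof.
rewrite adaptD frameK; congr (_ + _); rewrite adaptE /=.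
by rewrite !scale0r !subr0.
Qed.

Lemma bracket_posE y x c : bracket_pos y x c =
  c.1.1 *: (ncoef y x.1.2 + x.2) - x.1.1 *: (ncoef y c.1.2 + c.2).
Proof.
rewrite /bracket_pos /frame /=; move: (ncoef y _) (ncoef y _) (F y) => n1 n2 f.
by apply/rowP => k; rewrite !mxE; ring.
Qed.

Lemma frame_split y x : frame y x = frame y (x.1, 0) + (0, 0, x.2).
Proof.
case: x => [[a u] v]; rewrite /frame /= addr0; congr ((_, _), _) => /=.
- by rewrite addr0.
- by rewrite addr0.
Qed.

Lemma diff_vert y w : 'd F y ((0, 0, w) : E1) = 2 *: ncoef y w.
Proof. by rewrite /ncoef scalerA mulfV ?scale1r// pnatr_eq0. Qed.

(** The first term is the curvature of the splitting, on the horizontal parts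
    of x and c; the other terms involve their vertical parts. *)
Lemma bracket_corr_split y x c :
  (bracket_corr y x c).2 = (bracket_corr y (x.1, 0) (c.1, 0)).2 +
   (c.1.1 *: ncoef y x.2 - x.1.1 *: ncoef y c.2 + (scoef y x.2 c.1.2 - scoef y
     c.2 x.1.2)).
Proof.
have D2D om u v : dncoef y om (u + v) = dncoef y om u + dncoef y om v by exact:
  linearD.
rewrite /bracket_corr /bracket_vel [in LHS](frame_split y x) [in
  LHS](frame_split y c).
rewrite !(diff_linD F).
rewrite !D2D.
rewrite !diff_vert.
rewrite !bracket_posE.
rewrite -!/(scoef _ _ _).
rewrite /= !addr0.
have NE a u v b u' v' : ncoef y (a *: (u + v) - b *: (u' + v')) =
  a *: ncoef y u + a *: ncoef y v - (b *: ncoef y u' + b *: ncoef y v').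
  by rewrite ncoefB !ncoefZ !ncoefD !scalerDr.
have NE' a u b u' : ncoef y (a *: u - b *: u') = a *: ncoef y u - b *: ncoef y u'.
  by rewrite ncoefB !ncoefZ.
rewrite NE NE'.
move: (ncoef y _) (ncoef y _) (ncoef y _) (ncoef y _) ('d F y _) ('d F y _) =>
  n1 n2 n3 n4 f1 f2.
move: (scoef y _ _) (scoef y _ _) (dncoef y _ _) (dncoef y _ _) => s1 s2 d1 d2.
by apply/rowP => k; rewrite !mxE; ring.
Qed.

End AdaptedPoint.

(** * Differentiating adapted components *)

Section AdaptedDifferential.
Context {R : realType} {n : nat}.
Local Notation V := 'rV[R]_n.
Local Notation E1 := (R * V * V)%type.
Variables (F : E1 -> V) (W : set E1).
Hypotheses (oW : open W) (hF : smooth_on W F).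
Implicit Types (x c : E1 -> E1) (y : E1) (w om : E1 -> V).

Let frE : finite_frame E1 := frame_E1.

Lemma scoef_sym y u v : W y -> scoef F y u v = scoef F y v u.
Proof.
move=> Wy; rewrite /scoef /dncoef; congr (_ *: _).
exact: schwarz (finite_frame_rV n) oW Wy (hF 2).
Qed.

Lemma has_diff_ncoef y w dw : W y -> has_diff w y dw ->
  has_diff (fun z => ncoef F z (w z)) y (fun v => ncoef F y (dw v) + dncoef F y
    (w y) v).
Proof.
move=> Wy hw.
have h0 : has_diff (fun z => (0, 0, w z) : E1) y (fun v => (0, 0, dw v)).
  by apply: has_diff_pair hw; exact: has_diff_cst.
have h1 := has_diff_diff_app frE (hF 2) Wy h0.
apply: has_diff_eq (has_diffZ (has_diff_cst (2^-1 : R) y) h1) => v.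
by rewrite scale0r add0r scalerDr addrC.
Qed.

Lemma has_diff_frame y x dx : W y -> has_diff x y dx ->
  has_diff (fun z => frame F z (x z)) y (fun v => frame F y (dx v) +
    (0, (x y).1.1 *: v.2, (x y).1.1 *: 'd F y v + dncoef F y (x y).1.2 v)).
Proof.
move=> Wy hx.
have h1 := has_diff_fst (has_diff_fst hx).
have h2 := has_diff_snd (has_diff_fst hx).
have h3 := has_diff_snd hx.
have hv := has_diff_snd (has_diff_id y).
have hFy := Ck_diff (hF 1) Wy.
have k2 := has_diffD (has_diffZ h1 hv) h2.
have k3 := has_diffD (has_diffD (has_diffZ h1 hFy) (has_diff_ncoef Wy h2)) h3.
apply: has_diff_eq (has_diff_pair (has_diff_pair h1 k2) k3) => v.
congr ((_, _), _) => /=; first by rewrite addr0.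
  by rewrite addrAC.
move: (ncoef _ _ _) (dncoef _ _ _ _) ('d F y v) (F y) => n1 d f1 f.
by apply/rowP => k; rewrite !mxE; ring.
Qed.

(** The structure equations of the frame. Differentiating X = frame x gives
    the derivative of x and those of the frame, which [bracket_corr] collects. *)
Lemma bracket_frame (X C : E1 -> E1) y x dx c dc : W y ->
  (forall z, W z -> X z = frame F z (x z)) ->
  (forall z, W z -> C z = frame F z (c z)) ->
  has_diff x y dx -> has_diff c y dc ->
  adapt F y ('d C y (X y) - 'd X y (C y)) =
  dc (X y) - dx (C y) + bracket_corr F y (x y) (c y).
Proof.
move=> Wy hX hC hx hc.
have [_ eC] := has_diff_on oW Wy (fun z Wz => esym (hC z Wz)) (has_diff_frame
  Wy hc).
have [_ eX] := has_diff_on oW Wy (fun z Wz => esym (hX z Wz)) (has_diff_frame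
  Wy hx).
apply: etrans (congr2 (fun u v => adapt F y (u - v)) (eC (X y)) (eX (C y))) _.
rewrite opprD addrACA -frameB.
have -> (a b c' d : V) : ((0, a, b) : E1) - (0, c', d) = (0, a - c', b - d).
  by congr ((_, _), _); rewrite /= subr0.
by rewrite adapt_add /bracket_corr /bracket_pos /bracket_vel -hX// -hC// opprD
  addrACA.
Qed.

Lemma Ck_ncoef k w : Ck k W w -> Ck k W (fun z => ncoef F z (w z)).
Proof.
move=> hw; apply: CkZ oW (Ck_cst _ _ oW) _.
apply: (Ck_diff_app frE oW (hF k.+1)).
by apply: Ck_pair => //; exact: Ck_cst.
Qed.

(** Only fixed second arguments are covered by [Ck]; the symmetry of the second
    derivative makes it possible to expand a varying one in a frame. *)
Lemma Ck_scoef k w om : Ck k W w -> Ck k W om ->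
  Ck k W (fun z => scoef F z (w z) (om z)).
Proof.
move=> hw ho; have [T [e [l [cl el]]]] := finite_frame_rV (R := R) n.
apply: (Ck_eq (f := fun z => \sum_a l a (om z) *: scoef F z (w z) (e a))) => //.
  move=> z Wz; rewrite scoef_sym// [in RHS](el (om z)).
  have lin : linear (fun u => scoef F z u (w z)) by exact: scoef_lin.
  pose L : {linear V -> V} := HB.pack (fun u => scoef F z u (w z))
    (GRing.isLinear.Build _ _ _ _ _ lin).
  rewrite -[RHS]/(L _) linear_sum; apply: eq_bigr => a _.
  by apply: etrans (esym (linearZZ L _ _)); congr (_ *: _); exact: scoef_sym.
apply: Ck_sum => // a; apply: CkZ => //; first exact: Ck_lincomp.
apply: CkZ oW (Ck_cst _ _ oW) _.
apply: Ck_diff_app => //; first exact: (hF k.+2).2.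
by apply: Ck_pair => //; exact: Ck_cst.
Qed.

Lemma Ck_adapt k x : Ck k W x -> Ck k W (fun z => adapt F z (x z)).
Proof.
move=> hx.
have h1 : Ck k W (fun z => (x z).1.1) by apply: Ck_fst => //; exact: Ck_fst.
have ho : Ck k W (fun z => (x z).1.2 - (x z).1.1 *: z.2).
  apply: CkB => //; first by apply: Ck_snd => //; exact: Ck_fst.
  by apply: CkZ => //; apply: Ck_snd => //; exact: Ck_id.
apply: Ck_eq oW (fun z _ => esym (adaptE F z (x z))) _.
apply: Ck_pair => //; first exact: Ck_pair.
apply: CkB => //; last exact: Ck_ncoef.
by apply: CkB => //; [exact: Ck_snd|apply: CkZ => //; exact: hF].
Qed.

Lemma Ck_frame k x : Ck k W x -> Ck k W (fun z => frame F z (x z)).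
Proof.
move=> hx.
have h1 : Ck k W (fun z => (x z).1.1) by apply: Ck_fst => //; exact: Ck_fst.
have h2 : Ck k W (fun z => (x z).1.2) by apply: Ck_snd => //; exact: Ck_fst.
apply: Ck_pair => //; first apply: Ck_pair => //.
  apply: CkD => //; apply: CkZ => //; apply: Ck_snd => //; exact: Ck_id.
apply: CkD => //; last exact: Ck_snd.
by apply: CkD => //; [apply: CkZ => //; exact: hF|exact: Ck_ncoef].
Qed.

Lemma Ck_christoffel k x c : Ck k W x -> Ck k W c ->
  Ck k W (fun z => christoffel F z (x z) (c z)).
Proof.
move=> hx hc.
have h1 : Ck k W (fun z => (x z).1.1) by apply: Ck_fst => //; exact: Ck_fst.
have h2 : Ck k W (fun z => (x z).1.2) by apply: Ck_snd => //; exact: Ck_fst.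
have hG w : Ck k W w -> Ck k W (fun z => gamma F z (x z) (w z)).
  by move=> hw; apply: CkD => //; [apply: CkZ => //; exact: Ck_ncoef|exact:
    Ck_scoef].
apply: Ck_pair => //; first apply: Ck_pair => //; first exact: Ck_cst.
  by apply: hG; apply: Ck_snd => //; exact: Ck_fst.
by apply: hG; exact: Ck_snd.
Qed.

End AdaptedDifferential.

(** * Adapted components of the operators *)

Section AdaptedFields.
Context {R : realType} {n : nat} {M : topologicalType} {I : Type}.
Variables (phi : I -> chart M 'rV[R]_n) (sigma : jet phi 1 -> jet phi 2).
Hypothesis hM : smooth_manifold phi.
Hypothesis hs : sode sigma.
Local Notation M1 := (jet phi 1).
Local Notation V := 'rV[R]_n.
Local Notation E1 := (R * V * V)%type.
Local Notation A1 := (chart1 phi).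
Local Notation field := (M1 -> I -> E1).
Local Notation Xs := (X_sigma sigma).
Let gJ := jet_atlas hM.
Implicit Types (U : set M1) (X Y Z : field) (p : M1) (i k : I).

Definition force_rep i : E1 -> V := coord_rep (A1 i) (force sigma i).

Definition adapted i X p : E1 := adapt (force_rep i) (A1 i p) (X p i).

Definition dadapted i X p (v : E1) : E1 := 'd (coord_rep (A1 i) (adapted i X))
  (A1 i p) v.

Lemma chart1_repE (T : zmodType) (f : M1 -> T) i p : chart_dom (A1 i) p ->
  coord_rep (A1 i) f (A1 i p) = f p.
Proof. by move=> dp; apply: coord_repE dp; exact: chart1_inj. Qed.

Lemma force_repE i p : chart_dom (A1 i) p -> force_rep i (A1 i p) = force sigma i p.
Proof. exact: chart1_repE. Qed.

Lemma force_rep_smooth U i :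
  smooth_on (A1 i @` (U `&` chart_dom (A1 i))) (force_rep i).
Proof.
move=> k; apply: Ck_sub (force_smooth hM hs i k).
by apply: image_subset => q [].
Qed.

Lemma adaptedK i X p : frame (force_rep i) (A1 i p) (adapted i X p) = X p i.
Proof. exact: adaptK. Qed.

Lemma adapted_inj i X Y p : adapted i X p = adapted i Y p -> X p i = Y p i.
Proof. by move=> e; rewrite -(adaptedK i X) e adaptedK. Qed.

Lemma adapted_dt i X p : (adapted i X p).1.1 = (X p i).1.1.
Proof. by rewrite /adapted adaptE. Qed.

Lemma adaptedD i X Y p : adapted i (X + Y) p = adapted i X p + adapted i Y p.
Proof. exact: adaptD. Qed.
Lemma adaptedN i X p : adapted i (- X) p = - adapted i X p.
Proof. exact: adaptN. Qed.
Lemma adaptedB i X Y p : adapted i (X - Y) p = adapted i X p - adapted i Y p.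
Proof. exact: adaptB. Qed.
Lemma adapted0 i p : adapted i 0 p = 0.
Proof. by rewrite -[0 in LHS](subrr (0 : field)) adaptedB subrr. Qed.

Lemma adapt_vert G (y : E1) w : adapt G y (0, 0, w) = (0, 0, w).
Proof.
rewrite adaptE /= !scale0r !subr0; congr (_, _).
by rewrite /ncoef linear0 scaler0 subr0.
Qed.

Lemma dp10E j (v : I -> E1) i : chart_dom (A1 i) j -> dp10 j v i = (v i).1.
Proof.
move=> dj.
have h : has_diff (fun y : E1 => y.1) (A1 i j) (fun v => v.1).
  by apply: has_diff_fst; exact: has_diff_id.
have Wj : (A1 i @` (chart_dom (A1 i) `&` chart_dom (A1 i))) (A1 i j) by exists j.
have E y : (A1 i @` (chart_dom (A1 i) `&` chart_dom (A1 i))) y ->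
    y.1 = coord_rep (A1 i) (chart0 phi i \o @p10 _ _ _ _ phi) y.
  by move=> [q [_ dq] <-]; rewrite chart1_repE.
exact: (has_diff_on (atlas_open gJ i i) Wj E h).2.
Qed.

Lemma hliftE j (w : I -> R * V) i : chart_dom (A1 i) j ->
  hlift sigma j w i = frame (force_rep i) (A1 i j) ((w i).1, omega j w i, 0).
Proof.
move=> dj; rewrite /hlift.
pose L (om : V) : E1 := (0, om, ncoef (force_rep i) (A1 i j) om).
have linL : linear L.
  by move=> a u v; rewrite /L ncoef_lin; congr ((_, _), _); rewrite /= ?mulr0
    ?scaler0 addr0.
have -> : \sum_(a < n) omega j w i 0 a *: X_hor_coord sigma i a j = L (omega j w i).
  pose LL : {linear V -> E1} := HB.pack L (GRing.isLinear.Build _ _ _ _ _ linL).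
  rewrite [in RHS](row_sum_delta (omega j w i)) -[RHS]/(LL _) linear_sum.
  by apply: eq_bigr => a _; apply: esym; exact: linearZZ.
rewrite /frame /L /X_sigma /= force_repE//; congr ((_, _), _) => /=.
- by rewrite [LHS]addr0 [LHS]mulr1.
- by rewrite addr0.
Qed.

Lemma omegaE j (v : I -> E1) i : chart_dom (A1 i) j ->
  omega j (dp10 j v) i = (adapt (force_rep i) (A1 i j) (v i)).1.2.
Proof. by move=> dj; rewrite /omega dp10E// adaptE. Qed.

Lemma adapted_Xs i p : chart_dom (A1 i) p -> adapted i Xs p = (1, 0, 0).
Proof.
move=> dp; apply: (can_inj (frameK (force_rep i) (A1 i p))).
rewrite adaptedK /frame /= !scale1r force_repE// addr0 addr0.
by rewrite /ncoef linear0 scaler0 addr0.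
Qed.

Lemma adapted_J i X p : chart_dom (A1 i) p ->
  adapted i (J_endo X) p = (0, 0, (adapted i X p).1.2).
Proof. by move=> dp; rewrite /adapted /J_endo /vlift adapt_vert omegaE. Qed.

Lemma adapted_hor i X p : chart_dom (A1 i) p ->
  adapted i (hor sigma X) p = ((adapted i X p).1, 0).
Proof.
by move=> dp; rewrite /adapted /hor hliftE// frameK omegaE// dp10E// adaptE.
Qed.

Lemma adapted_ver i X p : chart_dom (A1 i) p ->
  adapted i (ver sigma X) p = (0, (adapted i X p).2).
Proof.
move=> dp; rewrite /ver adaptedB adapted_hor//.
by case: (adapted i X p) => a b; congr (_, _) => /=; rewrite ?subrr ?subr0.
Qed.

Lemma vertical_comp i X p : (adapted i X p).1 = 0 -> (X p i).2 = (adapted i X p).2.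
Proof.
move=> e; rewrite -[in LHS](adaptedK i X p) /frame e /= !scale0r add0r.
by rewrite /ncoef linear0 scaler0 add0r.
Qed.

Lemma adapted_HLJ_of_LJ i X p : chart_dom (A1 i) p ->
  adapted i (HLJ sigma X) p = (0, (adapted i (LJ sigma X) p).2, 0).
Proof.
move=> dp; rewrite {1}/adapted /HLJ hliftE// frameK /omega /incl0 /= scale0r subr0.
by rewrite /vlift_inv vertical_comp adapted_ver.
Qed.

End AdaptedFields.

(** * Brackets in adapted components *)

Section AdaptedCalculus.
Context {R : realType} {n : nat} {M : topologicalType} {I : Type}.
Variables (phi : I -> chart M 'rV[R]_n) (sigma : jet phi 1 -> jet phi 2).
Hypothesis hM : smooth_manifold phi.
Hypothesis hs : sode sigma.
Local Notation M1 := (jet phi 1).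
Local Notation V := 'rV[R]_n.
Local Notation E1 := (R * V * V)%type.
Local Notation A1 := (chart1 phi).
Local Notation field := (M1 -> I -> E1).
Local Notation F := (force_rep sigma).
Local Notation adapted := (adapted sigma).
Local Notation dadapted := (dadapted sigma).
Local Notation vf := (vector_field A1).
Let gJ := jet_atlas hM.
Let gA := base_atlas hM.
Implicit Types (U : set M1) (X Y Z : field) (p : M1) (i k : I).

Lemma jet_transition_diff i k p : chart_dom (A1 i) p -> chart_dom (A1 k) p ->
  has_diff (jet_transition phi i k) (A1 i p) ('d (transition A1 i k) (A1 i p)).
Proof.
move=> di dk.
have Wp : (A1 i @` (chart_dom (A1 k) `&` chart_dom (A1 i))) (A1 i p) by exists p.
apply: (has_diff_on (atlas_open gJ k i) Wp _ (transition_diff gJ di dk)).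
move=> _ [q [dqk dqi] <-]; rewrite (transitionE gJ)//.
exact: esym (jet_transitionE hM dqi dqk).
Qed.

Lemma transition_base i k p (v : E1) : chart_dom (A1 i) p -> chart_dom (A1 k) p ->
  ('d (transition A1 i k) (A1 i p) v).1 =
  (v.1.1, 'd (transition phi i k) (phi i (jet_target p)) v.1.2).
Proof.
move=> di dk.
have h0 := has_diff_fst (jet_transition_diff di dk).
have h1 : has_diff (fun y : E1 => y.1.1) (A1 i p) (fun v => v.1.1).
  by apply: has_diff_fst; apply: has_diff_fst; exact: has_diff_id.
have h2 : has_diff (fun y : E1 => y.1.2) (A1 i p) (fun v => v.1.2).
  by apply: has_diff_snd; apply: has_diff_fst; exact: has_diff_id.
have h3 := has_diff_pair h1 (has_diff_comp h2 (transition_diff gA di dk)).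
exact: etrans (esym (h0.2 v)) (h3.2 v).
Qed.

(** The last component of the prolongation is linear along the fibre, with
    the differential of the base transition as its linear part. *)
Lemma transition_vert i k p (w : V) : chart_dom (A1 i) p -> chart_dom (A1 k) p ->
  'd (transition A1 i k) (A1 i p) ((0, 0, w) : E1) =
  (0, 0, 'd (transition phi i k) (phi i (jet_target p)) w).
Proof.
move=> di dk; rewrite [LHS]surjective_pairing transition_base//= linear0.
congr (_, _).
have h0 := has_diff_snd (jet_transition_diff di dk).
have hl := has_diff_line (A1 i p) ((0, 0, w) : E1) 0.
have e0 : A1 i p + 0 *: ((0, 0, w) : E1) = A1 i p by rewrite scale0r addr0.
have h0' : has_diff (fun y => (jet_transition phi i k y).2)
    (A1 i p + 0 *: ((0, 0, w) : E1)) (fun v => ('d (transition A1 i k) (A1 i p)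
    v).2).
  by rewrite e0; exact: h0.
have h1 := has_diff_comp hl h0'.
pose tau := 'd (transition phi i k) (phi i (jet_target p)).
have h2 : has_diff (fun s : R => tau ((A1 i p).2 + s *: w)) 0 (fun h => tau (h
  *: w)).
  apply: has_diff_comp (has_diff_line _ _ _) _; apply: has_diff_lin.
  exact: diff_continuous (transition_diff gA di dk).1.
have E (s : R) : tau ((A1 i p).2 + s *: w) =
  (jet_transition phi i k (A1 i p + s *: ((0, 0, w) : E1))).2.
  have e : (A1 i p).1.2 + s *: (0 : V) = phi i (jet_target p).
    by rewrite scaler0 addr0.
  by rewrite -[RHS]/('d (transition phi i k) ((A1 i p).1.2 + s *: (0 : V))
    ((A1 i p).2 + s *: w)) e.
have h3 := has_diff_on openT (Logic.I : setT 0) (fun s _ => E s) h2.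
have s1 := congr1 (fun z => ('d (transition A1 i k) (A1 i p) z).2)
  (scale1r ((0, 0, w) : E1)).
exact: etrans (esym s1) (etrans (esym (h1.2 1)) (etrans (h3.2 1)
  (congr1 tau (scale1r w)))).
Qed.

(** Velocities correspond under the differential of the base transition, so
    omega transforms like a tangent vector of M. *)
Lemma J_tangent X p : tangent A1 p (X p) -> tangent A1 p (J_endo X p).
Proof.
move=> tX i k di dk.
rewrite /J_endo /vlift transition_vert//; congr (_, _).
rewrite /omega !dp10E// (tX i k)// transition_base//=.
rewrite /velocity (jet_velocity hM di dk) linearB.
by congr (_ - _); apply: esym; exact: linearZZ.
Qed.

Lemma adapted_rep U X i y : (A1 i @` (U `&` chart_dom (A1 i))) y ->
  coord_rep (A1 i) (X ^~ i) y = frame (F i) y (coord_rep (A1 i) (adapted i X) y).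
Proof. by move=> [q [Uq dq] <-]; rewrite !chart1_repE// adaptedK. Qed.

Lemma adapted_smooth U X i : open_in A1 U -> vf U X ->
  smooth_on (A1 i @` (U `&` chart_dom (A1 i))) (coord_rep (A1 i) (adapted i X)).
Proof.
move=> oU hX m.
apply: Ck_eq (oU i) _ (Ck_adapt (oU i) (force_rep_smooth hM hs U i) (hX.2 i m)).
by move=> y /adapted_rep ->; rewrite frameK.
Qed.

Lemma adapted_diff U X i p : open_in A1 U -> vf U X -> U p -> chart_dom (A1 i) p ->
  has_diff (coord_rep (A1 i) (adapted i X)) (A1 i p) (dadapted i X p).
Proof.
move=> oU hX Up dp; apply: (Ck_diff (adapted_smooth i oU hX 1)).
by exists p.
Qed.

Lemma vector_field_adapted U Z (g : I -> E1 -> E1) : open_in A1 U ->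
  (forall p, U p -> tangent A1 p (Z p)) ->
  (forall i p, U p -> chart_dom (A1 i) p -> adapted i Z p = g i (A1 i p)) ->
  (forall i m, Ck m (A1 i @` (U `&` chart_dom (A1 i))) (g i)) -> vf U Z.
Proof.
move=> oU h1 h2 h3.
apply: (vector_fieldI gJ (g := fun i y => frame (F i) y (g i y))) => //.
  by move=> i p Up dp; rewrite -h2// adaptedK.
by move=> i m; apply: Ck_frame => //; exact: force_rep_smooth.
Qed.

Lemma adapted_bracket U X Y i p : open_in A1 U -> vf U X -> vf U Y -> U p ->
  chart_dom (A1 i) p ->
  adapted i (bracket A1 X Y) p = dadapted i Y p (X p i) - dadapted i X p (Y p i) +
    bracket_corr (F i) (A1 i p) (adapted i X p) (adapted i Y p).
Proof.
move=> oU hX hY Up dp.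
have Wp : (A1 i @` (U `&` chart_dom (A1 i))) (A1 i p) by exists p.
have := bracket_frame (oU i) (force_rep_smooth hM hs U i) Wp
  (@adapted_rep U X i) (@adapted_rep U Y i) (adapted_diff oU hX Up dp)
    (adapted_diff oU hY Up dp).
by rewrite !chart1_repE.
Qed.

(** In adapted components J, L_X J, E and the projections all have this form,
    which lets the lemmas below treat them together. *)
Definition block_map (e s t u v : R) (c : E1) : E1 :=
  (e * c.1.1, s *: c.1.2 + t *: c.2, u *: c.1.2 + v *: c.2).

Lemma has_diff_block_map e s t u v (f df : E1 -> E1) y : has_diff f y df ->
  has_diff (fun z => block_map e s t u v (f z)) y (fun w => block_map e s t u v
    (df w)).
Proof.
move=> hf.
have h1 := has_diff_fst (has_diff_fst hf).
have h2 := has_diff_snd (has_diff_fst hf).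
have h3 := has_diff_snd hf.
have hZ (W : normedModType R) (a : R) (g dg : E1 -> W) : has_diff g y dg ->
    has_diff (fun z => a *: g z) y (fun w => a *: dg w).
  move=> hg; apply: has_diff_eq (has_diffZ (has_diff_cst a y) hg) => w.
  by rewrite scale0r add0r.
apply: has_diff_pair; first apply: has_diff_pair.
- exact: hZ R e _ _ h1.
- by apply: has_diffD; exact: hZ.
- by apply: has_diffD; exact: hZ.
Qed.

Lemma Ck_block_map e s t u v m (W : set E1) (f : E1 -> E1) : open W -> Ck m W f ->
  Ck m W (fun z => block_map e s t u v (f z)).
Proof.
move=> oW hf.
have h1 : Ck m W (fun z => (f z).1.1) by apply: Ck_fst => //; exact: Ck_fst.
have h2 : Ck m W (fun z => (f z).1.2) by apply: Ck_snd => //; exact: Ck_fst.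
have h3 : Ck m W (fun z => (f z).2) by exact: Ck_snd.
have hZ (Z : normedModType R) (a : R) (g : E1 -> Z) : Ck m W g ->
    Ck m W (fun z => a *: g z).
  by move=> hg; apply: CkZ => //; exact: Ck_cst.
apply: Ck_pair => //; first apply: Ck_pair => //.
- exact: hZ R e _ h1.
- by apply: CkD => //; exact: hZ.
- by apply: CkD => //; exact: hZ.
Qed.

Lemma dadapted_block_map e s t u v U X Z i p : open_in A1 U -> vf U X -> U p ->
  chart_dom (A1 i) p ->
  (forall q, U q -> chart_dom (A1 i) q -> adapted i Z q = block_map e s t u v
    (adapted i X q)) ->
  forall w, dadapted i Z p w = block_map e s t u v (dadapted i X p w).
Proof.
move=> oU hX Up dp hZ w.
have Wp : (A1 i @` (U `&` chart_dom (A1 i))) (A1 i p) by exists p.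
have E y : (A1 i @` (U `&` chart_dom (A1 i))) y ->
    block_map e s t u v (coord_rep (A1 i) (adapted i X) y) = coord_rep (A1 i)
    (adapted i Z) y.
  by move=> [q [Uq dq] <-]; rewrite !chart1_repE// hZ.
exact: (has_diff_on (oU i) Wp E (has_diff_block_map e s t u v (adapted_diff oU
  hX Up dp))).2.
Qed.

Lemma vector_field_block_map e s t u v U X Z : open_in A1 U -> vf U X ->
  (forall p, U p -> tangent A1 p (Z p)) ->
  (forall i p, U p -> chart_dom (A1 i) p -> adapted i Z p = block_map e s t u v
    (adapted i X p)) ->
  vf U Z.
Proof.
move=> oU hX tZ hZ.
apply: (vector_field_adapted
  (g := fun i y => block_map e s t u v (coord_rep (A1 i) (adapted i X) y))) => //.
  by move=> i p Up dp; rewrite chart1_repE// hZ.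
by move=> i m; apply: Ck_block_map => //; exact: adapted_smooth.
Qed.

End AdaptedCalculus.

(** * The tensors attached to a SODE *)

Section BracketTerms.
Context {R : realType} {n : nat}.
Local Notation V := 'rV[R]_n.
Local Notation E1 := (R * V * V)%type.
Variable F : E1 -> V.
Implicit Types (y x c Z : E1) (w om : V).

Lemma ncoef0 y : ncoef F y 0 = 0. Proof. exact: linear0. Qed.

Lemma dncoef0 y Z : dncoef F y 0 Z = 0.
Proof.
have e : dvert F 0 = fun=> 0 by apply/funext => z; exact: linear0.
rewrite /dncoef e (@has_diff_cst R E1 V 0 y).2; exact: scaler0.
Qed.

Lemma scoef0l y om : scoef F y 0 om = 0.
Proof. by rewrite /scoef; exact: linear0. Qed.

Lemma scoef0r y w : scoef F y w 0 = 0.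
Proof. exact: dncoef0. Qed.

Lemma bracket_corr0r y x : bracket_corr F y x 0 = 0.
Proof.
have e : bracket_pos F y x 0 = 0 by rewrite bracket_posE scale0r ncoef0 addr0
  scaler0 subr0.
have f0 : frame F y 0 = 0 by exact: linear0.
rewrite /bracket_corr e ncoef0 /bracket_vel /= f0.
have -> : dncoef F y 0 (frame F y x) = 0 by exact: dncoef0.
have -> : dncoef F y x.1.2 0 = 0 by exact: linear0.
have -> : 'd F y (0 : E1) = 0 by exact: linear0.
by rewrite scale0r scaler0 !subr0 addr0.
Qed.

Lemma bracket_corr_vert y x c : c.1 = 0 ->
  (bracket_corr F y x c).2 = - (x.1.1 *: ncoef F y c.2 + scoef F y c.2 x.1.2).
Proof.
move=> c0.
have e : (bracket_corr F y (x.1, 0) (c.1, 0)).2 = 0.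
  by rewrite c0; exact: (congr1 snd (bracket_corr0r y _)).
have -> : (bracket_corr F y x c).2 = _ := bracket_corr_split F y x c.
have c1 : c.1.1 = 0 by rewrite c0.
have c2 : c.1.2 = 0 by rewrite c0.
rewrite e c1 c2 add0r scoef0r.
by rewrite sub0r scale0r sub0r -opprD.
Qed.

End BracketTerms.

Section InvariantOperators.
Context {R : realType} {n : nat} {M : topologicalType} {I : Type}.
Variables (phi : I -> chart M 'rV[R]_n) (sigma : jet phi 1 -> jet phi 2).
Hypothesis hM : smooth_manifold phi.
Hypothesis hs : sode sigma.
Local Notation M1 := (jet phi 1).
Local Notation V := 'rV[R]_n.
Local Notation E1 := (R * V * V)%type.
Local Notation A1 := (chart1 phi).
Local Notation field := (M1 -> I -> E1).
Local Notation Xs := (X_sigma sigma).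
Local Notation F := (force_rep sigma).
Local Notation adapted := (adapted sigma).
Local Notation dadapted := (dadapted sigma).
Local Notation vf := (vector_field A1).
Local Notation oin := (open_in A1).
Let gJ := jet_atlas hM.
Implicit Types (U : set M1) (X Y Z : field) (p : M1) (i k : I).

Lemma block_map_J (c : E1) : block_map 0 0 0 1 0 c = (0, 0, c.1.2).
Proof. by rewrite /block_map mul0r !scale0r scale1r !addr0. Qed.
Lemma block_map_hor (c : E1) : block_map 1 1 0 0 0 c = (c.1, 0).
Proof. by case: c => [[a b] c]; rewrite /block_map mul1r !scale0r scale1r
  !addr0. Qed.
Lemma block_map_ver (c : E1) : block_map 0 0 0 0 1 c = (0, c.2).
Proof. by rewrite /block_map mul0r !scale0r scale1r !addr0 add0r. Qed.
Lemma block_map_LJ (c : E1) : block_map 0 (-1) 0 0 1 c = (0, - c.1.2, c.2).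
Proof. by rewrite /block_map mul0r !scale0r scale1r scaleN1r !addr0 add0r. Qed.
Lemma block_map_HLJ (c : E1) : block_map 0 0 1 0 0 c = (0, c.2, 0).
Proof. by rewrite /block_map mul0r !scale0r scale1r !addr0 add0r. Qed.
Lemma block_map_E (c : E1) : block_map 0 0 1 1 0 c = (0, c.2, c.1.2).
Proof. by rewrite /block_map mul0r !scale0r !scale1r !addr0 add0r. Qed.

Lemma tangent_eq p (v w : I -> E1) : eq_at A1 p v w -> tangent A1 p w ->
  tangent A1 p v.
Proof. by move=> e tw i k di dk; rewrite !e//; exact: tw. Qed.

Lemma tangent_dt p (v : I -> E1) i k : tangent A1 p v -> chart_dom (A1 i) p ->
  chart_dom (A1 k) p -> (v i).1.1 = (v k).1.1.
Proof. by move=> tv di dk; rewrite (tv i k)// transition_base. Qed.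

Lemma vf_Xs U : oin U -> vf U Xs.
Proof.
move=> oU; apply: (vector_field_adapted hM hs (g := fun=> fun=> (1, 0, 0))) => //.
- by move=> p _; exact: X_sigma_tangent.
- by move=> i p _; exact: adapted_Xs.
- by move=> i m; exact: Ck_cst.
Qed.

Lemma dadapted_Xs i p v : chart_dom (A1 i) p -> dadapted i Xs p v = 0.
Proof.
move=> dp.
have Wp : (A1 i @` (chart_dom (A1 i) `&` chart_dom (A1 i))) (A1 i p) by exists p.
have E y : (A1 i @` (chart_dom (A1 i) `&` chart_dom (A1 i))) y ->
    (1, 0, 0) = coord_rep (A1 i) (adapted i Xs) y.
  by move=> [q [_ dq] <-]; rewrite chart1_repE// adapted_Xs.
exact: (has_diff_on (atlas_open gJ i i) Wp E (has_diff_cst _ _)).2.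
Qed.

Lemma adapted_block_J i X p : chart_dom (A1 i) p ->
  adapted i (J_endo X) p = block_map 0 0 0 1 0 (adapted i X p).
Proof. by move=> dp; rewrite block_map_J adapted_J. Qed.

Lemma vf_J U X : oin U -> vf U X -> vf U (J_endo X).
Proof.
move=> oU hX; apply: (vector_field_block_map hM hs oU hX) => [p Up|i p Up].
  by apply: J_tangent => //; exact: hX.1.
exact: adapted_block_J.
Qed.

Lemma vf_bracket U X Y : oin U -> vf U X -> vf U Y -> vf U (bracket A1 X Y).
Proof. exact: vector_field_bracket. Qed.

Lemma vf_LJ U X : oin U -> vf U X -> vf U (LJ sigma X).
Proof.
move=> oU hX; have hs' := vf_Xs oU.
apply: vector_fieldB => //; first by apply: vf_bracket => //; exact: vf_J.
by apply: vf_J => //; exact: vf_bracket.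
Qed.

Lemma adapted_bracket_Xs U Z i p : oin U -> vf U Z -> U p -> chart_dom (A1 i) p ->
  adapted i (bracket A1 Xs Z) p =
  dadapted i Z p (Xs p i) + bracket_corr (F i) (A1 i p) (1, 0, 0) (adapted i Z p).
Proof.
move=> oU hZ Up dp; have e := adapted_bracket hM hs oU (vf_Xs oU) hZ Up dp.
by apply: etrans e _; rewrite (dadapted_Xs (Z p i) dp) (adapted_Xs sigma hM dp)
  subr0.
Qed.

Lemma bracket_pos_Xs (G : E1 -> V) y c : bracket_pos G y (1, 0, 0) c = - (ncoef
  G y c.1.2 + c.2).
Proof. by rewrite bracket_posE /= ncoef0 addr0 scaler0 scale1r sub0r. Qed.

(** In [X^sigma, J X] - J [X^sigma, X] the derivatives of the components of X
    cancel. So L_X J has eigenvalue -1 on the X^sigma_a, 1 on vertical vectors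
    and 0 on X^sigma. *)
Lemma adapted_block_LJ U X i p : oin U -> vf U X -> U p -> chart_dom (A1 i) p ->
  adapted i (LJ sigma X) p = block_map 0 (-1) 0 0 1 (adapted i X p).
Proof.
move=> oU hX Up dp; have hJ := vf_J oU hX.
rewrite block_map_LJ /LJ /lie_endo adaptedB (adapted_J sigma hM _ dp).
rewrite (adapted_bracket_Xs oU hJ Up dp) (adapted_bracket_Xs oU hX Up dp).
rewrite (dadapted_block_map hM hs oU hX Up dp (fun q _ dq => adapted_block_J X
  dq)) block_map_J.
rewrite (adapted_J sigma hM _ dp).
move: (dadapted i X p (Xs p i)) (adapted i X p) => d c.
set c1 := bracket_corr _ _ _ (0, 0, c.1.2).
have e1 : c1.1 = (0, - c.1.2).
  by rewrite /c1 /bracket_corr bracket_pos_Xs ncoef0 add0r.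
have e2 : c1.2 = - ncoef (F i) (A1 i p) c.1.2.
  by rewrite /c1 bracket_corr_vert// scoef0r addr0 scale1r.
rewrite (surjective_pairing c1) e1 e2 /bracket_corr bracket_pos_Xs.
move: (ncoef _ _ c.1.2) => N.
congr ((_, _), _) => /=.
- by rewrite !addr0 subr0.
- by rewrite add0r subr0.
- by apply/rowP => k; rewrite !mxE; ring.
Qed.

Lemma adapted_block_hor i X p : chart_dom (A1 i) p ->
  adapted i (hor sigma X) p = block_map 1 1 0 0 0 (adapted i X p).
Proof. by move=> dp; rewrite block_map_hor adapted_hor. Qed.

Lemma adapted_block_ver i X p : chart_dom (A1 i) p ->
  adapted i (ver sigma X) p = block_map 0 0 0 0 1 (adapted i X p).
Proof. by move=> dp; rewrite block_map_ver adapted_ver. Qed.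

Lemma half_double (W : lmodType R) (v : W) : 2^-1 *: (v + v) = v.
Proof.
have n2 : (2 : R) != 0 by rewrite pnatr_eq0.
have -> : v + v = (2 : R) *: v by rewrite scaler_nat mulr2n.
by rewrite scalerA mulVf// scale1r.
Qed.

(** Read off from the eigenvalues of L_X J. It makes the horizontal projection
    independent of the chart without the transformation law of the X^sigma_a. *)
Lemma hor_LJ U X p i : oin U -> vf U X -> U p -> chart_dom (A1 i) p ->
  hor sigma X p i =
  2^-1 *: ((X p i + (X p i).1.1 *: Xs p i) - LJ sigma X p i).
Proof.
move=> oU hX Up dp; apply: (can_inj (adaptK (F i) (A1 i p))).
rewrite adaptZ adaptB adaptD adaptZ.
rewrite -[LHS]/(adapted i (hor sigma X) p) -[adapt _ _ (X p i)]/(adapted i X p).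
rewrite -[adapt _ _ (Xs p i)]/(adapted i Xs p).
rewrite -[adapt _ _ (LJ sigma X p i)]/(adapted i (LJ sigma X) p).
rewrite (adapted_block_LJ oU hX)// adapted_hor// adapted_Xs// block_map_LJ
  -(adapted_dt sigma i X p).
case: (adapted i X p) => [[a b] c]; congr ((_, _), _) => /=.
- have -> : a *: (1 : R) = a by rewrite [LHS]mulr1.
  by rewrite subr0; apply: esym; exact: (half_double (a : R^o)).
- by rewrite scaler0 addr0 opprK half_double.
- by rewrite scaler0 addr0 subrr scaler0.
Qed.

Lemma vf_hor U X : oin U -> vf U X -> vf U (hor sigma X).
Proof.
move=> oU hX; apply: (vector_field_block_map hM hs oU hX) => [p Up|i p Up].
  apply: tangent_eq (fun i di => hor_LJ oU hX Up di) _.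
  have tX := hX.1 p Up.
  apply: (tangentZ (a := fun=> 2^-1)) => //; apply: tangentD; last first.
    by apply: tangentN; exact: (vf_LJ oU hX).1.
  apply: tangentD => //; apply: (tangentZ (a := fun i => (X p i).1.1)).
    exact: X_sigma_tangent.
  by move=> i k; exact: tangent_dt.
exact: adapted_block_hor.
Qed.

Lemma vf_ver U X : oin U -> vf U X -> vf U (ver sigma X).
Proof. by move=> oU hX; apply: vector_fieldB => //; exact: vf_hor. Qed.

Lemma adapted_block_HLJ U X i p : oin U -> vf U X -> U p -> chart_dom (A1 i) p ->
  adapted i (HLJ sigma X) p = block_map 0 0 1 0 0 (adapted i X p).
Proof.
by move=> oU hX Up dp; rewrite adapted_HLJ_of_LJ// (adapted_block_LJ oU hX)//
  block_map_LJ block_map_HLJ.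
Qed.

(** For V vertical, [X^sigma, V] is - H (epsilon^-1 V) up to a vertical field.
    This in turn makes H o epsilon^-1 independent of the chart. *)
Lemma HLJ_hor U X p i : oin U -> vf U X -> U p -> chart_dom (A1 i) p ->
  HLJ sigma X p i = (- hor sigma (bracket A1 Xs (ver sigma X))) p i.
Proof.
move=> oU hX Up dp; have hs' := vf_Xs oU; have hv := vf_ver oU hX.
apply: (adapted_inj (sigma := sigma)).
rewrite adaptedN (adapted_hor sigma hM _ dp) (adapted_bracket_Xs oU hv Up dp).
rewrite (adapted_block_HLJ oU hX Up dp) block_map_HLJ.
rewrite (dadapted_block_map hM hs oU hX Up dp (fun q _ dq => adapted_block_ver
  X dq)) block_map_ver.
rewrite (adapted_ver sigma hM _ dp) /bracket_corr bracket_pos_Xs ncoef0 add0r.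
congr ((_, _), _) => /=.
- by rewrite addr0 oppr0.
- by rewrite add0r opprK.
- by rewrite oppr0.
Qed.

Lemma vf_HLJ U X : oin U -> vf U X -> vf U (HLJ sigma X).
Proof.
move=> oU hX; apply: (vector_field_block_map hM hs oU hX) => [p Up|i p Up].
  apply: tangent_eq (fun i di => HLJ_hor oU hX Up di) _.
  apply: (vector_fieldN gJ oU _).1 => //; apply: vf_hor => //.
  by apply: vf_bracket => //; [exact: vf_Xs|exact: vf_ver].
exact: adapted_block_HLJ.
Qed.

Lemma adapted_block_E U X i p : oin U -> vf U X -> U p -> chart_dom (A1 i) p ->
  adapted i (E_endo sigma X) p = block_map 0 0 1 1 0 (adapted i X p).
Proof.
move=> oU hX Up dp; rewrite /E_endo adaptedD adapted_J// (adapted_block_HLJ oU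
  hX)//.
rewrite block_map_HLJ block_map_E; congr ((_, _), _); rewrite /= ?add0r ?addr0//.
Qed.

Lemma vf_E U X : oin U -> vf U X -> vf U (E_endo sigma X).
Proof.
by move=> oU hX; apply: vector_fieldD => //; [exact: vf_J|exact: vf_HLJ].
Qed.

End InvariantOperators.

(** * The connection *)

Section ChristoffelTerms.
Context {R : realType} {n : nat}.
Local Notation V := 'rV[R]_n.
Local Notation E1 := (R * V * V)%type.
Variables (F : E1 -> V) (W : set E1).
Hypotheses (oW : open W) (hF : smooth_on W F).
Implicit Types (y x c : E1) (w : V).

Lemma christoffelE y x c : christoffel F y x c = (0, gamma F y x c.1.2, gamma F
  y x c.2).
Proof. by []. Qed.

Lemma scoefDr y w u v : W y -> scoef F y w (u + v) = scoef F y w u + scoef F y w v.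
Proof.
move=> Wy; rewrite (scoef_sym oW hF w (u + v) Wy) (scoef_sym oW hF w u Wy).
rewrite (scoef_sym oW hF w v Wy).
have e := scoef_lin F y w 1 u v.
by rewrite (scale1r u) (scale1r (scoef F y u w)) in e.
Qed.

Lemma scoefZr y (a : R) w u : W y -> scoef F y w (a *: u) = a *: scoef F y w u.
Proof.
move=> Wy; rewrite (scoef_sym oW hF w (a *: u) Wy) (scoef_sym oW hF w u Wy).
have e := scoef_lin F y w a u 0.
by rewrite (addr0 (a *: u)) (scoef0l F y w) (addr0 (a *: scoef F y u w)) in e.
Qed.

Lemma gammaDl y x x' w : W y -> gamma F y (x + x') w = gamma F y x w + gamma F
  y x' w.
Proof. by move=> Wy; rewrite /gamma /= scoefDr// scalerDl addrACA. Qed.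

Lemma gammaZl y (a : R) x w : W y -> gamma F y (a *: x) w = a *: gamma F y x w.
Proof. by move=> Wy; rewrite /gamma /= scoefZr// scalerDr scalerA. Qed.

Lemma christoffelDl y x x' c : W y ->
  christoffel F y (x + x') c = christoffel F y x c + christoffel F y x' c.
Proof.
move=> Wy; rewrite /christoffel !gammaDl//; congr ((_, _), _).
by rewrite /= addr0.
Qed.

Lemma christoffelZl y (a : R) x c : W y -> christoffel F y (a *: x) c = a *:
  christoffel F y x c.
Proof.
move=> Wy; rewrite /christoffel !gammaZl//; congr ((_, _), _).
by rewrite /= scaler0.
Qed.

Lemma gammaD y x u v : gamma F y x (u + v) = gamma F y x u + gamma F y x v.
Proof. exact: linearD. Qed.
Lemma gammaZ y x (a : R) u : gamma F y x (a *: u) = a *: gamma F y x u.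
Proof. exact: linearZ. Qed.
Lemma gamma0 y x : gamma F y x 0 = 0.
Proof. exact: linear0. Qed.

Lemma christoffelD y x c c' : christoffel F y x (c + c') = christoffel F y x c
  + christoffel F y x c'.
Proof.
rewrite /christoffel !gammaD; congr ((_, _), _).
by rewrite /= addr0.
Qed.

Lemma christoffelZ y (a : R) x c : christoffel F y x (a *: c) = a *:
  christoffel F y x c.
Proof.
rewrite /christoffel !gammaZ; congr ((_, _), _).
by rewrite /= scaler0.
Qed.

Lemma christoffel_block_map y x e s t u v c :
  christoffel F y x (block_map e s t u v c) = block_map e s t u v (christoffel
    F y x c).
Proof. by rewrite /christoffel /block_map /= !gammaD !gammaZ mulr0. Qed.

Lemma block_mapB e s t u v (c d : E1) : block_map e s t u v (c - d) = block_map
  e s t u v c - block_map e s t u v d.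
Proof.
congr ((_, _), _) => /=; first by rewrite mulrBr.
  by rewrite !scalerBr opprD addrACA.
by rewrite !scalerBr opprD addrACA.
Qed.

(** The part of the torsion without derivatives of the components. Between
    horizontal arguments the Christoffel terms cancel by the symmetry of
    [scoef]. *)
Lemma torsion_algebra y x c : W y ->
  christoffel F y c x - christoffel F y x c - bracket_corr F y x c =
  - (0, (bracket_corr F y (x.1, 0) (c.1, 0)).2) +
  (x.1.1 *: ((0, c.2, 0) : E1) - c.1.1 *: ((0, x.2, 0) : E1)).
Proof.
move=> Wy.
have e2 : (bracket_corr F y x c).2 = _ := bracket_corr_split F y x c.
have e1 : (bracket_corr F y x c).1 = (0, _) := congr1 (pair 0) (bracket_posE F
  y x c).
rewrite [bracket_corr F y x c]surjective_pairing e1 e2.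
move: (bracket_corr F y (x.1, 0) (c.1, 0)).2 => K.
rewrite /christoffel /gamma (scoef_sym oW hF x.1.2 c.1.2 Wy).
move: (ncoef F y x.1.2) (ncoef F y x.2) (ncoef F y c.1.2) (ncoef F y c.2) => n1
  n2 n3 n4.
move: (scoef F y _ _) (scoef F y _ _) (scoef F y _ _) => s1 s2 s3.
move: x.1.1 c.1.1 x.2 c.2 => a al mu nu.
congr ((_, _), _) => /=.
- by rewrite [a *: _]mulr0 [al *: _]mulr0 !subr0 oppr0 addr0.
- by apply/rowP => k; rewrite !mxE; ring.
- by rewrite !scaler0; apply/rowP => k; rewrite !mxE; ring.
Qed.

End ChristoffelTerms.

Section ChernNabla.
Context {R : realType} {n : nat} {M : topologicalType} {I : Type}.
Variables (phi : I -> chart M 'rV[R]_n) (sigma : jet phi 1 -> jet phi 2).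
Hypothesis hM : smooth_manifold phi.
Hypothesis hs : sode sigma.
Local Notation M1 := (jet phi 1).
Local Notation V := 'rV[R]_n.
Local Notation E1 := (R * V * V)%type.
Local Notation A1 := (chart1 phi).
Local Notation field := (M1 -> I -> E1).
Local Notation F := (force_rep sigma).
Local Notation adapted := (adapted sigma).
Local Notation dadapted := (dadapted sigma).
Local Notation vf := (vector_field A1).
Local Notation oin := (open_in A1).
Let gJ := jet_atlas hM.
Implicit Types (U : set M1) (X Y Z : field) (p : M1) (i k : I).

(** The adapted components (alpha, eta, nu) of Y become (X alpha, D_X eta,
    D_X nu), where D_X w = X w - gamma w. *)
Definition chern_nabla_expr X Y : field := fun p i => frame (F i) (A1 i p)
  (dadapted i Y p (X p i) - christoffel (F i) (A1 i p) (adapted i X p) (adapted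
    i Y p)).
Fact chern_nabla_key : unit. Proof. by []. Qed.
Definition chern_nabla := locked_with chern_nabla_key chern_nabla_expr.

Lemma adapted_chern_nabla i X Y p : adapted i (chern_nabla X Y) p =
  dadapted i Y p (X p i) - christoffel (F i) (A1 i p) (adapted i X p) (adapted
    i Y p).
Proof. by rewrite /chern_nabla unlock; exact: frameK. Qed.

Lemma dadaptedD i Y p u v : dadapted i Y p (u + v) = dadapted i Y p u +
  dadapted i Y p v.
Proof. exact: diff_linD. Qed.

Lemma dadapted_on U i p Z (g dg : E1 -> E1) v : oin U -> U p -> chart_dom (A1
  i) p ->
  (forall q, U q -> chart_dom (A1 i) q -> adapted i Z q = g (A1 i q)) ->
  has_diff g (A1 i p) dg -> dadapted i Z p v = dg v.
Proof.
move=> oU Up dp hZ hg.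
have Wp : (A1 i @` (U `&` chart_dom (A1 i))) (A1 i p) by exists p.
have E y : (A1 i @` (U `&` chart_dom (A1 i))) y ->
    g y = coord_rep (A1 i) (adapted i Z) y.
  by move=> [q [Uq dq] <-]; rewrite chart1_repE// hZ.
exact: (has_diff_on (oU i) Wp E hg).2.
Qed.

(** On a vertical field Z this is nabla_X Z, written with brackets only. It is
    tensorial in X because ver o hor = 0 and J o ver = 0. *)
Definition vertical_der X Z : field :=
  ver sigma (bracket A1 (hor sigma X) Z) +
  J_endo (bracket A1 (ver sigma X) (HLJ sigma Z)).

Lemma vf_vertical_der U X Z : oin U -> vf U X -> vf U Z -> vf U (vertical_der X Z).
Proof.
move=> oU hX hZ; apply: (vector_fieldD gJ oU).
  by apply: (vf_ver hM hs oU); apply: (vf_bracket hM oU) hZ; exact: vf_hor.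
apply: (vf_J hM hs oU); apply: (vf_bracket hM oU); first exact: vf_ver.
exact: vf_HLJ.
Qed.

Lemma adapted_vertical_der U X Z i p : oin U -> vf U X -> vf U Z -> U p ->
  chart_dom (A1 i) p ->
  (adapted i Z p).1 = 0 ->
  adapted i (vertical_der X Z) p = (0, 0, (dadapted i Z p (X p i)).2 -
     gamma (F i) (A1 i p) (adapted i X p) (adapted i Z p).2).
Proof.
move=> oU hX hZ Up dp hv.
have hh := vf_hor hM hs oU hX; have hvX := vf_ver hM hs oU hX.
have hH := vf_HLJ hM hs oU hZ.
rewrite /vertical_der adaptedD (adapted_ver sigma hM _ dp) (adapted_J sigma hM
  _ dp).
rewrite (adapted_bracket hM hs oU hh hZ Up dp) (adapted_bracket hM hs oU hvX hH
  Up dp).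
rewrite (dadapted_block_map hM hs oU hX Up dp (fun q _ dq => adapted_block_hor
  sigma hM X dq)).
rewrite (dadapted_block_map hM hs oU hX Up dp (fun q _ dq => adapted_block_ver
  sigma hM X dq)).
rewrite (dadapted_block_map hM hs oU hZ Up dp (fun q Uq dq => adapted_block_HLJ
  hM hs oU hZ Uq dq)).
rewrite block_map_hor block_map_ver block_map_HLJ.
rewrite (adapted_hor sigma hM _ dp) (adapted_ver sigma hM _ dp).
rewrite (adapted_block_HLJ hM hs oU hZ Up dp) block_map_HLJ.
have eX : dadapted i Z p (X p i) =
    dadapted i Z p (hor sigma X p i) + dadapted i Z p (ver sigma X p i).
  rewrite -dadaptedD; congr (dadapted i Z p _).
  by rewrite -[ver sigma X p i]/(X p i - hor sigma X p i) addrC subrK.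
rewrite eX.
move: (dadapted i Z p (hor sigma X p i)) (dadapted i Z p (ver sigma X p i)) =>
  d1 d2.
set c1 := bracket_corr _ _ _ (adapted i Z p).
set c2 := bracket_corr _ _ _ (0, _, 0).
have e1 : c1.2 = - gamma (F i) (A1 i p) (adapted i X p) (adapted i Z p).2.
  exact: bracket_corr_vert.
have e2 : c2.1 = 0.
  by rewrite /c2 /bracket_corr bracket_posE /= !scale0r subr0.
move: c1 c2 e1 e2 => c1 c2 e1 e2.
congr ((_, _), _) => /=.
- by rewrite addr0.
- by rewrite addr0.
- by rewrite e1 -[c2.1.2]/(c2.1).2 e2 /= !subr0 !addr0 addrAC.
Qed.

End ChernNabla.

Section ChernNablaProperties.
Context {R : realType} {n : nat} {M : topologicalType} {I : Type}.
Variables (phi : I -> chart M 'rV[R]_n) (sigma : jet phi 1 -> jet phi 2).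
Hypothesis hM : smooth_manifold phi.
Hypothesis hs : sode sigma.
Local Notation M1 := (jet phi 1).
Local Notation V := 'rV[R]_n.
Local Notation E1 := (R * V * V)%type.
Local Notation A1 := (chart1 phi).
Local Notation field := (M1 -> I -> E1).
Local Notation Xs := (X_sigma sigma).
Local Notation F := (force_rep sigma).
Local Notation adapted := (adapted sigma).
Local Notation dadapted := (dadapted sigma).
Local Notation chern_nabla := (chern_nabla sigma).
Local Notation vf := (vector_field A1).
Local Notation oin := (open_in A1).
Let gJ := jet_atlas hM.
Implicit Types (U : set M1) (X Y Z : field) (p : M1) (i k : I).

Lemma dadapted_dt U X Y i p : oin U -> vf U Y -> U p -> chart_dom (A1 i) p ->
  has_diff (coord_rep (A1 i) (fun q => (Y q i).1.1)) (A1 i p)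
    (fun v => (dadapted i Y p v).1.1).
Proof.
move=> oU hY Up dp.
have Wp : (A1 i @` (U `&` chart_dom (A1 i))) (A1 i p) by exists p.
have h := has_diff_fst (has_diff_fst (adapted_diff hM hs oU hY Up dp)).
apply: (has_diff_on (oU i) Wp _ h) => _ [q [Uq dq] <-].
by rewrite !chart1_repE// adapted_dt.
Qed.

Lemma dadapted_dt_change U X Y i k p : oin U -> vf U X -> vf U Y -> U p ->
  chart_dom (A1 i) p -> chart_dom (A1 k) p ->
  (dadapted i Y p (X p i)).1.1 = (dadapted k Y p (X p k)).1.1.
Proof.
move=> oU hX hY Up di dk.
have hk := dadapted_dt X oU hY Up dk.
have hi := dadapted_dt X oU hY Up di.
pose f q := (Y q k).1.1.
have e1 := diff_change gJ (X p i) di dk hk.1.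
have oUk : oin (U `&` chart_dom (A1 k)).
  by apply: (open_inI gJ oU); exact: atlas_open.
have Wp : (A1 i @` ((U `&` chart_dom (A1 k)) `&` chart_dom (A1 i))) (A1 i p).
  by exists p.
have E y : (A1 i @` ((U `&` chart_dom (A1 k)) `&` chart_dom (A1 i))) y ->
    coord_rep (A1 i) (fun q => (Y q i).1.1) y = coord_rep (A1 i) f y.
  move=> [q [[Uq dkq] diq] <-]; rewrite !(chart1_repE hM _ diq).
  exact: (tangent_dt hM (hY.1 q Uq) diq dkq).
have e2 := (has_diff_on (oUk i) Wp E hi).2 (X p i).
have e3 := hk.2 (X p k).
rewrite -(hX.1 p Up i k di dk) in e1.
exact: etrans (esym e2) (etrans e1 e3).
Qed.

(** The right-hand side is made of brackets and tensors, so that it does not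
    depend on the chart; hence neither does nabla_X Y. *)
Lemma chern_nabla_invariant U X Y p : oin U -> vf U X -> vf U Y -> U p ->
  eq_at A1 p (chern_nabla X Y p) (fun i => (dadapted i Y p (X p i)).1.1 *: Xs p i +
    HLJ sigma (vertical_der sigma X (J_endo Y)) p i + vertical_der sigma X (ver
    sigma Y) p i).
Proof.
move=> oU hX hY Up i dp; apply: (can_inj (adaptK (F i) (A1 i p))).
have hJ := vf_J hM hs oU hY; have hv := vf_ver hM hs oU hY.
have eR : adapt (F i) (A1 i p) ((dadapted i Y p (X p i)).1.1 *: Xs p i +
    HLJ sigma (vertical_der sigma X (J_endo Y)) p i + vertical_der sigma X (ver
    sigma Y) p i) =
  (dadapted i Y p (X p i)).1.1 *: adapted i Xs p +
    adapted i (HLJ sigma (vertical_der sigma X (J_endo Y))) p +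
    adapted i (vertical_der sigma X (ver sigma Y)) p.
  apply: etrans (adaptD _ _ _ _) _; congr (_ + _).
  by apply: etrans (adaptD _ _ _ _) _; congr (_ + _); exact: adaptZ.
have J1 : (adapted i (J_endo Y) p).1 = 0 := congr1 fst (adapted_J sigma hM Y dp).
have v1 : (adapted i (ver sigma Y) p).1 = 0 := congr1 fst (adapted_ver sigma hM
  Y dp).
have k2 := adapted_vertical_der hM hs oU hX hv Up dp v1.
have k1' := adapted_vertical_der hM hs oU hX hJ Up dp J1.
have k1 := etrans (adapted_block_HLJ hM hs oU (vf_vertical_der hM hs oU hX hJ)
  Up dp)
  (etrans (block_map_HLJ _) (congr1 (fun c : E1 => (0, c.2, 0) : E1) k1')).
apply: etrans (adapted_chern_nabla _ _ _ _ _) _; apply: etrans (esym eR).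
rewrite {eR k1'}k1 {}k2.
rewrite (dadapted_block_map hM hs oU hY Up dp (fun q _ dq => adapted_block_J
  sigma hM Y dq)).
rewrite (dadapted_block_map hM hs oU hY Up dp (fun q _ dq => adapted_block_ver
  sigma hM Y dq)).
rewrite block_map_J block_map_ver (adapted_J sigma hM _ dp) (adapted_ver sigma
  hM _ dp).
rewrite (adapted_Xs sigma hM dp) christoffelE.
move: (dadapted i Y p (X p i)) (adapted i Y p) (adapted i X p) => [[d1 d2] d3] c x.
congr ((_, _), _) => /=.
- by rewrite [d1 *: _]mulr1 subr0 !addr0.
- by rewrite scaler0 add0r addr0.
- by rewrite scaler0 !add0r.
Qed.

Lemma chern_nabla_tangent U X Y p : oin U -> vf U X -> vf U Y -> U p ->
  tangent A1 p (chern_nabla X Y p).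
Proof.
move=> oU hX hY Up; apply: tangent_eq (chern_nabla_invariant oU hX hY Up) _.
have hJ := vf_J hM hs oU hY; have hv := vf_ver hM hs oU hY.
apply: tangentD; last exact: (vf_vertical_der hM hs oU hX hv).1.
apply: tangentD; last exact: (vf_HLJ hM hs oU (vf_vertical_der hM hs oU hX hJ)).1.
apply: (tangentZ (a := fun i => (dadapted i Y p (X p i)).1.1)).
  exact: X_sigma_tangent.
by move=> i k di dk; exact: (dadapted_dt_change oU hX hY Up di dk).
Qed.

Lemma vf_chern_nabla U X Y : oin U -> vf U X -> vf U Y -> vf U (chern_nabla X Y).
Proof.
move=> oU hX hY.
apply: (vector_field_adapted hM hs (g := fun i y =>
  'd (coord_rep (A1 i) (adapted i Y)) y (coord_rep (A1 i) (X ^~ i) y) -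
  christoffel (F i) y (coord_rep (A1 i) (adapted i X) y) (coord_rep (A1 i)
    (adapted i Y) y))).
- exact: oU.
- by move=> p Up; exact: chern_nabla_tangent oU hX hY Up.
- by move=> i p Up dp; rewrite adapted_chern_nabla !(chart1_repE hM _ dp).
- move=> i m; apply: (CkB (oU i)).
    apply: (Ck_diff_app frame_E1 (oU i)); first exact: (adapted_smooth hM hs i
    oU hY).
    exact: hX.2.
  apply: (Ck_christoffel (oU i) (force_rep_smooth hM hs U i)).
    exact: (adapted_smooth hM hs i oU hX).
  exact: (adapted_smooth hM hs i oU hY).
Qed.

Lemma eq_on_adapted U X Y :
  (forall p i, U p -> chart_dom (A1 i) p -> adapted i X p = adapted i Y p) ->
  eq_on A1 U X Y.
Proof. by move=> h p Up i dp; apply: (adapted_inj (sigma := sigma)); exact: h. Qed.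

Lemma chern_nabla_connection : linear_connection A1 chern_nabla.
Proof.
have WpU U i p : U p -> chart_dom (A1 i) p -> (A1 i @` (U `&` chart_dom (A1
  i))) (A1 i p).
  by move=> Up dp; exists p.
split.
- by move=> U X Y oU hX hY; exact: vf_chern_nabla.
- move=> U X X' Y Y' oU hX hX' hY hY' eX eY; apply: eq_on_adapted => p i Up dp.
  have eXp : adapted i X p = adapted i X' p by rewrite /adapted (eX p Up i dp).
  have eYp : adapted i Y p = adapted i Y' p by rewrite /adapted (eY p Up i dp).
  rewrite (adapted_chern_nabla sigma i X Y p) (adapted_chern_nabla sigma i X' Y' p).
  have e v : dadapted i Y p v = dadapted i Y' p v.
    apply: (dadapted_on hM _ oU Up dp _ (adapted_diff hM hs oU hY' Up dp)) => q
    Uq dq.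
    by rewrite (chart1_repE hM _ dq) /adapted (eY q Uq i dq).
  rewrite eXp eYp (eX p Up i dp).
  by rewrite (e (X' p i)).
- move=> U X X' Y oU hX hX' hY; apply: eq_on_adapted => p i Up dp.
  rewrite adaptedD (adapted_chern_nabla sigma i (X + X') Y p)
    (adapted_chern_nabla sigma i X Y p).
  rewrite (adapted_chern_nabla sigma i X' Y p) adaptedD (christoffelDl (oU i)
    (force_rep_smooth hM hs U i) _ _ _ (WpU U i p Up dp)).
  by rewrite dadaptedD opprD addrACA.
- move=> U f X Y oU hf hX hY; apply: eq_on_adapted => p i Up dp.
  have kZ Z : adapted i (fun p => f p *: Z p) p = f p *: adapted i Z p by
    exact: adaptZ.
  rewrite kZ (adapted_chern_nabla sigma i _ Y p) (adapted_chern_nabla sigma i X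
    Y p) kZ (christoffelZl (oU i) (force_rep_smooth hM hs U i) _ _ _ (WpU U i p
    Up dp)).
  rewrite scalerBr.
  have e : dadapted i Y p (f p *: X p i) = f p *: dadapted i Y p (X p i) by
    exact: linearZZ.
  by rewrite e.
- move=> U X Y Y' oU hX hY hY'; apply: eq_on_adapted => p i Up dp.
  rewrite adaptedD (adapted_chern_nabla sigma i X (Y + Y') p)
    (adapted_chern_nabla sigma i X Y p).
  rewrite (adapted_chern_nabla sigma i X Y' p) adaptedD christoffelD opprD addrACA.
  have e : dadapted i (Y + Y') p (X p i) = dadapted i Y p (X p i) + dadapted i
    Y' p (X p i).
    apply: (dadapted_on hM _ oU Up dp _
      (has_diffD (adapted_diff hM hs oU hY Up dp) (adapted_diff hM hs oU hY' Up
      dp))).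
    by move=> q Uq dq; rewrite !(chart1_repE hM _ dq) adaptedD.
  by rewrite e.
- move=> U f X Y oU hf hX hY; apply: eq_on_adapted => p i Up dp.
  have kZ Z q : adapted i (fun p => f p *: Z p) q = f q *: adapted i Z q by
    exact: adaptZ.
  have hfd : has_diff (coord_rep (A1 i) f) (A1 i p) ('d (coord_rep (A1 i) f)
    (A1 i p)).
    exact: (Ck_diff (hf i 1) (WpU U i p Up dp)).
  have e : dadapted i (fun p => f p *: Y p) p (X p i) =
      dir_deriv A1 i X f p *: adapted i Y p + f p *: dadapted i Y p (X p i).
    rewrite (dadapted_on hM _ oU Up dp _ (has_diffZ hfd (adapted_diff hM hs oU
    hY Up dp))).
      by rewrite (chart1_repE hM (adapted i Y) dp) (chart1_repE hM f dp) /dir_deriv.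
    by move=> q Uq dq; rewrite !(chart1_repE hM _ dq) kZ.
  rewrite [RHS]adaptD !adaptZ -[adapt _ _ (Y p i)]/(adapted i Y p).
  rewrite -[adapt _ _ (chern_nabla X Y p i)]/(adapted i (chern_nabla X Y) p).
  by rewrite (adapted_chern_nabla sigma i X _ p) (adapted_chern_nabla sigma i X
    Y p) kZ e christoffelZ scalerBr addrA.
Qed.

(** The same derivation D_X acts on the omega-part and on the vertical part,
    so it commutes with constant combinations of the two. *)
Lemma chern_nabla_parallel_block_map (L : field -> field) e s t u v :
  (forall U Y, oin U -> vf U Y -> vf U (L Y)) ->
  (forall U Y i p, oin U -> vf U Y -> U p -> chart_dom (A1 i) p ->
     adapted i (L Y) p = block_map e s t u v (adapted i Y p)) ->
  parallel_endo A1 chern_nabla L.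
Proof.
move=> hL kL U X Y oU hX hY; apply: eq_on_adapted => p i Up dp.
rewrite adaptedB (kL U _ i p oU (vf_chern_nabla oU hX hY) Up dp).
rewrite (adapted_chern_nabla sigma i X (L Y) p) (adapted_chern_nabla sigma i X Y p).
rewrite (dadapted_block_map hM hs oU hY Up dp (fun q Uq dq => kL U Y i q oU hY
  Uq dq)).
by rewrite (kL U Y i p oU hY Up dp) christoffel_block_map -block_mapB subrr
  adapted0.
Qed.

Lemma chern_nabla_X : parallel_field A1 chern_nabla Xs.
Proof.
move=> U X oU hX; apply: eq_on_adapted => p i Up dp.
rewrite (adapted_chern_nabla sigma i X Xs p) (dadapted_Xs sigma hM _ dp)
  (adapted_Xs sigma hM dp) adapted0 christoffelE.
by rewrite !gamma0 subrr.
Qed.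

Lemma chern_nabla_torsion : has_torsion A1 chern_nabla (T_sigma sigma).
Proof.
move=> U X Y oU hX hY; apply: eq_on_adapted => p i Up dp.
have hhX := vf_hor hM hs oU hX; have hhY := vf_hor hM hs oU hY.
rewrite /torsion 2!adaptedB (adapted_chern_nabla sigma i X Y p)
  (adapted_chern_nabla sigma i Y X p).
rewrite (adapted_bracket hM hs oU hX hY Up dp).
have -> (a b c d e : E1) : a - b - (c - d) - (a - c + e) = d - b - e.
  by rewrite opprB [a - b]addrC addrACA opprD [LHS]addrA addrK [- b + d]addrC.
rewrite (torsion_algebra (oU i) (force_rep_smooth hM hs U i)); last by exists p.
rewrite /T_sigma adaptedD /curvature adaptedN (adapted_ver sigma hM _ dp).
rewrite (adapted_bracket hM hs oU hhX hhY Up dp).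
rewrite (dadapted_block_map hM hs oU hX Up dp (fun q _ dq => adapted_block_hor
  sigma hM X dq)).
rewrite (dadapted_block_map hM hs oU hY Up dp (fun q _ dq => adapted_block_hor
  sigma hM Y dq)).
rewrite !block_map_hor !(adapted_hor sigma hM _ dp).
have -> (a b : R * V) (c : E1) : ((a, 0) - (b, 0) + c : E1).2 = c.2.
  by rewrite /= subr0 add0r.
have kH Z (hZ : vf U Z) : adapted i (HLJ sigma Z) p = (0, (adapted i Z p).2, 0) :=
  etrans (adapted_block_HLJ hM hs oU hZ Up dp) (block_map_HLJ _).
have e1 : adapt (F i) (A1 i p) (dt X p i *: HLJ sigma Y p i) =
    (adapted i X p).1.1 *: ((0, (adapted i Y p).2, 0) : E1).
  by rewrite adapted_dt; exact: etrans (adaptZ _ _ _ _) (congr1 ( *:%R _) (kH Y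
    hY)).
have e2 : adapt (F i) (A1 i p) (dt Y p i *: HLJ sigma X p i) =
    (adapted i Y p).1.1 *: ((0, (adapted i X p).2, 0) : E1).
  by rewrite adapted_dt; exact: etrans (adaptZ _ _ _ _) (congr1 ( *:%R _) (kH X
    hX)).
have e3 : adapted i (dt_wedge (HLJ sigma) X Y) p =
    (adapted i X p).1.1 *: ((0, (adapted i Y p).2, 0) : E1) -
    (adapted i Y p).1.1 *: ((0, (adapted i X p).2, 0) : E1).
  by rewrite -e1 -e2; exact: adaptB.
by rewrite e3.
Qed.

Lemma chern_nabla_characterized : characterized sigma chern_nabla.
Proof.
split.
- exact: chern_nabla_X.
- apply: (chern_nabla_parallel_block_map (e := 0) (s := -1) (t := 0) (u := 0)
  (v := 1)).
    by move=> U Y; exact: vf_LJ.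
  by move=> U Y i p oU hY Up dp; exact: (adapted_block_LJ hM hs oU hY Up dp).
- apply: (chern_nabla_parallel_block_map (e := 0) (s := 0) (t := 1) (u := 1) (v
  := 0)).
    by move=> U Y; exact: vf_E.
  by move=> U Y i p oU hY Up dp; exact: (adapted_block_E hM hs oU hY Up dp).
- exact: chern_nabla_torsion.
Qed.

End ChernNablaProperties.

(** * Uniqueness from the torsion *)

Section Uniqueness.
Context {R : realType} {n : nat} {M : topologicalType} {I : Type}.
Variables (phi : I -> chart M 'rV[R]_n) (sigma : jet phi 1 -> jet phi 2).
Hypothesis hM : smooth_manifold phi.
Hypothesis hs : sode sigma.
Local Notation M1 := (jet phi 1).
Local Notation V := 'rV[R]_n.
Local Notation E1 := (R * V * V)%type.
Local Notation A1 := (chart1 phi).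
Local Notation field := (M1 -> I -> E1).
Local Notation Xs := (X_sigma sigma).
Local Notation adapted := (adapted sigma).
Local Notation vf := (vector_field A1).
Local Notation oin := (open_in A1).
Let gJ := jet_atlas hM.
Implicit Types (U : set M1) (X Y Z : field) (p : M1) (i k : I).

Definition is_vert U Z := forall p i, U p -> chart_dom (A1 i) p -> (adapted i Z
  p).1 = 0.

Section OneConnection.
Variable D : field -> field -> field.
Hypotheses (hD : linear_connection A1 D) (hC : characterized sigma D).

Let DLJ : parallel_endo A1 D (LJ sigma). Proof. by case: hC. Qed.
Let DE : parallel_endo A1 D (E_endo sigma). Proof. by case: hC. Qed.

Lemma adapted_eq U X Y p i : eq_on A1 U X Y -> U p -> chart_dom (A1 i) p ->
  adapted i X p = adapted i Y p.
Proof. by move=> e Up dp; rewrite /adapted (e p Up i dp). Qed.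

Lemma conn_eqr U X Y Y' p i : oin U -> vf U X -> vf U Y -> vf U Y' ->
  (forall q k, U q -> chart_dom (A1 k) q -> adapted k Y q = adapted k Y' q) ->
  U p -> chart_dom (A1 i) p -> adapted i (D X Y) p = adapted i (D X Y') p.
Proof.
move=> oU hX hY hY' e; apply: adapted_eq; apply: (conn_local hD oU hX hX hY
  hY') => //.
by apply: (eq_on_adapted (sigma := sigma)) => q k; exact: e.
Qed.

Lemma parallel_adapted (L : field -> field) U X Y p i : parallel_endo A1 D L ->
  oin U -> vf U X -> vf U Y -> U p -> chart_dom (A1 i) p ->
  adapted i (D X (L Y)) p = adapted i (L (D X Y)) p.
Proof.
move=> hL oU hX hY Up dp; have := adapted_eq (hL U X Y oU hX hY) Up dp.
by rewrite adaptedB adapted0 => /subr0_eq.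
Qed.

Lemma conn_LJ U X Y p i : oin U -> vf U X -> vf U Y -> U p -> chart_dom (A1 i) p ->
  adapted i (D X (LJ sigma Y)) p = (0, - (adapted i (D X Y) p).1.2, (adapted i
    (D X Y) p).2).
Proof.
move=> oU hX hY Up dp; rewrite (parallel_adapted DLJ oU hX hY Up dp).
exact: etrans (adapted_block_LJ hM hs oU (conn_field hD oU hX hY) Up dp)
  (block_map_LJ _).
Qed.

Lemma conn_E U X Y p i : oin U -> vf U X -> vf U Y -> U p -> chart_dom (A1 i) p ->
  adapted i (D X (E_endo sigma Y)) p = (0, (adapted i (D X Y) p).2, (adapted i
    (D X Y) p).1.2).
Proof.
move=> oU hX hY Up dp; rewrite (parallel_adapted DE oU hX hY Up dp).
exact: etrans (adapted_block_E hM hs oU (conn_field hD oU hX hY) Up dp)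
  (block_map_E _).
Qed.

(** Vertical fields form the eigenspace of the parallel endomorphism L_X J for
    the eigenvalue 1. *)
Lemma conn_vert U X Z : oin U -> vf U X -> vf U Z -> is_vert U Z ->
  is_vert U (D X Z).
Proof.
move=> oU hX hZ vZ p i Up dp.
have e : adapted i (D X (LJ sigma Z)) p = adapted i (D X Z) p.
  apply: (conn_eqr oU hX (vf_LJ hM hs oU hZ) hZ _ Up dp) => q k Uq dq.
  rewrite (adapted_block_LJ hM hs oU hZ Uq dq) block_map_LJ.
  by have := vZ q k Uq dq; case: (adapted k Z q) => [a b] /= ->; rewrite oppr0.
rewrite (conn_LJ oU hX hZ Up dp) in e.
case: (adapted i (D X Z) p) e => [[a b] c] /= [ea eb].
(* b and - b are both the omega-part of nabla_X Z *)
have b0 : b = 0.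
  by apply: (@scalerI _ _ (2 : R)); rewrite ?pnatr_eq0// scaler_nat mulr2n
    -{1}eb addNr scaler0.
by rewrite -ea b0.
Qed.

Lemma vert_ver U Z : is_vert U (ver sigma Z).
Proof. by move=> p i _ dp; exact (congr1 fst (adapted_ver sigma hM Z dp)). Qed.

Lemma vert_J U Z : is_vert U (J_endo Z).
Proof. by move=> p i _ dp; exact (congr1 fst (adapted_J sigma hM Z dp)). Qed.

(** L_X J maps hor Z to E V for a vertical field V. As E and vertical fields
    are preserved, the derivative of hor Z has no vertical part. *)
Lemma conn_hor U X Z p i : oin U -> vf U X -> vf U Z -> U p -> chart_dom (A1 i) p ->
  (adapted i (D X (hor sigma Z)) p).2 = 0.
Proof.
move=> oU hX hZ Up dp.
have hh := vf_hor hM hs oU hZ; have hL := vf_LJ hM hs oU hh.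
have hE := vf_E hM hs oU hL.
have kL q k : U q -> chart_dom (A1 k) q ->
    adapted k (LJ sigma (hor sigma Z)) q = (0, - (adapted k Z q).1.2, 0).
  move=> Uq dq; rewrite (adapted_block_LJ hM hs oU hh Uq dq) block_map_LJ.
  by rewrite (adapted_hor sigma hM _ dq).
have kE q k : U q -> chart_dom (A1 k) q ->
    adapted k (E_endo sigma (LJ sigma (hor sigma Z))) q = (0, 0, - (adapted k Z
    q).1.2).
  by move=> Uq dq; rewrite (adapted_block_E hM hs oU hL Uq dq) block_map_E kL.
have vE : is_vert U (E_endo sigma (LJ sigma (hor sigma Z))).
  by move=> q k Uq dq; rewrite kE.
have e : adapted i (D X (E_endo sigma (E_endo sigma (LJ sigma (hor sigma Z))))) p =
    adapted i (D X (LJ sigma (hor sigma Z))) p.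
  apply: (conn_eqr oU hX (vf_E hM hs oU hE) hL _ Up dp) => q k Uq dq.
  by rewrite (adapted_block_E hM hs oU hE Uq dq) block_map_E kE// kL.
rewrite (conn_E oU hX hE Up dp) (conn_LJ oU hX hh Up dp) in e.
have v := conn_vert oU hX hE vE Up dp.
have := congr1 snd e => /= <-.
by rewrite v.
Qed.

End OneConnection.

Section TwoConnections.
Variables D D' : field -> field -> field.
Hypotheses (hD : linear_connection A1 D) (hC : characterized sigma D).
Hypotheses (hD' : linear_connection A1 D') (hC' : characterized sigma D').

Lemma torsion_agree U X Y p i : oin U -> vf U X -> vf U Y -> U p ->
  chart_dom (A1 i) p ->
  adapted i (D X Y) p - adapted i (D Y X) p = adapted i (D' X Y) p - adapted i
    (D' Y X) p.
Proof.
move=> oU hX hY Up dp.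
have [_ _ _ hT] := hC; have [_ _ _ hT'] := hC'.
have := etrans (adapted_eq (hT U X Y oU hX hY) Up dp)
  (esym (adapted_eq (hT' U X Y oU hX hY) Up dp)).
rewrite /torsion (adaptedB sigma i (D X Y - D Y X)) (adaptedB sigma i (D' X Y -
  D' Y X)).
rewrite (adaptedB sigma i (D X Y)) (adaptedB sigma i (D' X Y)).
move: (adapted i (bracket _ _ _) p) => b /(congr1 (fun z => z + b)); rewrite
  2!subrK; exact.
Qed.

(** If X is horizontal, nabla_Z X has no vertical part, so the torsion gives
    the vertical part of nabla_X Z. If X is vertical, so is nabla_(E Z) X, and
    the torsion gives the omega-part of nabla_X (E Z) = E (nabla_X Z). *)
Lemma vert_agree U X Z p i : oin U -> vf U X -> vf U Z -> is_vert U Z -> U p ->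
  chart_dom (A1 i) p -> adapted i (D X Z) p = adapted i (D' X Z) p.
Proof.
move=> oU hX hZ vZ Up dp.
have hh := vf_hor hM hs oU hX; have hv := vf_ver hM hs oU hX.
have hE := vf_E hM hs oU hZ.
have split_arg (B : field -> field -> field) : linear_connection A1 B ->
    adapted i (B X Z) p = adapted i (B (hor sigma X) Z) p + adapted i (B (ver
    sigma X) Z) p.
  move=> hB; have eX : eq_on A1 U X (hor sigma X + ver sigma X).
    move=> q _ k _; rewrite -[RHS]/(hor sigma X q k + (X q k - hor sigma X q k)).
    by rewrite addrC subrK.
  have e1 := conn_local hB oU hX (vector_fieldD gJ oU hh hv) hZ hZ eX
    (fun q _ k _ => erefl _).
  by rewrite (adapted_eq e1 Up dp) (adapted_eq (conn_addl hB oU hh hv hZ) Up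
    dp) adaptedD.
have e1 : (adapted i (D (hor sigma X) Z) p).2 = (adapted i (D' (hor sigma X) Z)
  p).2.
  have := congr1 snd (torsion_agree oU hh hZ Up dp) => /=.
  rewrite (conn_hor hD hC oU hZ hX Up dp) (conn_hor hD' hC' oU hZ hX Up dp).
  by rewrite !subr0.
have vv : is_vert U (ver sigma X) by exact: vert_ver.
have e2 : (adapted i (D (ver sigma X) Z) p).2 = (adapted i (D' (ver sigma X) Z)
  p).2.
  have := congr1 (fun c => c.1.2) (torsion_agree oU hv hE Up dp) => /=.
  rewrite (conn_E hD hC oU hv hZ Up dp) (conn_E hD' hC' oU hv hZ Up dp) /=.
  rewrite (conn_vert hD hC oU hE hv vv Up dp) (conn_vert hD' hC' oU hE hv vv Up dp).
  by rewrite /= !subr0.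
have v1 := conn_vert hD hC oU hX hZ vZ Up dp.
have v2 := conn_vert hD' hC' oU hX hZ vZ Up dp.
rewrite [LHS]surjective_pairing [RHS]surjective_pairing v1 v2.
by rewrite (split_arg D hD) (split_arg D' hD') /= e1 e2.
Qed.

Definition some_chart p : I := projT1 (cid (manifold_cover hM (jet_target p))).

Lemma some_chartP p : chart_dom (A1 (some_chart p)) p.
Proof. exact: projT2 (cid (manifold_cover hM (jet_target p))). Qed.

(** The form dt is independent of the chart, so that any choice of a chart at
    each point gives this smooth function. *)
Definition dt_fun Y p : R := (Y p (some_chart p)).1.1.

Lemma dt_funE U Y i p : vf U Y -> U p -> chart_dom (A1 i) p ->
  dt_fun Y p = (adapted i Y p).1.1.
Proof.
move=> hY Up dp; rewrite adapted_dt.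
exact: (tangent_dt hM (hY.1 p Up) (some_chartP p) dp).
Qed.

Lemma dt_fun_smooth U Y : oin U -> vf U Y -> smooth_fun A1 U (dt_fun Y).
Proof.
move=> oU hY i m.
have h : Ck m (A1 i @` (U `&` chart_dom (A1 i)))
    (fun y => (coord_rep (A1 i) (Y ^~ i) y).1.1).
  by apply: (Ck_fst (oU i)); apply: (Ck_fst (oU i)); exact: hY.2.
apply: (Ck_eq (oU i) _ h) => _ [q [Uq dq] <-].
by rewrite !(chart1_repE hM _ dq) (dt_funE hY Uq dq) adapted_dt.
Qed.

(** Y = dt(Y) X^sigma + E (J Y) + ver Y, where J Y and ver Y are vertical
    while X^sigma and E are parallel. *)
Lemma characterized_agree : eq_connection A1 D D'.
Proof.
move=> U X Y oU hX hY; apply: (eq_on_adapted (sigma := sigma)) => p i Up dp.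
have hJ := vf_J hM hs oU hY; have hv := vf_ver hM hs oU hY.
have hE := vf_E hM hs oU hJ.
have hXs := vf_Xs hM hs oU.
have hf := dt_fun_smooth oU hY.
have hfX := vector_fieldZ gJ oU hf hXs.
have hS := vector_fieldD gJ oU (vector_fieldD gJ oU hfX hE) hv.
set f := dt_fun Y in hf hfX hS.
pose S : field := (fun p => f p *: Xs p) + E_endo sigma (J_endo Y) + ver sigma Y.
have eS q k : U q -> chart_dom (A1 k) q -> adapted k Y q = adapted k S q.
  move=> Uq dq; rewrite 2!adaptedD (adapted_ver sigma hM _ dq).
  rewrite (adapted_block_E hM hs oU hJ Uq dq) block_map_E (adapted_J sigma hM _ dq).
  have -> : adapted k (fun p => f p *: Xs p) q = f q *: adapted k Xs q by
    exact: adaptZ.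
  rewrite (adapted_Xs sigma hM dq) (dt_funE hY Uq dq : f q = _).
  case: (adapted k Y q) => [[a b] c]; congr ((_, _), _) => /=.
  - by rewrite [a *: _]mulr1 !addr0.
  - by rewrite scaler0 add0r addr0.
  - by rewrite scaler0 !add0r.
have key (B : field -> field -> field) : linear_connection A1 B ->
    characterized sigma B ->
    adapted i (B X Y) p = dir_deriv A1 i X f p *: adapted i Xs p +
      (0, (adapted i (B X (J_endo Y)) p).2, (adapted i (B X (J_endo Y)) p).1.2) +
      adapted i (B X (ver sigma Y)) p.
  move=> hB cB; have [pX _ _ _] := cB.
  rewrite (conn_eqr hB oU hX hY hS eS Up dp).
  rewrite (adapted_eq (conn_addr hB oU hX (vector_fieldD gJ oU hfX hE) hv) Up
    dp) adaptedD.
  rewrite (adapted_eq (conn_addr hB oU hX hfX hE) Up dp) adaptedD.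
  rewrite (conn_E hB cB oU hX hJ Up dp).
  rewrite (adapted_eq (conn_leibniz hB oU hf hX hXs) Up dp).
  have -> : adapted i (fun p i => dir_deriv A1 i X f p *: Xs p i + f p *: B X
    Xs p i) p =
     dir_deriv A1 i X f p *: adapted i Xs p + f p *: adapted i (B X Xs) p.
    by apply: etrans (adaptD _ _ _ _) _; rewrite !adaptZ.
  by rewrite (adapted_eq (pX U X oU hX) Up dp) adapted0 scaler0 addr0.
rewrite (key D hD hC) (key D' hD' hC').
by rewrite (vert_agree oU hX hJ (@vert_J U Y) Up dp)
  (vert_agree oU hX hv (@vert_ver U Y) Up dp).
Qed.

End TwoConnections.

End Uniqueness.

(** * Connections and frames *)

Section AtlasFrames.
Context {R : realType} {P I : Type} {E : normedModType R}.
Variable A : I -> chart P E.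
Hypothesis gA : good_atlas A.
Implicit Types (U : set P) (p : P) (X Y Z : P -> I -> E).

(** The other charts see the same field through the transitions. *)
Lemma vector_field_chart U k (w : P -> E) : open_in A U ->
  (forall p, U p -> chart_dom (A k) p) ->
  (forall m, Ck m (A k @` (U `&` chart_dom (A k))) (coord_rep (A k) w)) ->
  vector_field A U (chart_field A k w).
Proof.
move=> oU Uk hw; have inj := atlas_inj gA; have fr := atlas_frame gA.
pose G l z := 'd (transition A k l) z (coord_rep (A k) w z).
apply: (vector_fieldI gA (g := fun l y => G l (transition A l k y))) => //.
- by move=> p Up; apply: (chart_field_tangent gA); exact: Uk.
- move=> l p Up dl; have dk := Uk p Up.
  by rewrite /G (transitionE gA _ dl) (coord_repE _ (inj k) dk).
move=> l m.
pose W := A k @` ((U `&` chart_dom (A l)) `&` chart_dom (A k)).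
have oW : open W.
  by apply: (open_inI gA oU _); exact: atlas_open.
have hG : Ck m W (G l).
  apply: (Ck_diff_app fr oW).
    by apply: Ck_sub (atlas_smooth gA k l m.+1); apply: image_subset => q [[_ ?] ?].
  by apply: Ck_sub (hw m); apply: image_subset => q [[? _] ?].
apply: (Ck_comp fr (oU l) _ _ hG).
- move=> _ [q [Uq dl] <-]; rewrite (transitionE gA _ dl).
  by exists q => //; split=> //; exact: Uk.
- by apply: Ck_sub (atlas_smooth gA l k m); apply: image_subset => q [Uq dq];
    split=> //; exact: Uk.
Qed.

Lemma smooth_fun_chart U k (f : P -> R) : open_in A U ->
  (forall p, U p -> chart_dom (A k) p) ->
  (forall m, Ck m (A k @` (U `&` chart_dom (A k))) (coord_rep (A k) f)) ->
  smooth_fun A U f.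
Proof.
move=> oU Uk hf l m; have inj := atlas_inj gA; have fr := atlas_frame gA.
have h : Ck m (A l @` (U `&` chart_dom (A l)))
    (fun y => coord_rep (A k) f (transition A l k y)).
  apply: (Ck_comp fr (oU l) _ _ (hf m)).
  - move=> _ [q [Uq dl] <-]; rewrite (transitionE gA _ dl).
    by exists q => //; split=> //; exact: Uk.
  - by apply: Ck_sub (atlas_smooth gA l k m); apply: image_subset => q [Uq dq];
      split=> //; exact: Uk.
apply: Ck_eq (oU l) _ h => _ [q [Uq dl] <-].
by rewrite (transitionE gA _ dl) (coord_repE _ (inj k) (Uk q Uq))
  (coord_repE _ (inj l) dl).
Qed.

Lemma tangent_sum p (T : finType) (v : T -> I -> E) :
  (forall t, tangent A p (v t)) -> tangent A p (\sum_t v t).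
Proof.
move=> hv; apply: (big_ind (tangent A p)) => //; first exact: tangent0.
by move=> ? ?; exact: tangentD.
Qed.

Section Agree.
Variables D D' : (P -> I -> E) -> (P -> I -> E) -> P -> I -> E.
Hypotheses (hD : linear_connection A D) (hD' : linear_connection A D').

Lemma conn_zerol B U Z : linear_connection A B -> open_in A U ->
  vector_field A U Z -> eq_on A U (B 0 Z) 0.
Proof.
move=> hB oU hZ p Up i di; have v0 := vector_field0 gA oU.
have := conn_addl hB oU v0 v0 hZ Up di; rewrite addr0.
rewrite -[RHS]/(B 0 Z p i + B 0 Z p i) => e.
by apply: (addrI (B 0 Z p i)); rewrite -e -[RHS]/(_ + 0) addr0.
Qed.

Lemma conn_zeror B U Z : linear_connection A B -> open_in A U ->
  vector_field A U Z -> eq_on A U (B Z 0) 0.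
Proof.
move=> hB oU hZ p Up i di; have v0 := vector_field0 gA oU.
have := conn_addr hB oU hZ v0 v0 Up di; rewrite addr0.
rewrite -[RHS]/(B Z 0 p i + B Z 0 p i) => e.
by apply: (addrI (B Z 0 p i)); rewrite -e -[RHS]/(_ + 0) addr0.
Qed.

(** The derivatives of the coefficients g enter both connections in the same
    way, by the Leibniz rule. *)
Lemma frame_agree U (T : finType) (e : T -> P -> I -> E) (f g : T -> P -> R) :
  open_in A U -> (forall t, vector_field A U (e t)) ->
  (forall t, smooth_fun A U (f t)) -> (forall t, smooth_fun A U (g t)) ->
  (forall s t, eq_on A U (D (e s) (e t)) (D' (e s) (e t))) ->
  eq_on A U (D (\sum_t (fun p => f t p *: e t p)) (\sum_t (fun p => g t p *: e
    t p)))
            (D' (\sum_t (fun p => f t p *: e t p)) (\sum_t (fun p => g t p *: e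
            t p))).
Proof.
move=> oU he hf hg ag.
have hfe t : vector_field A U (fun p => f t p *: e t p) by exact: vector_fieldZ.
have hge t : vector_field A U (fun p => g t p *: e t p) by exact: vector_fieldZ.
have left_agree Z : vector_field A U Z ->
    (forall s, eq_on A U (D (e s) Z) (D' (e s) Z)) ->
    eq_on A U (D (\sum_t (fun p => f t p *: e t p)) Z)
              (D' (\sum_t (fun p => f t p *: e t p)) Z).
  move=> hZ agZ.
  pose Q X := vector_field A U X /\ eq_on A U (D X Z) (D' X Z).
  suff : Q (\sum_t (fun p => f t p *: e t p)) by case.
  apply: (big_ind Q).
  - split; first exact: vector_field0.
    by move=> p Up i di; rewrite (conn_zerol hD oU hZ Up di) (conn_zerol hD' oU
    hZ Up di).
  - move=> X Y [hX aX] [hY aY]; split; first exact: vector_fieldD.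
    move=> p Up i di.
    rewrite (conn_addl hD oU hX hY hZ Up di) (conn_addl hD' oU hX hY hZ Up di).
    by rewrite -![(_ + _) p i]/(_ p i + _ p i) (aX p Up i di) (aY p Up i di).
  - move=> t _; split=> // p Up i di.
    rewrite (conn_scalel hD oU (hf t) (he t) hZ Up di).
    rewrite (conn_scalel hD' oU (hf t) (he t) hZ Up di).
    by congr (f t p *: _); exact: agZ.
have hS : vector_field A U (\sum_t (fun p => f t p *: e t p)).
  exact: vector_field_sum.
set S := \sum_t (fun p => f t p *: e t p) in left_agree hS *.
pose Q Y := vector_field A U Y /\ eq_on A U (D S Y) (D' S Y).
suff : Q (\sum_t (fun p => g t p *: e t p)) by case.
apply: (big_ind Q).
- split; first exact: vector_field0.
  by move=> p Up i di; rewrite (conn_zeror hD oU hS Up di) (conn_zeror hD' oU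
    hS Up di).
- move=> X Y [hX aX] [hY aY]; split; first exact: vector_fieldD.
  move=> p Up i di.
  rewrite (conn_addr hD oU hS hX hY Up di) (conn_addr hD' oU hS hX hY Up di).
  by rewrite -![(_ + _) p i]/(_ p i + _ p i) (aX p Up i di) (aY p Up i di).
- move=> t _; split=> // p Up i di.
  rewrite (conn_leibniz hD oU (hg t) hS (he t) Up di).
  rewrite (conn_leibniz hD' oU (hg t) hS (he t) Up di).
  have a := left_agree (e t) (he t) (fun s => ag s t) p Up i di.
  by rewrite a.
Qed.

End Agree.
End AtlasFrames.

(** * The Chern connection in coordinates *)

Section Chern.
Context {R : realType} {n : nat} {M : topologicalType} {I : Type}.
Variables (phi : I -> chart M 'rV[R]_n) (sigma : jet phi 1 -> jet phi 2).
Hypothesis hM : smooth_manifold phi.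
Hypothesis hs : sode sigma.
Local Notation M1 := (jet phi 1).
Local Notation V := 'rV[R]_n.
Local Notation E1 := (R * V * V)%type.
Local Notation A1 := (chart1 phi).
Local Notation field := (M1 -> I -> E1).
Local Notation Xs := (X_sigma sigma).
Local Notation F := (force_rep sigma).
Local Notation adapted := (adapted sigma).
Local Notation dadapted := (dadapted sigma).
Local Notation chern_nabla := (chern_nabla sigma).
Local Notation vf := (vector_field A1).
Local Notation oin := (open_in A1).
Local Notation dom i := (chart_dom (A1 i)).
Local Notation dl a := (delta_mx 0 a : V).
Let gJ := jet_atlas hM.
Implicit Types (U : set M1) (X Y Z : field) (p : M1) (i k : I) (a b c : 'I_n).

Lemma chart_field_self i (w : M1 -> E1) p : dom i p -> chart_field A1 i w p i = w p.
Proof. by move=> dp; rewrite /chart_field (transition_self gJ). Qed.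

Lemma X_hor_coordE i a p : dom i p ->
  X_hor_coord sigma i a p = frame (F i) (A1 i p) (0, dl a, 0).
Proof.
move=> dp; rewrite /frame /X_hor_coord /= !scale0r !add0r addr0.
by [].
Qed.

Lemma adapted_X_hor i a p : dom i p -> adapted i (X_hor sigma i a) p = (0, dl a, 0).
Proof.
move=> dp; rewrite /adapted /X_hor (chart_field_self _ dp) (X_hor_coordE a dp).
exact: frameK.
Qed.

Lemma adapted_D_vel i a p : dom i p -> adapted i (D_vel (phi := phi) i a) p =
  (0, 0, dl a).
Proof.
by move=> dp; rewrite /adapted /D_vel (chart_field_self _ dp); exact: adapt_vert.
Qed.

Lemma vf_X_hor i a : vf (dom i) (X_hor sigma i a).
Proof.
apply: (vector_field_chart gJ (atlas_open gJ i)) => // m.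
have oW := atlas_open gJ i i.
apply: (Ck_eq oW _ (Ck_frame oW (force_rep_smooth hM hs _ i)
  (Ck_cst m ((0, dl a, 0) : E1) oW))) => _ [q [_ dq] <-].
by rewrite (chart1_repE hM _ dq) (X_hor_coordE a dq).
Qed.

Lemma vf_D_vel i a : vf (dom i) (D_vel (phi := phi) i a).
Proof.
apply: (vector_field_chart gJ (atlas_open gJ i)) => // m.
have oW := atlas_open gJ i i.
apply: (Ck_eq oW _ (Ck_cst m ((0, 0, dl a) : E1) oW)) => _ [q [_ dq] <-].
by rewrite (chart1_repE hM _ dq).
Qed.

Lemma adapted_chern_nabla_const U X Z i p (c : E1) : oin U -> U p -> dom i p ->
  (forall q, U q -> dom i q -> adapted i Z q = c) ->
  adapted i (chern_nabla X Z) p = (0, - gamma (F i) (A1 i p) (adapted i X p) c.1.2,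
    - gamma (F i) (A1 i p) (adapted i X p) c.2).
Proof.
move=> oU Up dp hZ; rewrite adapted_chern_nabla (hZ p Up dp) christoffelE.
have -> : dadapted i Z p (X p i) = 0.
  exact: (dadapted_on hM (X p i) oU Up dp hZ (has_diff_cst c (A1 i p))).
by congr ((_, _), _); rewrite /= sub0r// oppr0.
Qed.

Lemma sum_delta_hor (w : V) :
  \sum_(b < n) w 0 b *: ((0, dl b, 0) : E1) = (0, w, 0).
Proof.
have lin : linear (fun u : V => (0, u, 0) : E1).
  by move=> r u v; congr ((_, _), _); rewrite /= ?mulr0 ?scaler0 addr0.
pose L : {linear V -> E1} := HB.pack (fun u : V => (0, u, 0) : E1)
  (GRing.isLinear.Build _ _ _ _ _ lin).
rewrite [in RHS](row_sum_delta w) -[RHS]/(L _) linear_sum.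
by apply: eq_bigr => b _; apply: esym; exact: linearZZ.
Qed.

Lemma sum_delta_vel (w : V) :
  \sum_(b < n) w 0 b *: ((0, 0, dl b) : E1) = (0, 0, w).
Proof.
pose L : {linear V -> E1} := HB.pack (fun u : V => (0, 0, u) : E1)
  (GRing.isLinear.Build _ _ _ _ _ (@vert_lin R n)).
rewrite [in RHS](row_sum_delta w) -[RHS]/(L _) linear_sum.
by apply: eq_bigr => b _; apply: esym; exact: linearZZ.
Qed.

Lemma adapted_comb i p (r : 'I_n -> M1 -> R) (Z : 'I_n -> field) :
  adapted i (fun j => \sum_(b < n) r b j *: Z b j) p =
  \sum_(b < n) r b p *: adapted i (Z b) p.
Proof.
have e : (\sum_(b < n) r b p *: Z b p) i = \sum_(b < n) r b p *: Z b p i.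
  by rewrite fct_sumE.
apply: etrans (congr1 (adapt (F i) (A1 i p)) e) _.
apply: etrans (raddf_sum (adapt (F i) (A1 i p)) _ _ _) _.
by apply: eq_bigr => b _; exact: adaptZ.
Qed.

Lemma tangent_comb p (r : 'I_n -> R) (v : 'I_n -> I -> E1) :
  (forall b, tangent A1 p (v b)) -> tangent A1 p (\sum_(b < n) r b *: v b).
Proof.
move=> hv; apply: tangent_sum => b.
exact: (tangentZ (a := fun=> r b) (hv b)).
Qed.

Lemma eq_on_chart i X Y : (forall p, dom i p -> tangent A1 p (X p)) ->
  (forall p, dom i p -> tangent A1 p (Y p)) ->
  (forall p, dom i p -> adapted i X p = adapted i Y p) -> eq_on A1 (dom i) X Y.
Proof.
move=> tX tY e p dp; apply: (tangent_eq_at dp (tX p dp) (tY p dp)).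
by apply: (adapted_inj (sigma := sigma)); exact: e.
Qed.

Lemma chern_coef1E i a p b : chern_coef1 sigma i a b p = (- ncoef (F i) (A1 i
  p) (dl a)) 0 b.
Proof.
rewrite /chern_coef1 /ncoef -/(dvel i a (force sigma i) p).
by move: (dvel i a (force sigma i) p) => d; rewrite !mxE mulNr.
Qed.

Lemma chern_coef2E i a b p c : dom i p ->
  chern_coef2 sigma i a b c p = (- scoef (F i) (A1 i p) (dl a) (dl b)) 0 c.
Proof.
move=> dp; have oW := atlas_open gJ i i.
have Wp : (A1 i @` (dom i `&` dom i)) (A1 i p) by exists p.
have h : has_diff (dvert (F i) (dl b)) (A1 i p) ('d (dvert (F i) (dl b)) (A1 i p)).
  have [_ h] := force_rep_smooth hM hs (dom i) i 2; have [h' _] := h (0, 0, dl b).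
  by apply: has_diffP; exact: h'.
have E y : (A1 i @` (dom i `&` dom i)) y ->
    dvert (F i) (dl b) y = coord_rep (A1 i) (dvel i b (force sigma i)) y.
  by move=> [q [_ dq] <-]; rewrite (chart1_repE hM _ dq).
have e : dvel i a (dvel i b (force sigma i)) p =
    'd (dvert (F i) (dl b)) (A1 i p) (0, 0, dl a).
  exact: (has_diff_on oW Wp E h).2.
rewrite /chern_coef2 e /scoef /dncoef.
by move: ('d (dvert (F i) (dl b)) _ _) => d; rewrite !mxE mulNr.
Qed.

Lemma chern_nabla_is_chern : chern_connection sigma chern_nabla.
Proof.
have od i := atlas_open gJ i.
have vX i := vf_Xs hM hs (od i).
have vH := vf_X_hor; have vD := vf_D_vel.
split.
- exact: chern_nabla_X.
- move=> i a; apply: eq_on_chart => p dp.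
  + exact: (vf_chern_nabla hM hs (od i) (vX i) (vH i a)).1.
  + by apply: tangent_comb => b; exact: (vH i b).1.
  rewrite (adapted_chern_nabla_const Xs (od i) dp dp (fun q _ dq =>
    adapted_X_hor a dq)) /=.
  rewrite (adapted_Xs sigma hM dp) gamma0 oppr0 adapted_comb.
  under eq_bigr do rewrite (adapted_X_hor _ dp) chern_coef1E.
  by rewrite sum_delta_hor /gamma /= scale1r scoef0r addr0.
- move=> i a; apply: eq_on_chart => p dp.
  + exact: (vf_chern_nabla hM hs (od i) (vX i) (vD i a)).1.
  + by apply: tangent_comb => b; exact: (vD i b).1.
  rewrite (adapted_chern_nabla_const Xs (od i) dp dp (fun q _ dq =>
    adapted_D_vel a dq)) /=.
  rewrite (adapted_Xs sigma hM dp) gamma0 oppr0 adapted_comb.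
  under eq_bigr do rewrite (adapted_D_vel _ dp) chern_coef1E.
  by rewrite sum_delta_vel /gamma /= scale1r scoef0r addr0.
- move=> i a b; apply: eq_on_chart => p dp.
  + exact: (vf_chern_nabla hM hs (od i) (vH i b) (vH i a)).1.
  + by apply: tangent_comb => c; exact: (vH i c).1.
  rewrite (adapted_chern_nabla_const _ (od i) dp dp (fun q _ dq =>
    adapted_X_hor a dq)) /=.
  rewrite (adapted_X_hor b dp) gamma0 oppr0 adapted_comb.
  under eq_bigr do rewrite (adapted_X_hor _ dp) (chern_coef2E _ _ _ dp).
  by rewrite sum_delta_hor /gamma /= scale0r add0r.
- move=> i a b; apply: eq_on_chart => p dp.
  + exact: (vf_chern_nabla hM hs (od i) (vH i b) (vD i a)).1.
  + by apply: tangent_comb => c; exact: (vD i c).1.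
  rewrite (adapted_chern_nabla_const _ (od i) dp dp (fun q _ dq =>
    adapted_D_vel a dq)) /=.
  rewrite (adapted_X_hor b dp) gamma0 oppr0 adapted_comb.
  under eq_bigr do rewrite (adapted_D_vel _ dp) (chern_coef2E _ _ _ dp).
  by rewrite sum_delta_vel /gamma /= scale0r add0r.
- move=> i a b; apply: eq_on_chart => p dp.
  + exact: (vf_chern_nabla hM hs (od i) (vD i b) (vH i a)).1.
  + exact: tangent0.
  rewrite (adapted_chern_nabla_const _ (od i) dp dp (fun q _ dq =>
    adapted_X_hor a dq)) /=.
  by rewrite (adapted_D_vel b dp) adapted0 /gamma /= !scale0r !scoef0r addr0 oppr0.
- move=> i a b; apply: eq_on_chart => p dp.
  + exact: (vf_chern_nabla hM hs (od i) (vD i b) (vD i a)).1.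
  + exact: tangent0.
  rewrite (adapted_chern_nabla_const _ (od i) dp dp (fun q _ dq =>
    adapted_D_vel a dq)) /=.
  by rewrite (adapted_D_vel b dp) adapted0 /gamma /= !scale0r !scoef0r addr0 oppr0.
Qed.

End Chern.

Section ChernFrame.
Context {R : realType} {n : nat} {M : topologicalType} {I : Type}.
Variables (phi : I -> chart M 'rV[R]_n) (sigma : jet phi 1 -> jet phi 2).
Hypothesis hM : smooth_manifold phi.
Hypothesis hs : sode sigma.
Local Notation M1 := (jet phi 1).
Local Notation V := 'rV[R]_n.
Local Notation E1 := (R * V * V)%type.
Local Notation A1 := (chart1 phi).
Local Notation field := (M1 -> I -> E1).
Local Notation Xs := (X_sigma sigma).
Local Notation F := (force_rep sigma).
Local Notation adapted := (adapted sigma).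
Local Notation vf := (vector_field A1).
Local Notation oin := (open_in A1).
Local Notation dom i := (chart_dom (A1 i)).
Local Notation T := (unit + ('I_n + 'I_n))%type.
Let gJ := jet_atlas hM.
Implicit Types (U : set M1) (X Y Z : field) (p : M1) (i k : I) (a b c : 'I_n).

Definition adapted_frame i (t : T) : field :=
  match t with
  | inl _ => Xs
  | inr (inl a) => X_hor sigma i a
  | inr (inr a) => D_vel (phi := phi) i a
  end.

Definition adapted_coord (t : T) (c : E1) : R :=
  match t with
  | inl _ => c.1.1
  | inr (inl a) => c.1.2 0 a
  | inr (inr a) => c.2 0 a
  end.

Lemma vf_frame i t : vf (dom i) (adapted_frame i t).
Proof.
case: t => [t|[a|a]].
- exact: (vf_Xs hM hs (atlas_open gJ i)).
- exact: vf_X_hor.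
- exact: vf_D_vel.
Qed.

Lemma smooth_coord i t U X : oin U -> (forall p, U p -> dom i p) -> vf U X ->
  smooth_fun A1 U (fun p => adapted_coord t (adapted i X p)).
Proof.
move=> oU Ui hX; apply: (smooth_fun_chart gJ oU Ui) => m.
have hk := adapted_smooth hM hs i oU hX m; have oW := oU i.
have coord (f : E1 -> V) a : Ck m (A1 i @` (U `&` dom i)) f ->
    Ck m (A1 i @` (U `&` dom i)) (fun y => f y 0 a).
  have lin : linear (fun v : V => v 0 a) by move=> r u v; rewrite !mxE.
  pose L : {linear V -> R} :=
    HB.pack (fun v : V => v 0 a) (GRing.isLinear.Build _ _ _ _ _ lin).
  by apply: (Ck_lincomp (L := L) oW) => x; exact: coord_continuous.
have h : Ck m (A1 i @` (U `&` dom i))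
    (fun y => adapted_coord t (coord_rep (A1 i) (adapted i X) y)).
  case: t => [t|[a|a]] /=.
  - exact: Ck_fst oW (Ck_fst oW hk).
  - exact: coord (Ck_snd oW (Ck_fst oW hk)).
  - exact: coord (Ck_snd oW hk).
by apply: Ck_eq oW _ h => _ [q [_ dq] <-]; rewrite !(chart1_repE hM _ dq).
Qed.

Lemma adapted_frame_comb i p (r : T -> M1 -> R) : dom i p ->
  adapted i (\sum_t (fun q => r t q *: adapted_frame i t q)) p =
  (r (inl tt) p, \row_a r (inr (inl a)) p, \row_a r (inr (inr a)) p).
Proof.
move=> dp.
have e : (\sum_t (fun q => r t q *: adapted_frame i t q)) p i =
    \sum_t r t p *: adapted_frame i t p i by rewrite !fct_sumE.
apply: etrans (congr1 (adapt (F i) (A1 i p)) e) _.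
apply: etrans (raddf_sum (adapt (F i) (A1 i p)) _ _ _) _.
have eZ t : adapt (F i) (A1 i p) (r t p *: adapted_frame i t p i) =
    r t p *: adapted i (adapted_frame i t) p by exact: adaptZ.
apply: etrans (eq_bigr _ (fun t _ => eZ t)) _.
rewrite !big_sumType /= (bigD1 tt)//= big1 ?addr0; last by case.
have eH : \sum_(a < n) r (inr (inl a)) p *: adapted i (X_hor sigma i a) p =
    (0, \row_a r (inr (inl a)) p, 0).
  rewrite -sum_delta_hor; apply: eq_bigr => a _.
  by rewrite (adapted_X_hor sigma hM a dp) mxE.
have eD : \sum_(a < n) r (inr (inr a)) p *: adapted i (D_vel i a) p =
    (0, 0, \row_a r (inr (inr a)) p).
  rewrite -sum_delta_vel; apply: eq_bigr => a _.
  by rewrite (adapted_D_vel sigma hM a dp) mxE.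
rewrite eH eD (adapted_Xs sigma hM dp); congr ((_, _), _) => /=.
- by rewrite !addr0 [LHS]mulr1.
- by rewrite scaler0 add0r addr0.
- by rewrite scaler0 !add0r.
Qed.

Lemma frame_decomposition i U X : (forall p, U p -> dom i p) -> vf U X ->
  oin U ->
  eq_on A1 U X (\sum_t (fun p => adapted_coord t (adapted i X p) *:
    adapted_frame i t p)).
Proof.
move=> Ui hX oU p Up; have dp := Ui p Up.
have hfr t : vf U (adapted_frame i t).
  exact: vector_field_sub Ui (vf_frame i t).
have hS : vf U (\sum_t (fun p => adapted_coord t (adapted i X p) *:
  adapted_frame i t p)).
  apply: (vector_field_sum gJ oU) => t.
  exact: (vector_fieldZ gJ oU (smooth_coord t oU Ui hX) (hfr t)).
apply: (tangent_eq_at dp (hX.1 p Up) (hS.1 p Up)).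
apply: (adapted_inj (sigma := sigma)); rewrite (adapted_frame_comb _ dp) /=.
case: (adapted i X p) => [[x u] v]; congr ((_, _), _).
- by apply/rowP => a; rewrite mxE.
- by apply/rowP => a; rewrite mxE.
Qed.

Variables D D' : field -> field -> field.
Hypotheses (hD : linear_connection A1 D) (hD' : linear_connection A1 D').
Hypotheses (cD : chern_connection sigma D) (cD' : chern_connection sigma D').

Lemma chern_frame_agree i s t : eq_on A1 (dom i)
  (D (adapted_frame i s) (adapted_frame i t))
  (D' (adapted_frame i s) (adapted_frame i t)).
Proof.
have tr X Y Z : eq_on A1 (dom i) X Z -> eq_on A1 (dom i) Y Z -> eq_on A1 (dom
  i) X Y.
  by move=> e1 e2 p dp k dk; rewrite (e1 p dp k dk) (e2 p dp k dk).
case: t => [t|[a|a]].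
- have oi := atlas_open gJ i; have hs' := vf_frame i s.
  exact: tr (chern_X cD oi hs') (chern_X cD' oi hs').
- case: s => [s|[b|b]].
  + exact: tr (chern_X_hor cD a) (chern_X_hor cD' a).
  + exact: tr (chern_hor_hor cD a b) (chern_hor_hor cD' a b).
  + exact: tr (chern_vel_hor cD a b) (chern_vel_hor cD' a b).
- case: s => [s|[b|b]].
  + exact: tr (chern_X_vel cD a) (chern_X_vel cD' a).
  + exact: tr (chern_hor_vel cD a b) (chern_hor_vel cD' a b).
  + exact: tr (chern_vel_vel cD a b) (chern_vel_vel cD' a b).
Qed.

Lemma chern_agree : eq_connection A1 D D'.
Proof.
move=> U X Y oU hX hY p Up i dp.
pose W := U `&` dom i.
have oW : oin W by apply: (open_inI gJ oU); exact: atlas_open.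
have WU : W `<=` U by move=> q [].
have Wi q : W q -> dom i q by case.
have hXW := vector_field_sub WU hX; have hYW := vector_field_sub WU hY.
have eX := frame_decomposition Wi hXW oW.
have eY := frame_decomposition Wi hYW oW.
have hfr t : vf W (adapted_frame i t) by exact: vector_field_sub Wi (vf_frame i t).
have sX t := smooth_coord t oW Wi hXW; have sY t := smooth_coord t oW Wi hYW.
have hSX := vector_field_sum gJ oW (fun t => vector_fieldZ gJ oW (sX t) (hfr t)).
have hSY := vector_field_sum gJ oW (fun t => vector_fieldZ gJ oW (sY t) (hfr t)).
have Wp : W p by split.
rewrite (conn_local hD oW hXW hSX hYW hSY eX eY Wp dp).
rewrite (conn_local hD' oW hXW hSX hYW hSY eX eY Wp dp).
apply: (frame_agree gJ hD hD' oW hfr sX sY _ Wp dp) => s t.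
exact: eq_on_sub Wi (chern_frame_agree s t).
Qed.

End ChernFrame.

Theorem theorem4p1 (R : realType) (n : nat) (M : topologicalType) (I : Type)
    (phi : I -> chart M 'rV[R]_n) (hM : smooth_manifold phi)
    (hconn : connected [set: M])
    (sigma : jet phi 1 -> jet phi 2) (hsigma : sode sigma) :
  exists nabla, [/\ linear_connection (chart1 phi) nabla,
    characterized sigma nabla,
    (forall nabla', linear_connection (chart1 phi) nabla' ->
       characterized sigma nabla' ->
       eq_connection (chart1 phi) nabla' nabla),
    chern_connection sigma nabla &
    (forall nabla', linear_connection (chart1 phi) nabla' ->
       chern_connection sigma nabla' ->
       eq_connection (chart1 phi) nabla' nabla)].
Proof.
have hL := chern_nabla_connection hM hsigma; have hC :=
  chern_nabla_characterized hM hsigma.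
have hN := chern_nabla_is_chern hM hsigma.
exists (chern_nabla sigma); split=> // D hD cD.
- exact: characterized_agree hD cD hL hC.
- exact: (chern_agree hM hsigma hD hL cD hN).
Qed.
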